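(* Let $g$ be a metric that is asymptotically flat at null infinity in the sense of Newman and Unti, that is, in coordinates $(u,r,x^A)$, $x^A=(\zeta,\bar\zeta)$, it has the form $$ds^2=W\,du^2-2\,dr\,du+g_{AB}(dx^A-V^Adu)(dx^B-V^Bdu),$$ with the fall-off conditions recalled in the context. For every triple $(Y,\tilde T,\tilde\omega)$, where $Y=Y^A\partial_A$ is a conformal Killing vector of $\bar\gamma_{AB}$ (so that $Y^\zeta=Y(\zeta)$ and $Y^{\bar\zeta}=\bar Y(\bar\zeta)$), $\tilde T=\tilde T(\zeta,\bar\zeta)$ and $\tilde\omega=\tilde\omega(u,\zeta,\bar\zeta)$ are arbitrary functions, and all three are independent of the metric, let $\xi[Y,\tilde T,\tilde\omega;g]$ be the metric-dependent spacetime vector field with components $$\xi^u=f,\qquad \xi^A=Y^A-\partial_Bf\int_r^\infty dr'\,g^{AB},\qquad \xi^r=-r\,\partial_uf+\tfrac12\bar\Delta f+\partial_Af\int_r^\infty dr'\,V^A,$$ where $$f=e^{\tilde\varphi}\Big[\tilde T+\tfrac12\int_0^u du'\,e^{-\tilde\varphi}\,\tilde\psi\Big],\qquad \tilde\psi=\bar D_AY^A-2\tilde\omega .$$ Then these vector fields realize the extended $\mathfrak{bms}_4$ algebra in the modified Lie bracket $[\cdot,\cdot]_M$: for all triples $(Y_1,\tilde T_1,\tilde\omega_1)$ and $(Y_2,\tilde T_2,\tilde\omega_2)$, $$\Big[\xi[Y_1,\tilde T_1,\tilde\omega_1;g],\,\xi[Y_2,\tilde T_2,\tilde\omega_2;g]\Big]_M=\xi[\hat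 Y,\hat{\tilde T},\hat{\tilde\omega};g]$$ holds in the bulk of the spacetime (i.e. as an identity of vector fields at every point of the coordinate domain, not only asymptotically as $r\to\infty$), where $$\hat Y^A=Y_1^B\partial_BY_2^A-Y_2^B\partial_BY_1^A,$$ $$\hat{\tilde T}=Y_1^A\partial_A\tilde T_2-Y_2^A\partial_A\tilde T_1+\tfrac12\big(\tilde T_1\,\partial_AY_2^A-\tilde T_2\,\partial_AY_1^A\big),$$ $$\hat{\tilde\omega}=0 .$$
   Context: **Metrics.** Coordinates are $u$, $r$ and $x^A=(\zeta,\bar\zeta)$, with $\zeta=\cot\frac{\theta}{2}\,e^{i\phi}$ a stereographic coordinate; write $\partial=\partial_\zeta$, $\bar\partial=\partial_{\bar\zeta}$. A metric is asymptotically flat at null infinity in the sense of Newman and Unti if it has the form $$ds^2=W\,du^2-2\,dr\,du+g_{AB}(dx^A-V^Adu)(dx^B-V^Bdu),$$ where $W$, $V^A$, $g_{AB}$ are functions of $(u,r,x^A)$ such that, as $r\to\infty$: - $g_{AB}\,dx^Adx^B=r^2\bar\gamma_{AB}\,dx^Adx^B+r\,C_{AB}\,dx^Adx^B+o(r)$, where $\bar\gamma_{AB}$ and $C_{AB}$ do not depend on $r$, $\bar\gamma_{AB}dx^Adx^B=e^{2\tilde\varphi}\,d\zeta\,d\bar\zeta$ with $\tilde\varphi=\tilde\varphi(u,\zeta,\bar\zeta)$, and $C^A{}_A=\bar\gamma^{AB}C_{AB}=0$; - $V^A=O(r^{-2})$; - $W=-2r\,\partial_u\tilde\varphi+\bar\Delta\tilde\varphi+O(r^{-1})$.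 All functions are smooth, and the fall-off conditions are understood to be preserved under differentiation in the usual sense (derivatives along $u$, $x^A$ preserve the order in $r$, and derivatives along $r$ lower it by one). The quantity $g^{AB}$ denotes the inverse of the $2\times2$ matrix $g_{AB}$. $\bar D_A$ is the Levi-Civita covariant derivative of $\bar\gamma_{AB}$ (at fixed $u$) and $\bar\Delta$ its Laplacian, so $\bar\Delta h=4e^{-2\tilde\varphi}\,\partial\bar\partial h$ on functions. Thus $\bar D_AY^A=\partial_AY^A+2Y^A\partial_A\tilde\varphi$, where $\partial_AY^A=\partial Y+\bar\partial\bar Y$. Everything is local in $(\zeta,\bar\zeta)$. The $r$-independent data are real in the usual sense: $\tilde\varphi,\tilde T,\tilde\omega$ are real and $\bar Y$ is the complex conjugate of $Y$. **Origin of the vector fields.** The vectors $\xi[Y,\tilde T,\tilde\omega;g]$ generate the infinitesimal transformations that preserve the form of the metric and the fall-off conditions up to a rescaling of the conformal factor, $\delta\tilde\varphi=\tilde\omega$. **Modified Lie bracket.** For metric-dependent vector fields $\xi_1=\xi[Y_1,\tilde T_1,\tilde\omega_1;g]$ and $\xi_2=\xi[Y_2,\tilde T_2,\tilde\omega_2;g]$, where $\xi=\xi[Y,\tilde T,\tilde\omega;g]$ has components $\xi^u=f$, $\xi^A=Y^A-\partial_Bf\int_r^\infty dr'\,g^{AB}$, $\xi^r=-r\,\partial_uf+\tfrac12\bar\Delta f+\partial_Af\int_r^\infty dr'\,V^A$ with $f=e^{\tilde\varphi}\big[\tilde T+\tfrac12\int_0^u du'\,e^{-\tilde\varphi}(\bar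 D_AY^A-2\tilde\omega)\big]$, $$[\xi_1,\xi_2]_M=[\xi_1,\xi_2]-\delta^g_{\xi_1}\xi_2+\delta^g_{\xi_2}\xi_1,$$ where $[\xi_1,\xi_2]$ is the ordinary Lie bracket of vector fields ($[\xi_1,\xi_2]^\mu=\xi_1^\nu\partial_\nu\xi_2^\mu-\xi_2^\nu\partial_\nu\xi_1^\mu$) and $\delta^g_{\xi_1}\xi_2$ is the (linearized) variation of $\xi_2$ induced by the variation of the metric $\delta^g_{\xi_1}g_{\mu\nu}=\mathcal L_{\xi_1}g_{\mu\nu}$, with $\mathcal L$ the Lie derivative. The vector $\xi_2$ depends on the metric through $g^{AB}$, $V^A$ and $\tilde\varphi$ (the latter also entering $\bar D_A$ and $\bar\Delta$), while $Y^A,\tilde T,\tilde\omega$ are not varied; the induced variation of the conformal factor is $\delta^g_{\xi_1}\tilde\varphi=\tilde\omega_1$. **Extended $\mathfrak{bms}_4$ algebra.** This is the Lie algebra of triples $(Y,\tilde T,\tilde\omega)$ with bracket $[(Y_1,\tilde T_1,\tilde\omega_1),(Y_2,\tilde T_2,\tilde\omega_2)]=(\hat Y,\hat{\tilde T},\hat{\tilde\omega})$ given by the formulas in the claim: the semi-direct sum of the algebra of conformal Killing vectors $Y$ with the abelian ideal of supertranslations $\tilde T$, trivially extended by (in direct sum with) the abelian algebra of infinitesimal conformal rescalings $\tilde\omega$. *)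

(* Defs.v *)
From Stdlib Require Import Reals List ZArith.
From Coquelicot Require Import Coquelicot.

Open Scope R_scope.

(** * Coordinates *)

(** A point is [(u, r, zeta)] with [zeta] in [C]; the two coordinates
    [x^A = (zeta, conj zeta)] are both read off from [zeta]. *)
Definition pt : Type := (R * R * C)%type.
Definition pt_space : UniformSpace :=
  prod_UniformSpace (prod_UniformSpace R_UniformSpace R_UniformSpace)
    C_UniformSpace.

Definition pu (p : pt) : R := fst (fst p).
Definition pr (p : pt) : R := snd (fst p).
Definition pz (p : pt) : C := snd p.

Inductive ang : Set := hol | ahol.
Inductive idx : Set := iu | ir | ia (A : ang).
Coercion ia : ang >-> idx.

Definition abar (A : ang) : ang := match A with hol => ahol | ahol => hol end.
Definition ibar (m : idx) : idx := match m with ia A => ia (abar A) | _ => m end.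

Definition sum2 (F : ang -> C) : C := (F hol + F ahol)%C.
Definition sum4 (F : idx -> C) : C :=
  (F iu + F ir + sum2 (fun A => F (ia A)))%C.

Definition metric : Type := idx -> idx -> pt -> C.
Definition vfield : Type := idx -> pt -> C.

(** Functions of [(u, zeta)] or of [zeta] only, seen as functions on
    spacetime. *)
Definition lift_uz (F : R -> C -> C) : pt -> C := fun p => F (pu p) (pz p).
Definition lift_z (F : C -> C) : pt -> C := fun p => F (pz p).

(** * Partial derivatives *)

Inductive rdir : Set := du | dr | dx | dy.

Definition coord (i : rdir) (p : pt) : R :=
  match i with
  | du => pu p | dr => pr p | dx => Re (pz p) | dy => Im (pz p)
  end.

Definition set_coord (i : rdir) (p : pt) (t : R) : pt :=
  match i with
  | du => (t, pr p, pz p)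
  | dr => (pu p, t, pz p)
  | dx => (pu p, pr p, (t, Im (pz p)))
  | dy => (pu p, pr p, (Re (pz p), t))
  end.

Definition rpd (i : rdir) (F : pt -> C) (p : pt) : C :=
  (Derive (fun t => Re (F (set_coord i p t))) (coord i p),
   Derive (fun t => Im (F (set_coord i p t))) (coord i p)).

Definition ex_rpd (i : rdir) (F : pt -> C) (p : pt) : Prop :=
  ex_derive (fun t => Re (F (set_coord i p t))) (coord i p) /\
  ex_derive (fun t => Im (F (set_coord i p t))) (coord i p).

(** [d/dzeta] and [d/d(conj zeta)] are the Wirtinger derivatives. *)
Definition pd (m : idx) (F : pt -> C) (p : pt) : C :=
  match m with
  | iu => rpd du F p
  | ir => rpd dr F p
  | ia hol => (RtoC (/ 2) * (rpd dx F p - Ci * rpd dy F p))%C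
  | ia ahol => (RtoC (/ 2) * (rpd dx F p + Ci * rpd dy F p))%C
  end.

Definition pds (l : list idx) (F : pt -> C) : pt -> C := fold_right pd F l.

(** C-infinity on the (open) set [D]: iterated derivatives of all orders exist
    and are jointly continuous. *)
Definition smooth_on (D : pt -> Prop) (F : pt -> C) : Prop :=
  forall (l : list idx) (p : pt), D p ->
    (forall i : rdir, ex_rpd i (pds l F) p) /\
    @continuous pt_space C_UniformSpace (pds l F) p.

Definition real_on (D : pt -> Prop) (F : pt -> C) : Prop :=
  forall p, D p -> Cconj (F p) = F p.

(** * Coordinate domain and fall-off conditions *)

(** The domain reaches null infinity along every ray and contains the data
    needed for the integrals from [0] to [u] at fixed [zeta]. *)
Definition coordinate_domain (D : pt -> Prop) : Prop :=
  @open pt_space D /\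
  (forall u r r' z, D (u, r, z) -> r <= r' -> D (u, r', z)) /\
  (forall u r z u', D (u, r, z) -> Rmin 0 u <= u' <= Rmax 0 u ->
     exists r', D (u', r', z)).

(** [r -> oo], locally uniformly in [(u, zeta)]. *)
Definition near_scri (p : pt) : (R * C * R -> Prop) -> Prop :=
  filter_prod
    (@locally (prod_UniformSpace R_UniformSpace C_UniformSpace) (pu p, pz p))
    (Rbar_locally p_infty).

Fixpoint falloff_order (n : Z) (l : list idx) : Z :=
  match l with
  | nil => n
  | ir :: l' => (falloff_order n l' - 1)%Z
  | _ :: l' => falloff_order n l'
  end.

(** [F = O(r^n)], resp. [F = o(r^n)], preserved under differentiation: each
    [d/dr] lowers the order by one, other derivatives preserve it. *)
Definition bigO (D : pt -> Prop) (n : Z) (F : pt -> C) : Prop :=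
  forall (l : list idx) (p : pt), D p ->
    exists K : R, near_scri p (fun q =>
      Cmod (pds l F (fst (fst q), snd q, snd (fst q)))
        <= K * powerRZ (snd q) (falloff_order n l)).

Definition littleo (D : pt -> Prop) (n : Z) (F : pt -> C) : Prop :=
  forall (l : list idx) (p : pt), D p ->
    forall eps : R, 0 < eps -> near_scri p (fun q =>
      Cmod (pds l F (fst (fst q), snd q, snd (fst q)))
        <= eps * powerRZ (snd q) (falloff_order n l)).

(** * Geometry of the conformally flat metric [exp(2 phi) dzeta d(conj zeta)] *)

Definition det2 (m : ang -> ang -> C) : C :=
  (m hol hol * m ahol ahol - m hol ahol * m ahol hol)%C.

Definition inv2 (m : ang -> ang -> C) (A B : ang) : C :=
  match A, B with
  | hol, hol => (m ahol ahol / det2 m)%C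
  | ahol, ahol => (m hol hol / det2 m)%C
  | _, _ => (- m A B / det2 m)%C
  end.

Definition lift_R (phi : R -> C -> R) : pt -> C :=
  lift_uz (fun u z => RtoC (phi u z)).

Definition gam (phi : R -> C -> R) (A B : ang) (p : pt) : C :=
  match A, B with
  | hol, ahol | ahol, hol => RtoC (exp (2 * phi (pu p) (pz p)) / 2)
  | _, _ => RtoC 0
  end.

Definition laplacian (phi : R -> C -> R) (F : pt -> C) (p : pt) : C :=
  (RtoC (4 * exp (- 2 * phi (pu p) (pz p))) * pd hol (pd ahol F) p)%C.

Definition divergence (phi : R -> C -> R) (Y : ang -> C -> C) (p : pt) : C :=
  sum2 (fun A => pd A (lift_z (Y A)) p
                 + RtoC 2 * Y A (pz p) * pd A (lift_R phi) p)%C.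

Definition conformal_killing (D : pt -> Prop) (phi : R -> C -> R)
    (Y : ang -> C -> C) : Prop :=
  exists lambda : pt -> C, forall (A B : ang) (p : pt), D p ->
    sum2 (fun E => Y E (pz p) * pd E (gam phi A B) p
                   + gam phi E B p * pd A (lift_z (Y E)) p
                   + gam phi A E p * pd B (lift_z (Y E)) p)%C
    = (lambda p * gam phi A B p)%C.

(** * Newman-Unti metrics *)

(** [W du^2 - 2 dr du + h_AB (dx^A - V^A du) (dx^B - V^B du)]. *)
Definition nu_metric (W : pt -> C) (V : ang -> pt -> C)
    (h : ang -> ang -> pt -> C) : metric := fun m n p =>
  match m, n with
  | iu, iu =>
      (W p + sum2 (fun A => sum2 (fun B => h A B p * V A p * V B p)))%C
  | iu, ir | ir, iu => RtoC (- 1)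
  | iu, ia A | ia A, iu => (- sum2 (fun B => h A B p * V B p))%C
  | ia A, ia B => h A B p
  | ir, ir | ir, ia _ | ia _, ir => RtoC 0
  end.

Definition newman_unti (D : pt -> Prop) (W : pt -> C) (V : ang -> pt -> C)
    (h : ang -> ang -> pt -> C) : Prop :=
  (smooth_on D W /\ real_on D W) /\
  (forall A, smooth_on D (V A)) /\
  (forall A p, D p -> V (abar A) p = Cconj (V A p)) /\
  (forall A B, smooth_on D (h A B)) /\
  (forall A B p, D p -> h A B p = h B A p) /\
  (forall A B p, D p -> h (abar A) (abar B) p = Cconj (h A B p)) /\
  (forall p, D p -> det2 (fun A B => h A B p) <> RtoC 0) /\
  exists (phi : R -> C -> R) (S : ang -> ang -> R -> C -> C),
    smooth_on D (lift_R phi) /\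
    (forall A B, smooth_on D (lift_uz (S A B))) /\
    (forall A B, littleo D 1 (fun p =>
       h A B p - RtoC (pr p ^ 2) * gam phi A B p
       - RtoC (pr p) * S A B (pu p) (pz p))%C) /\
    (forall p, D p ->
       sum2 (fun A => sum2 (fun B =>
         inv2 (fun A' B' => gam phi A' B' p) A B * S A B (pu p) (pz p)))%C
       = RtoC 0) /\
    (forall A, bigO D (-2) (V A)) /\
    bigO D (-1) (fun p =>
      W p - (RtoC (- 2 * pr p) * pd iu (lift_R phi) p
             + laplacian phi (lift_R phi) p))%C.

(** Quantities read off from a metric in Newman-Unti form. *)

Definition ginv (g : metric) (A B : ang) (p : pt) : C :=
  inv2 (fun A' B' => g A' B' p) A B.

(** [g_uA = - g_AB V^B]. *)
Definition shift_of (g : metric) (A : ang) (p : pt) : C :=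
  (- sum2 (fun B => ginv g A B p * g iu (ia B) p))%C.

(** [exp(2 phi) / 2] is the limit of [g_{zeta, conj zeta} / r^2]. *)
Definition conformal_factor (g : metric) (u : R) (z : C) : R :=
  / 2 * ln (real (Lim (fun r => 2 * Re (g hol ahol (u, r, z)) / r ^ 2) p_infty)).

(** * The vector fields xi *)

Record triple : Type := Triple {
  tY : ang -> C -> C;
  tT : C -> C;
  tw : R -> C -> C }.

Definition admissible (D : pt -> Prop) (g : metric) (s : triple) : Prop :=
  (forall A, smooth_on D (lift_z (tY s A))) /\
  (forall A p, D p -> tY s (abar A) (pz p) = Cconj (tY s A (pz p))) /\
  conformal_killing D (conformal_factor g) (tY s) /\
  smooth_on D (lift_z (tT s)) /\ real_on D (lift_z (tT s)) /\
  smooth_on D (lift_uz (tw s)) /\ real_on D (lift_uz (tw s)).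

Definition psi (s : triple) (g : metric) (p : pt) : C :=
  (divergence (conformal_factor g) (tY s) p
   - RtoC 2 * tw s (pu p) (pz p))%C.

Definition xi_f (s : triple) (g : metric) (p : pt) : C :=
  (RtoC (exp (conformal_factor g (pu p) (pz p))) *
   (tT s (pz p) + RtoC (/ 2) *
      @RInt C_R_CompleteNormedModule (fun u' =>
        RtoC (exp (- conformal_factor g u' (pz p))) *
        psi s g (u', pr p, pz p)) 0 (pu p)))%C.

Definition int_to_scri (F : pt -> C) (p : pt) : C :=
  @RInt_gen C_R_CompleteNormedModule (fun r' => F (pu p, r', pz p))
    (at_point (pr p)) (Rbar_locally p_infty).

Definition xi (s : triple) (g : metric) : vfield := fun m p =>
  match m with
  | iu => xi_f s g p
  | ia A => (tY s A (pz p)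
             - sum2 (fun B => pd B (xi_f s g) p * int_to_scri (ginv g A B) p))%C
  | ir => (- RtoC (pr p) * pd iu (xi_f s g) p
           + RtoC (/ 2) * laplacian (conformal_factor g) (xi_f s g) p
           + sum2 (fun A => pd A (xi_f s g) p * int_to_scri (shift_of g A) p))%C
  end.

(** * Modified Lie bracket *)

Definition lie_bracket (X Y : vfield) : vfield := fun m p =>
  sum4 (fun n => X n p * pd n (Y m) p - Y n p * pd n (X m) p)%C.

Definition lie_derivative (X : vfield) (g : metric) : metric := fun m n p =>
  sum4 (fun k => X k p * pd k (g m n) p
                 + g k n p * pd m (X k) p
                 + g m k p * pd n (X k) p)%C.

(** [v] is the linearized variation (Gateaux derivative) on [D] of the
    metric-dependent vector field [F] at [g] in the direction [k]. *)
Definition is_variation (D : pt -> Prop) (F : metric -> vfield) (g k : metric)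
    (v : vfield) : Prop :=
  forall m p, D p ->
    @is_derive R_AbsRing C_R_NormedModule
      (fun eps : R =>
         F (fun m' n' q => g m' n' q + RtoC eps * k m' n' q)%C m p) 0 (v m p).

(** On [D], [Z = [X1, X2]_M] at [g]; in particular both variations exist. *)
Definition is_modified_bracket (D : pt -> Prop) (X1 X2 : metric -> vfield)
    (g : metric) (Z : vfield) : Prop :=
  exists v12 v21 : vfield,
    is_variation D X2 g (lie_derivative (X1 g) g) v12 /\
    is_variation D X1 g (lie_derivative (X2 g) g) v21 /\
    forall m p, D p ->
      (lie_bracket (X1 g) (X2 g) m p - v12 m p + v21 m p)%C = Z m p.

(** * The extended bms4 bracket *)

Definition dz (A : ang) (F : C -> C) (z : C) : C := pd A (lift_z F) (0, 0, z).

Definition bms_bracket (s1 s2 : triple) : triple := {|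
  tY := fun A z => sum2 (fun B =>
    tY s1 B z * dz B (tY s2 A) z - tY s2 B z * dz B (tY s1 A) z)%C;
  tT := fun z => (sum2 (fun A =>
    tY s1 A z * dz A (tT s2) z - tY s2 A z * dz A (tT s1) z)
    + RtoC (/ 2) * (tT s1 z * sum2 (fun A => dz A (tY s2 A) z)
                    - tT s2 z * sum2 (fun A => dz A (tY s1 A) z)))%C;
  tw := fun _ _ => RtoC 0 |}.

(* Main.v *)
Require Import Defs.
From Stdlib Require Import Reals List ZArith Lra Lia FunctionalExtensionality ClassicalEpsilon.
From Coquelicot Require Import Coquelicot.
Open Scope R_scope.

(** The components of [xi] satisfy the radial equations
    [d_r xi^u = 0], [d_r xi^A = g^{AB} d_B f], [d_r xi^r = - d_u f - V^A d_A f],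
    which express that the Lie derivative of the metric keeps the Newman-Unti gauge.
    The modified bracket of two such fields satisfies the radial equations with [f]
    replaced by its [u]-component: the variations of [g^{AB}] and [V^A] cancel against
    the Lie derivatives.  Hence the difference of the two sides is constant along every
    ray, and the fall-off conditions force it to vanish at null infinity; for [xi^r] this
    uses the expansion of [g_AB] and [W] to subleading order.  The [u]-components agree
    because both satisfy the same first-order equation in [u] and coincide on [u = 0]. *)

(** * Complex-valued functions of a real variable *)

(** Three obstacles shape the proof. The variation of [xi] is a Gateaux derivative along
    [g + eps k], taken through a limit (the conformal factor), a logarithm, the [u]-integral and the
    radial integrals. It is tractable because the angular part of [k] is [2 w r^2 gam] plus order
    [r]: the perturbed conformal factor is then exactly [phi + ln (1 + 2 eps w) / 2], while the
    perturbed inverse metric and shift are rational in [eps] with a denominator bounded away from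
    zero along a ray. The radial integral of the varied shift must converge. Its formula contains
    three terms of order [1/r], and these cancel only because [W] starts with [-2 r d_u phi] and the
    angular metric scales as [exp (2 phi)]. In the [r]-component both sides contain terms of order
    [r] and of order 1. These have to cancel identically before decay can be invoked; holomorphy of
    [Y] and the [u]-equation of [f] enter there. Data independent of [r] live on the cylinder over
    [D], because a segment from [u = 0] at fixed [r] may leave [D], though it never leaves the union
    of the rays meeting [D]. *)

Definition isd (f : R -> C) (x : R) (l : C) : Prop :=
  is_derive (fun t => Re (f t)) x (Re l) /\ is_derive (fun t => Im (f t)) x (Im l).

Lemma C_eq (z w : C) : Re z = Re w -> Im z = Im w -> z = w.
Proof. destruct z, w; simpl; intros; subst; reflexivity. Qed.

Lemma isd_eq f x l l' : isd f x l -> l = l' -> isd f x l'.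
Proof. intros H <-; exact H. Qed.

Lemma isd_unique f x l l' : isd f x l -> isd f x l' -> l = l'.
Proof.
  intros [A1 A2] [B1 B2]; apply C_eq.
  - rewrite <- (is_derive_unique _ _ _ A1); apply is_derive_unique, B1.
  - rewrite <- (is_derive_unique _ _ _ A2); apply is_derive_unique, B2.
Qed.

Lemma isd_const c x : isd (fun _ => c) x 0%C.
Proof. split; apply @is_derive_const. Qed.

Lemma isd_add (f g : R -> C) x (a b : C) : isd f x a -> isd g x b ->
  isd (fun t => f t + g t)%C x (a + b)%C.
Proof.
  intros [A1 A2] [B1 B2]; split; simpl.
  - apply (is_derive_plus _ _ _ _ _ A1 B1).
  - apply (is_derive_plus _ _ _ _ _ A2 B2).
Qed.

Lemma isd_mul (f g : R -> C) x (a b : C) : isd f x a -> isd g x b ->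
  isd (fun t => f t * g t)%C x (a * g x + f x * b)%C.
Proof.
  intros [A1 A2] [B1 B2]; split.
  - eapply is_derive_ext_loc; [ | evar_last;
      [ apply (is_derive_minus _ _ _ _ _
          (is_derive_mult _ _ _ _ _ A1 B1 Rmult_comm)
          (is_derive_mult _ _ _ _ _ A2 B2 Rmult_comm)) | ] ].
    + apply filter_forall; intros t; reflexivity.
    + unfold minus, plus, opp, mult, Re, Im; simpl; ring.
  - eapply is_derive_ext_loc; [ | evar_last;
      [ apply (is_derive_plus _ _ _ _ _
          (is_derive_mult _ _ _ _ _ A1 B2 Rmult_comm)
          (is_derive_mult _ _ _ _ _ A2 B1 Rmult_comm)) | ] ].
    + apply filter_forall; intros t; reflexivity.
    + unfold plus, mult, Re, Im; simpl; ring.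
Qed.

Lemma normsq_pos (z : C) : z <> 0%C -> 0 < Re z * Re z + Im z * Im z.
Proof.
  intros H. destruct (Req_dec (Re z) 0) as [E|E].
  - destruct (Req_dec (Im z) 0) as [E'|E'].
    + exfalso; apply H, C_eq; assumption.
    + nra.
  - nra.
Qed.

Lemma isd_inv (f : R -> C) x a : isd f x a -> f x <> 0%C ->
  isd (fun t => / f t)%C x (- a * (/ f x * / f x))%C.
Proof.
  intros [A1 A2] N. pose proof (normsq_pos _ N) as P.
  (* Both components of [1 / f] have the shape [g / (g^2 + h^2)]: the real part with [g = Re f],
     [h = Im f], the imaginary part, up to sign, with the two roles exchanged. *)
  assert (K : forall g h : R -> R, forall g' h', is_derive g x g' -> is_derive h x h' ->
    g x * g x + h x * h x <> 0 ->
    is_derive (fun t => g t / (g t ^ 2 + h t ^ 2)) x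
      ((g' * (g x ^ 2 + h x ^ 2) - g x * (2 * g x * g' + 2 * h x * h')) / (g x ^ 2 + h x ^ 2) ^ 2)).
  { intros g h g' h' G H Q.
    assert (D1 : ex_derive g x) by (eexists; exact G).
    assert (D2 : ex_derive h x) by (eexists; exact H).
    apply is_derive_unique in G; apply is_derive_unique in H.
    auto_derive; [ repeat split; auto; simpl; nra | ].
    change (fun t => g t) with g; change (fun t => h t) with h.
    rewrite G, H. field. simpl; nra. }
  assert (Q : Re (f x) * Re (f x) + Im (f x) * Im (f x) <> 0) by lra.
  split.
  - evar_last; [ apply (K _ _ _ _ A1 A2 Q) | ].
    destruct (f x) as [c d], a as [a b]; simpl in *. field. nra.
  - eapply is_derive_ext; [ intros t; reflexivity | ].
    evar_last; [ apply (is_derive_ext (fun t => opp (Im (f t) / (Im (f t) ^ 2 + Re (f t) ^ 2)))) | ].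
    + intros t; unfold Cinv, opp, Re, Im; simpl. unfold Rdiv. rewrite (Rplus_comm (_ * _)). ring.
    + apply @is_derive_opp, (K _ _ _ _ A2 A1); lra.
    + unfold opp; destruct (f x) as [c d], a as [a b]; simpl in *. field. nra.
Qed.

Lemma isd_comp_real (g g' : R -> R) (f : R -> R) x a :
  is_derive g (f x) (g' (f x)) -> isd (fun t => RtoC (f t)) x a ->
  isd (fun t => RtoC (g (f t))) x (RtoC (g' (f x)) * a)%C.
Proof.
  intros Hg [A1 A2]. destruct a as [a a']; unfold Re, Im in *; simpl in A1, A2.
  assert (E : a' = 0).
  { rewrite <- (is_derive_unique _ _ _ A2). apply is_derive_unique, @is_derive_const. }
  subst a'. split; unfold Re, Im; simpl.
  - evar_last; [ apply (is_derive_comp g f); [ exact Hg | exact A1 ] | ].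
    unfold scal; simpl; unfold mult; simpl. ring.
  - evar_last; [ apply @is_derive_const | ].
    unfold zero; simpl. ring.
Qed.

Lemma isd_ext_loc f g x l : locally x (fun t => f t = g t) -> isd f x l -> isd g x l.
Proof.
  intros H [A1 A2]; split.
  - eapply is_derive_ext_loc; [ | exact A1 ].
    eapply filter_imp; [ | exact H ]; simpl; intros t ->; reflexivity.
  - eapply is_derive_ext_loc; [ | exact A2 ].
    eapply filter_imp; [ | exact H ]; simpl; intros t ->; reflexivity.
Qed.

Lemma isd_ext f g x l : (forall t, f t = g t) -> isd f x l -> isd g x l.
Proof. intros H; apply isd_ext_loc, filter_forall, H. Qed.

(** * Coordinate boxes, open sets, continuity and partial derivatives on spacetime *)

Definition bx (p : pt) (d : R) (q : pt) : Prop :=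
  Rabs (pu q - pu p) < d /\ Rabs (pr q - pr p) < d /\
  Rabs (Re (pz q) - Re (pz p)) < d /\ Rabs (Im (pz q) - Im (pz p)) < d.

Definition opn (D : pt -> Prop) : Prop :=
  forall p, D p -> exists d, 0 < d /\ forall q, bx p d q -> D q.

Lemma ball_bx (p q : pt) d : @ball pt_space p d q <-> bx p d q.
Proof.
  destruct p as [[u r] [x y]], q as [[u' r'] [x' y']].
  split.
  - intros [[A B] [E F]]; repeat split; assumption.
  - intros (A & B & E & F); repeat split; assumption.
Qed.

Lemma opn_open D : @open pt_space D -> opn D.
Proof.
  intros H p Hp. destruct (H p Hp) as [e He].
  exists e; split; [ apply cond_pos | ].
  intros q Hq; apply He, ball_bx, Hq.
Qed.

Lemma set_coord_id i p : set_coord i p (coord i p) = p.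
Proof. destruct i, p as [[u r] [x y]]; reflexivity. Qed.

Lemma coord_set i p t : coord i (set_coord i p t) = t.
Proof. destruct i; reflexivity. Qed.

Lemma set_set i p t s : set_coord i (set_coord i p t) s = set_coord i p s.
Proof. destruct i; reflexivity. Qed.

Lemma set_coord_bx i p t d : Rabs (t - coord i p) < d -> 0 < d -> bx p d (set_coord i p t).
Proof.
  intros H Hd. destruct i, p as [[u r] [x y]]; unfold bx, coord, set_coord, pu, pr, pz, Re, Im in *; simpl in *;
    repeat split; try assumption;
    match goal with |- Rabs (?a - ?a) < _ => rewrite Rminus_diag, Rabs_R0; assumption end.
Qed.

Lemma opn_coord D i p : opn D -> D p -> locally (coord i p) (fun t => D (set_coord i p t)).
Proof.
  intros H Hp. destruct (H p Hp) as (d & d0 & Hd).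
  exists (mkposreal d d0); intros t Ht; apply Hd, set_coord_bx; assumption.
Qed.

Definition contR (g : pt -> R) (p : pt) : Prop := @continuous pt_space R_UniformSpace g p.
Definition cont (F : pt -> C) (p : pt) : Prop :=
  contR (fun q => Re (F q)) p /\ contR (fun q => Im (F q)) p.

Lemma contR_ext_on D f g p : opn D -> D p -> (forall q, D q -> f q = g q) ->
  contR f p -> contR g p.
Proof.
  intros O Hp E H. unfold contR in *.
  eapply continuous_ext_loc; [ | exact H ].
  destruct (O p Hp) as (d & d0 & Hd). exists (mkposreal d d0).
  intros q Hq. apply E, Hd, ball_bx, Hq.
Qed.

Lemma cont_ext_on D F G p : opn D -> D p -> (forall q, D q -> F q = G q) ->
  cont F p -> cont G p.
Proof.
  intros O Hp E [A B]; split.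
  - apply (contR_ext_on D (fun q => Re (F q))); auto; intros; rewrite E; auto.
  - apply (contR_ext_on D (fun q => Im (F q))); auto; intros; rewrite E; auto.
Qed.

Lemma contR_eps g p : contR g p ->
  forall e, 0 < e -> exists d, 0 < d /\ forall q, bx p d q -> Rabs (g q - g p) < e.
Proof.
  intros H e He.
  destruct (H (fun y => Rabs (y - g p) < e)) as [d Hd].
  - exists (mkposreal e He); intros y Hy; exact Hy.
  - exists d; split; [ apply cond_pos | ]. intros q Hq; apply Hd, ball_bx, Hq.
Qed.

Lemma contR_of_eps g p :
  (forall e, 0 < e -> exists d, 0 < d /\ forall q, bx p d q -> Rabs (g q - g p) < e) ->
  contR g p.
Proof.
  intros H P [e He]. destruct (H e (cond_pos e)) as (d & d0 & Hd).
  exists (mkposreal d d0); intros q Hq. apply He, Hd, ball_bx, Hq.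
Qed.

Lemma continuous_cont F p : @continuous pt_space C_UniformSpace F p -> cont F p.
Proof.
  intros H; split; apply contR_of_eps; intros e He;
  (destruct (H (fun y => @ball C_UniformSpace (F p) e y)) as [d Hd];
   [ exists (mkposreal e He); intros y Hy; exact Hy | ];
   exists d; split; [ apply cond_pos | ]; intros q Hq;
   destruct (Hd q (proj2 (ball_bx p q d) Hq)); assumption).
Qed.

Lemma cont_const c p : cont (fun _ => c) p.
Proof. split; apply continuous_const. Qed.

Lemma cont_add (F G : pt -> C) p : cont F p -> cont G p -> cont (fun q => F q + G q)%C p.
Proof.
  intros [A B] [E H]; split.
  - apply (continuous_plus (U:=pt_space) (V:=R_NormedModule) _ _ p A E).
  - apply (continuous_plus (U:=pt_space) (V:=R_NormedModule) _ _ p B H).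
Qed.

Lemma cont_mul (F G : pt -> C) p : cont F p -> cont G p -> cont (fun q => F q * G q)%C p.
Proof.
  intros [A B] [E H]; split.
  - apply (continuous_minus (U:=pt_space) (V:=R_NormedModule)
      (fun q => Re (F q) * Re (G q)) (fun q => Im (F q) * Im (G q))).
    + apply (continuous_mult (U:=pt_space) (K:=R_AbsRing) _ _ p A E).
    + apply (continuous_mult (U:=pt_space) (K:=R_AbsRing) _ _ p B H).
  - apply (continuous_plus (U:=pt_space) (V:=R_NormedModule)
      (fun q => Re (F q) * Im (G q)) (fun q => Im (F q) * Re (G q))).
    + apply (continuous_mult (U:=pt_space) (K:=R_AbsRing) _ _ p A H).
    + apply (continuous_mult (U:=pt_space) (K:=R_AbsRing) _ _ p B E).
Qed.

Lemma contR_comp (g : R -> R) f p : ex_derive g (f p) -> contR f p -> contR (fun q => g (f q)) p.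
Proof.
  intros Hg Hf.
  apply (continuous_comp (U:=pt_space) (V:=R_UniformSpace) (W:=R_UniformSpace) f g); auto.
  apply (ex_derive_continuous (K:=R_AbsRing) (V:=R_NormedModule) g), Hg.
Qed.

Lemma contR_inv (f : pt -> R) p : f p <> 0 -> contR f p -> contR (fun q => / f q) p.
Proof.
  intros N. apply (contR_comp Rinv). auto_derive; assumption.
Qed.

Lemma cont_inv (F : pt -> C) p : F p <> 0%C -> cont F p -> cont (fun q => / F q)%C p.
Proof.
  intros N [A B]. pose proof (normsq_pos _ N) as P.
  assert (S : contR (fun q => / (Re (F q) ^ 2 + Im (F q) ^ 2)) p).
  { apply contR_inv; [ simpl; nra | ].
    apply (continuous_plus (U:=pt_space) (V:=R_NormedModule)
      (fun q => Re (F q) ^ 2) (fun q => Im (F q) ^ 2)).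
    - apply (contR_comp (fun t => t ^ 2)); [ auto_derive; auto | exact A ].
    - apply (contR_comp (fun t => t ^ 2)); [ auto_derive; auto | exact B ]. }
  split; unfold Cinv; cbn [Re Im fst snd].
  - apply (continuous_mult (U:=pt_space) (K:=R_AbsRing) _ _ p A S).
  - apply (continuous_mult (U:=pt_space) (K:=R_AbsRing)
      (fun q => - Im (F q)) _ p); [ | exact S ].
    apply (continuous_opp (U:=pt_space) (V:=R_NormedModule) _ p B).
Qed.

Lemma ex_rpd_isd i F p : ex_rpd i F p ->
  isd (fun t => F (set_coord i p t)) (coord i p) (rpd i F p).
Proof. intros [A B]; split; apply Derive_correct; assumption. Qed.

Lemma isd_rpd i F p l : isd (fun t => F (set_coord i p t)) (coord i p) l ->
  ex_rpd i F p /\ rpd i F p = l.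
Proof.
  intros H. assert (E : ex_rpd i F p) by (destruct H; split; eexists; eassumption).
  split; [ exact E | ].
  eapply isd_unique; [ apply ex_rpd_isd, E | exact H ].
Qed.

Definition fadd (F G : pt -> C) : pt -> C := fun p => (F p + G p)%C.
Definition fmul (F G : pt -> C) : pt -> C := fun p => (F p * G p)%C.
Definition fcst (c : C) : pt -> C := fun _ => c.
Definition fopp (F : pt -> C) : pt -> C := fmul (fcst (-(1))%C) F.
Definition finv (F : pt -> C) : pt -> C := fun p => (/ F p)%C.

Lemma rpd_ext_on D i F G p : opn D -> D p -> (forall q, D q -> F q = G q) ->
  (ex_rpd i F p -> ex_rpd i G p) /\ rpd i F p = rpd i G p.
Proof.
  intros O Hp E.
  assert (L := opn_coord D i p O Hp).
  split.
  - intros [A B]; split.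
    + eapply ex_derive_ext_loc; [ | exact A ].
      eapply filter_imp; [ | exact L ]; simpl; intros t Ht; rewrite E; auto.
    + eapply ex_derive_ext_loc; [ | exact B ].
      eapply filter_imp; [ | exact L ]; simpl; intros t Ht; rewrite E; auto.
  - unfold rpd; f_equal; apply Derive_ext_loc;
      (eapply filter_imp; [ | exact L ]; simpl; intros t Ht; rewrite E; auto).
Qed.

Lemma rpd_cst i c p : ex_rpd i (fcst c) p /\ rpd i (fcst c) p = 0%C.
Proof. apply isd_rpd. exact (isd_const c (coord i p)). Qed.

Lemma rpd_add i F G p : ex_rpd i F p -> ex_rpd i G p ->
  ex_rpd i (fadd F G) p /\ rpd i (fadd F G) p = (rpd i F p + rpd i G p)%C.
Proof.
  intros A B. apply isd_rpd.
  exact (isd_add _ _ _ _ _ (ex_rpd_isd i F p A) (ex_rpd_isd i G p B)).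
Qed.

Lemma rpd_mul i F G p : ex_rpd i F p -> ex_rpd i G p ->
  ex_rpd i (fmul F G) p /\ rpd i (fmul F G) p = (rpd i F p * G p + F p * rpd i G p)%C.
Proof.
  intros A B. apply isd_rpd.
  eapply isd_eq; [ exact (isd_mul _ _ _ _ _ (ex_rpd_isd i F p A) (ex_rpd_isd i G p B)) | ].
  cbv beta. rewrite !set_coord_id; reflexivity.
Qed.

Lemma rpd_inv i (F : pt -> C) p : ex_rpd i F p -> F p <> 0%C ->
  ex_rpd i (finv F) p /\ rpd i (finv F) p = (- rpd i F p * (/ F p * / F p))%C.
Proof.
  intros A N. apply isd_rpd.
  eapply isd_eq; [ apply (isd_inv _ _ _ (ex_rpd_isd i F p A)) | ];
  cbv beta; rewrite !set_coord_id; auto.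
Qed.

Lemma rpd_comp_real i (g g' : R -> R) (f : pt -> R) p :
  is_derive g (f p) (g' (f p)) -> ex_rpd i (fun q => RtoC (f q)) p ->
  ex_rpd i (fun q => RtoC (g (f q))) p /\
  rpd i (fun q => RtoC (g (f q))) p = (RtoC (g' (f p)) * rpd i (fun q => RtoC (f q)) p)%C.
Proof.
  intros Hg A. apply isd_rpd.
  eapply isd_eq; [ eapply (isd_comp_real g g' (fun t => f (set_coord i p t))) | ].
  - rewrite set_coord_id; exact Hg.
  - apply (ex_rpd_isd i (fun q => RtoC (f q)) p A).
  - rewrite set_coord_id; reflexivity.
Qed.

(** * Differentiability classes with bounds *)

Definition base (D : pt -> Prop) (F : pt -> C) : Prop :=
  forall p, D p -> cont F p /\ forall i, ex_rpd i F p.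

Definition lower (i : rdir) (n : Z) : Z := match i with dr => (n - 1)%Z | _ => n end.

(** [F] is [k] times differentiable and the derivatives obey the bounds [B], each [d/dr]
    lowering the index by one.  The trivial [B] gives smooth functions, and bounds by powers of [r]
    give symbols; the calculus is common to both. *)
Fixpoint Ck (D : pt -> Prop) (B : Z -> (pt -> C) -> Prop) (k : nat) (n : Z)
    (F : pt -> C) : Prop :=
  base D F /\ B n F /\
  match k with
  | O => True
  | S k' => forall i, Ck D B k' (lower i n) (rpd i F)
  end.

Record bclass (D : pt -> Prop) (B : Z -> (pt -> C) -> Prop) : Prop := {
  bc_open : opn D;
  bc_ext : forall n F G, (forall p, D p -> F p = G p) -> B n F -> B n G;
  bc_add : forall n F G, B n F -> B n G -> B n (fadd F G);
  bc_mul : forall m n F G, B m F -> B n G -> B (m + n)%Z (fmul F G);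
  bc_zero : forall n, B n (fcst 0%C);
  bc_cst : forall c, B 0%Z (fcst c);
  bc_mono : forall m n F, (m <= n)%Z -> B m F -> B n F }.

Section Classes.
Context (D : pt -> Prop) (B : Z -> (pt -> C) -> Prop) (HB : bclass D B).

Lemma base_ext F G : (forall p, D p -> F p = G p) -> base D F -> base D G.
Proof.
  intros E H p Hp. destruct (H p Hp) as [A A'].
  pose proof (bc_open _ _ HB) as O. split.
  - apply (cont_ext_on D F); auto.
  - intros i. apply (rpd_ext_on D i F G p O Hp E), A'.
Qed.

Lemma Ck_ext k : forall n F G, (forall p, D p -> F p = G p) ->
  Ck D B k n F -> Ck D B k n G.
Proof.
  pose proof (bc_open _ _ HB) as O.
  induction k as [|k IH]; simpl; intros n F G E (A & Bd & H); (split; [ apply (base_ext F); auto | ]);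
    (split; [ apply (bc_ext _ _ HB n F); auto | ]); auto.
  intros i. apply (IH _ (rpd i F)); auto.
  intros p Hp. apply (rpd_ext_on D i F G p O Hp E).
Qed.

Lemma Ck_base k n F : Ck D B k n F -> base D F.
Proof. destruct k; intros (A & _); exact A. Qed.

Lemma Ck_bound k n F : Ck D B k n F -> B n F.
Proof. destruct k; intros (_ & A & _); exact A. Qed.

Lemma Ck_S k : forall n F, Ck D B (S k) n F -> Ck D B k n F.
Proof.
  induction k as [|k IH]; intros n F (A & Bd & H).
  - repeat split; try apply A; auto.
  - split; [ exact A | split; [ exact Bd | ] ]. intros i; apply IH, H.
Qed.

Lemma Ck_mono k : forall m n F, (m <= n)%Z -> Ck D B k m F -> Ck D B k n F.
Proof.
  induction k as [|k IH]; intros m n F L (A & Bd & H);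
    (split; [ exact A | split; [ apply (bc_mono _ _ HB m); auto | ] ]); auto.
  intros i; apply (IH (lower i m)); auto. destruct i; simpl; lia.
Qed.

Lemma base_cst c : base D (fcst c).
Proof. intros p _; split; [ apply cont_const | intros i; apply rpd_cst ]. Qed.

Lemma Ck_zero k : forall n, Ck D B k n (fcst 0%C).
Proof.
  induction k as [|k IH]; intros n; (split; [ apply base_cst | split; [ apply (bc_zero _ _ HB) | ] ]); auto.
  intros i. apply (Ck_ext _ _ (fcst 0%C)); auto.
  intros p _; symmetry; apply rpd_cst.
Qed.

Lemma Ck_cst k c : Ck D B k 0 (fcst c).
Proof.
  destruct k; (split; [ apply base_cst | split; [ apply (bc_cst _ _ HB) | ] ]); auto.
  intros i. apply (Ck_ext _ _ (fcst 0%C)); auto using Ck_zero.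
  intros p _; symmetry; apply rpd_cst.
Qed.

Lemma base_add F G : base D F -> base D G -> base D (fadd F G).
Proof.
  intros A A' p Hp. destruct (A p Hp) as [C1 E1], (A' p Hp) as [C2 E2]; split.
  - apply cont_add; assumption.
  - intros i; apply rpd_add; auto.
Qed.

Lemma base_mul F G : base D F -> base D G -> base D (fmul F G).
Proof.
  intros A A' p Hp. destruct (A p Hp) as [C1 E1], (A' p Hp) as [C2 E2]; split.
  - apply cont_mul; assumption.
  - intros i; apply rpd_mul; auto.
Qed.

Lemma Ck_add k : forall n F G, Ck D B k n F -> Ck D B k n G -> Ck D B k n (fadd F G).
Proof.
  induction k as [|k IH]; intros n F G (A & Bd & H) (A' & Bd' & H');
  (split; [ apply base_add; auto | split; [ apply (bc_add _ _ HB); auto | ] ]); auto.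
  intros i. apply (Ck_ext _ _ (fadd (rpd i F) (rpd i G))); auto.
  intros p Hp. symmetry. apply rpd_add; [ apply A | apply A' ]; auto.
Qed.

Lemma lower_add_l i m n : (lower i m + n = lower i (m + n))%Z.
Proof. destruct i; simpl; lia. Qed.
Lemma lower_add_r i m n : (m + lower i n = lower i (m + n))%Z.
Proof. destruct i; simpl; lia. Qed.

Lemma Ck_mul k : forall m n F G, Ck D B k m F -> Ck D B k n G -> Ck D B k (m + n) (fmul F G).
Proof.
  induction k as [|k IH]; intros m n F G H1 H2;
  pose proof H1 as (A & Bd & H); pose proof H2 as (A' & Bd' & H');
  (split; [ apply base_mul; auto | split; [ apply (bc_mul _ _ HB); auto | ] ]); auto.
  intros i. apply (Ck_ext _ _ (fadd (fmul (rpd i F) G) (fmul F (rpd i G)))).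
  - intros p Hp. symmetry. apply rpd_mul; [ apply A | apply A' ]; auto.
  - apply Ck_add.
    + rewrite <- lower_add_l. apply IH; [ apply H | apply Ck_S, H2 ].
    + rewrite <- lower_add_r. apply IH; [ apply Ck_S, H1 | apply H' ].
Qed.

Lemma Ck_opp k n F : Ck D B k n F -> Ck D B k n (fopp F).
Proof.
  intros H. unfold fopp. replace n with (0 + n)%Z by lia.
  apply Ck_mul; auto using Ck_cst.
Qed.

(** Only the bound on [finv F] itself has to be supplied. A derivative of [1 / F] is [- F'] times
    the square of [1 / F]; the induction hypothesis bounds the square, and the orders add up to the
    right one. The derivative [F'] uses up one degree of regularity, hence the assumption on [F] at
    every [k]. *)
Lemma Ck_inv k : forall n (F : pt -> C), (forall k, Ck D B k n F) -> (forall p, D p -> F p <> 0%C) ->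
  B (- n)%Z (finv F) -> Ck D B k (- n) (finv F).
Proof.
  intros n F HF N HI.
  assert (Bs : base D (finv F)).
  { intros p Hp. destruct (Ck_base _ _ _ (HF O) p Hp) as [C1 E1]. split.
    - apply cont_inv; auto.
    - intros i; apply rpd_inv; auto. }
  induction k as [|k IH]; (split; [ exact Bs | split; [ exact HI | ] ]); auto.
  intros i.
  apply (Ck_ext _ _ (fmul (fopp (rpd i F)) (fmul (finv F) (finv F)))).
  - intros p Hp. symmetry.
    destruct (rpd_inv i F p) as [_ E]; auto.
    + apply (Ck_base _ _ _ (HF O)); auto.
    + rewrite E. unfold fmul, fopp, fmul, fcst, finv. ring.
  - replace (lower i (- n)) with (lower i n + (- n + - n))%Z by (destruct i; simpl; lia).
    apply Ck_mul; [ | apply Ck_mul; exact IH ].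
    apply Ck_opp. destruct (HF (S k)) as (_ & _ & H). apply H.
Qed.

Definition symbol (n : Z) (F : pt -> C) : Prop := forall k, Ck D B k n F.
End Classes.

(** * Smooth functions and symbols at null infinity *)

Definition TB (_ : Z) (_ : pt -> C) : Prop := True.

Lemma TB_bclass D : opn D -> bclass D TB.
Proof. intros H; split; unfold TB; auto. Qed.

Record dom (D : pt -> Prop) : Prop := {
  dom_open : opn D;
  dom_up : forall p q, D p -> pu q = pu p -> pz q = pz p -> pr p <= pr q -> D q }.

Definition nearuz (p : pt) (d : R) (q : pt) : Prop :=
  Rabs (pu q - pu p) < d /\
  Rabs (Re (pz q) - Re (pz p)) < d /\ Rabs (Im (pz q) - Im (pz p)) < d.

(** [near_scri] as a box condition on points of spacetime. *)
Definition nsc (p : pt) (P : pt -> Prop) : Prop :=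
  exists d M, 0 < d /\ 1 <= M /\ forall q, nearuz p d q -> M < pr q -> P q.

Lemma nsc_imp p (P Q : pt -> Prop) : (forall q, P q -> Q q) -> nsc p P -> nsc p Q.
Proof. intros H (d & M & A & B & E); exists d, M; auto. Qed.

Lemma nsc_and p (P Q : pt -> Prop) : nsc p P -> nsc p Q -> nsc p (fun q => P q /\ Q q).
Proof.
  intros (d & M & A & B & E) (d' & M' & A' & B' & E').
  exists (Rmin d d'), (Rmax M M'); split; [ apply Rmin_glb_lt; auto | ].
  split; [ eapply Rle_trans; [ exact B | apply Rmax_l ] | ].
  intros q (H1 & H2 & H3) H4.
  pose proof (Rmin_l d d'); pose proof (Rmin_r d d').
  pose proof (Rmax_l M M'); pose proof (Rmax_r M M').
  split; [ apply E | apply E' ]; unfold nearuz; repeat split; lra.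
Qed.

Lemma nsc_r p M : nsc p (fun q => 1 <= pr q /\ M < pr q).
Proof.
  exists 1, (Rmax 1 M); split; [ lra | ]; split; [ apply Rmax_l | ].
  intros q _ H. pose proof (Rmax_l 1 M); pose proof (Rmax_r 1 M); lra.
Qed.

Lemma nsc_D D p : dom D -> D p -> nsc p D.
Proof.
  intros HD Hp. destruct (dom_open _ HD p Hp) as (d & d0 & H).
  exists d, (Rmax 1 (pr p)); split; auto; split; [ apply Rmax_l | ].
  intros q (A & B & E) L. pose proof (Rmax_r 1 (pr p)).
  apply (dom_up _ HD (pu q, pr p, pz q)); try reflexivity; [ | cbn; lra ].
  apply H; unfold bx; cbn; repeat split; auto.
  rewrite Rminus_diag, Rabs_R0; exact d0.
Qed.

Lemma nsc_ray p P : nsc p P -> exists M, 1 <= M /\ forall r, M < r -> P (pu p, r, pz p).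
Proof.
  intros (d & M & A & B & E); exists M; split; auto; intros r Hr; apply E; auto.
  repeat split; cbn; rewrite Rminus_diag, Rabs_R0; exact A.
Qed.

(** The constant is uniform for [(u, zeta)] near those of [p]. This uniformity is what permits
    differentiating radial integrals with respect to [u] and [zeta]. *)
Definition SB (D : pt -> Prop) (n : Z) (F : pt -> C) : Prop :=
  forall p, D p -> exists K, 0 <= K /\
    nsc p (fun q => Cmod (F q) <= K * powerRZ (pr q) n).

Lemma powerRZ_mono x m n : 1 <= x -> (m <= n)%Z -> powerRZ x m <= powerRZ x n.
Proof.
  intros Hx L. replace n with (m + (n - m))%Z by lia.
  rewrite powerRZ_add by lra.
  assert (0 < powerRZ x m) by (apply powerRZ_lt; lra).
  assert (1 <= powerRZ x (n - m)).
  { replace (n - m)%Z with (Z.of_nat (Z.to_nat (n - m))) by (rewrite Z2Nat.id; lia).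
    rewrite <- pow_powerRZ. apply pow_R1_Rle; lra. }
  nra.
Qed.

Lemma SB_bclass D : dom D -> bclass D (SB D).
Proof.
  intros HD; split.
  - apply HD.
  - intros n F G E H p Hp. destruct (H p Hp) as (K & K0 & HK). exists K; split; auto.
    generalize (nsc_and _ _ _ HK (nsc_D D p HD Hp)). apply nsc_imp.
    intros q [A B]; rewrite <- E; auto.
  - intros n F G H H' p Hp. destruct (H p Hp) as (K & K0 & HK), (H' p Hp) as (K' & K0' & HK').
    exists (K + K'); split; [ lra | ].
    generalize (nsc_and _ _ _ HK HK'). apply nsc_imp. intros q [A B].
    unfold fadd. eapply Rle_trans; [ apply Cmod_triangle | ]. lra.
  - intros m n F G H H' p Hp. destruct (H p Hp) as (K & K0 & HK), (H' p Hp) as (K' & K0' & HK').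
    exists (K * K'); split; [ apply Rmult_le_pos; auto | ].
    generalize (nsc_and _ _ _ (nsc_r p 1) (nsc_and _ _ _ HK HK')). apply nsc_imp.
    intros q [[L _] [A B]].
    unfold fmul. rewrite Cmod_mult, powerRZ_add by lra.
    replace (K * K' * _) with ((K * powerRZ (pr q) m) * (K' * powerRZ (pr q) n)) by ring.
    apply Rmult_le_compat; auto; apply Cmod_ge_0.
  - intros n p Hp. exists 0; split; [ lra | ]. generalize (nsc_r p 1); apply nsc_imp.
    intros q _. unfold fcst; rewrite Cmod_0; lra.
  - intros c p Hp. exists (Cmod c); split; [ apply Cmod_ge_0 | ].
    generalize (nsc_r p 1); apply nsc_imp. intros q _. unfold fcst; simpl; lra.
  - intros m n F L H p Hp. destruct (H p Hp) as (K & K0 & HK). exists K; split; auto.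
    generalize (nsc_and _ _ _ HK (nsc_r p 1)). apply nsc_imp.
    intros q [A [B _]]. eapply Rle_trans; [ exact A | ].
    apply Rmult_le_compat_l; auto. apply powerRZ_mono; auto.
Qed.

Lemma near_scri_nsc p (P : R * C * R -> Prop) :
  near_scri p P -> nsc p (fun q => P (pu q, pz q, pr q)).
Proof.
  intros [Q S [d HQ] [M HM] H].
  exists d, (Rmax 1 M); split; [ apply cond_pos | split; [ apply Rmax_l | ] ].
  intros q (A & B & E) L. apply H.
  - apply HQ. repeat split; assumption.
  - apply HM. pose proof (Rmax_r 1 M); lra.
Qed.

Definition smooth (D : pt -> Prop) (F : pt -> C) : Prop := symbol D TB 0 F.
Definition symb (D : pt -> Prop) (n : Z) (F : pt -> C) : Prop := symbol D (SB D) n F.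

Lemma Ck_TB D k : forall m n F, Ck D TB k m F -> Ck D TB k n F.
Proof.
  induction k as [|k IH]; intros m n F (A & _ & H);
    (split; [ exact A | split; [ exact I | ] ]); [ exact I | ].
  intros i; eapply IH, H.
Qed.

Lemma Ck_to_TB D B k : forall n F, Ck D B k n F -> Ck D TB k n F.
Proof.
  induction k as [|k IH]; intros n F (A & _ & H);
    (split; [ exact A | split; [ exact I | ] ]); [ exact I | ].
  intros i; apply IH, H.
Qed.

Lemma symb_smooth D n F : symb D n F -> smooth D F.
Proof. intros H k. eapply Ck_TB, Ck_to_TB, H. Qed.

Lemma rpd_of_pd i F : rpd i F = match i with
  | du => pd iu F | dr => pd ir F
  | dx => fadd (pd hol F) (pd ahol F)
  | dy => fmul (fcst Ci) (fadd (pd hol F) (fopp (pd ahol F))) end.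
Proof.
  destruct i; auto; apply functional_extensionality; intros p;
    unfold fadd, fopp, fmul, fcst, fmul; simpl;
    generalize (rpd dx F p) (rpd dy F p); intros [a b] [c d];
    apply injective_projections; simpl; field.
Qed.

Definition lowerm (m : idx) (n : Z) : Z := match m with ir => (n - 1)%Z | _ => n end.

Lemma pds_app l m F : pds (l ++ m :: nil) F = pds l (pd m F).
Proof. unfold pds. rewrite fold_right_app. reflexivity. Qed.

Lemma falloff_app l m n : falloff_order n (l ++ m :: nil) = falloff_order (lowerm m n) l.
Proof.
  induction l as [|a l IH]; simpl; [ destruct m; reflexivity | ].
  destruct a; rewrite IH; reflexivity.
Qed.

(** The hypotheses on a metric are stated for words in [pd], the classes are built from the real
    partials [rpd]; inverting the Wirtinger relations passes from one to the other. The induction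
    removes the innermost letter of a word, which is why words are extended on the right. *)
Lemma Ck_of_pds D B (HB : bclass D B) k : forall n F, (forall l, base D (pds l F)) ->
  (forall l, B (falloff_order n l) (pds l F)) -> Ck D B k n F.
Proof.
  induction k as [|k IH]; intros n F HS HF;
    (split; [ apply (HS nil) | split; [ apply (HF nil) | ] ]); auto.
  assert (X : forall m, Ck D B k (lowerm m n) (pd m F)).
  { intros m; apply IH; intros l; rewrite <- pds_app; [ apply HS | rewrite <- falloff_app; apply HF ]. }
  intros i. rewrite rpd_of_pd. destruct i; simpl.
  - apply (X iu).
  - apply (X ir).
  - apply Ck_add; auto; [ apply (X hol) | apply (X ahol) ].
  - replace n with (0 + n)%Z by lia. apply Ck_mul; auto; [ apply Ck_cst; auto | ].
    apply Ck_add; auto; [ apply (X hol) | ]. apply Ck_opp; auto; apply (X ahol).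
Qed.

Lemma smooth_of_smooth_on D F : opn D -> smooth_on D F -> smooth D F.
Proof.
  intros O H k. apply Ck_of_pds; auto using TB_bclass; [ | intros; exact I ].
  intros l p Hp. destruct (H l p Hp) as [A E]. split; auto. apply continuous_cont, E.
Qed.

Lemma bigO_of_littleo D n F : littleo D n F -> bigO D n F.
Proof. intros H l p Hp. exists 1. apply H; auto; lra. Qed.

Lemma pd_rpd m F : pd m F = match m with
  | iu => rpd du F | ir => rpd dr F
  | ia hol => fmul (fcst (RtoC (/ 2))) (fadd (rpd dx F) (fmul (fcst (- Ci)%C) (rpd dy F)))
  | ia ahol => fmul (fcst (RtoC (/ 2))) (fadd (rpd dx F) (fmul (fcst Ci) (rpd dy F))) end.
Proof.
  destruct m as [| |[|]]; auto; apply functional_extensionality; intros p;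
    unfold fadd, fmul, fcst; simpl; ring.
Qed.

Section Rules.
Context (D : pt -> Prop) (B : Z -> (pt -> C) -> Prop) (HB : bclass D B).

Lemma symbol_ext n F G : (forall p, D p -> F p = G p) -> symbol D B n F -> symbol D B n G.
Proof. intros E H k. apply (Ck_ext D B HB k n F); auto. Qed.
Lemma symbol_add n F G : symbol D B n F -> symbol D B n G -> symbol D B n (fadd F G).
Proof. intros H H' k; apply Ck_add; auto. Qed.
Lemma symbol_mul m n F G : symbol D B m F -> symbol D B n G -> symbol D B (m + n) (fmul F G).
Proof. intros H H' k; apply Ck_mul; auto. Qed.
Lemma symbol_opp n F : symbol D B n F -> symbol D B n (fopp F).
Proof. intros H k; apply Ck_opp; auto. Qed.
Lemma symbol_cst c : symbol D B 0 (fcst c).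
Proof. intros k; apply Ck_cst; auto. Qed.
Lemma symbol_mono m n F : (m <= n)%Z -> symbol D B m F -> symbol D B n F.
Proof. intros L H k. apply (Ck_mono D B HB k m); auto. Qed.
Lemma symbol_rpd i n F : symbol D B n F -> symbol D B (lower i n) (rpd i F).
Proof. intros H k. destruct (H (S k)) as (_ & _ & X). apply X. Qed.
Lemma symbol_base n F : symbol D B n F -> base D F.
Proof. intros H; apply (Ck_base _ _ _ _ _ (H O)). Qed.
Lemma symbol_inv n F : symbol D B n F -> (forall p, D p -> F p <> 0%C) ->
  B (- n)%Z (finv F) -> symbol D B (- n) (finv F).
Proof. intros H N HI k; apply Ck_inv; auto. Qed.

Lemma symbol_pd m n F : symbol D B n F -> symbol D B (lowerm m n) (pd m F).
Proof.
  intros H. rewrite pd_rpd. pose proof (fun i => symbol_rpd i n F H) as X.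
  destruct m as [| |[|]]; simpl.
  - apply (X du).
  - apply (X dr).
  - replace n with (0 + n)%Z by lia. apply symbol_mul; [ apply symbol_cst | ].
    apply symbol_add; [ apply (X dx) | ].
    replace n with (0 + n)%Z by lia. apply symbol_mul; [ apply symbol_cst | apply (X dy) ].
  - replace n with (0 + n)%Z by lia. apply symbol_mul; [ apply symbol_cst | ].
    apply symbol_add; [ apply (X dx) | ].
    replace n with (0 + n)%Z by lia. apply symbol_mul; [ apply symbol_cst | apply (X dy) ].
Qed.

Lemma base_rpd n F p : symbol D B n F -> D p -> forall i, ex_rpd i F p.
Proof. intros H Hp. apply (symbol_base n F H p Hp). Qed.

Lemma symbol_pd_add m n n' F G p : symbol D B n F -> symbol D B n' G -> D p ->
  pd m (fadd F G) p = (pd m F p + pd m G p)%C.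
Proof.
  intros H H' Hp. pose proof (base_rpd _ _ p H Hp) as A; pose proof (base_rpd _ _ p H' Hp) as A'.
  assert (X : forall i, rpd i (fadd F G) p = (rpd i F p + rpd i G p)%C)
    by (intros i; apply rpd_add; auto).
  destruct m as [| |[|]]; simpl; rewrite ?X; auto; ring.
Qed.

Lemma symbol_pd_mul m n n' F G p : symbol D B n F -> symbol D B n' G -> D p ->
  pd m (fmul F G) p = (pd m F p * G p + F p * pd m G p)%C.
Proof.
  intros H H' Hp. pose proof (base_rpd _ _ p H Hp) as A; pose proof (base_rpd _ _ p H' Hp) as A'.
  assert (X : forall i, rpd i (fmul F G) p = (rpd i F p * G p + F p * rpd i G p)%C)
    by (intros i; apply rpd_mul; auto).
  destruct m as [| |[|]]; simpl; rewrite ?X; auto; ring.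
Qed.

Lemma symbol_pd_inv m n F p : symbol D B n F -> D p -> F p <> 0%C ->
  pd m (finv F) p = (- pd m F p * (/ F p * / F p))%C.
Proof.
  intros H Hp N. pose proof (base_rpd _ _ p H Hp) as A.
  assert (X : forall i, rpd i (finv F) p = (- rpd i F p * (/ F p * / F p))%C)
    by (intros i; apply rpd_inv; auto).
  destruct m as [| |[|]]; simpl; rewrite ?X; auto; ring.
Qed.

Lemma symbol_pd_comp_real m n (g g' : R -> R) (f : pt -> R) p :
  symbol D B n (fun q => RtoC (f q)) -> D p -> is_derive g (f p) (g' (f p)) ->
  pd m (fun q => RtoC (g (f q))) p = (RtoC (g' (f p)) * pd m (fun q => RtoC (f q)) p)%C.
Proof.
  intros H Hp N. pose proof (base_rpd _ _ p H Hp) as A.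
  assert (X : forall i, rpd i (fun q => RtoC (g (f q))) p = (RtoC (g' (f p)) * rpd i (fun q => RtoC (f q)) p)%C)
    by (intros i; apply rpd_comp_real; auto).
  destruct m as [| |[|]]; simpl; rewrite ?X; auto; ring.
Qed.

Lemma pd_ext_on m F G p : (forall q, D q -> F q = G q) -> D p -> pd m F p = pd m G p.
Proof.
  intros E Hp.
  assert (X : forall i, rpd i F p = rpd i G p)
    by (intros i; apply (rpd_ext_on D i F G p (bc_open _ _ HB) Hp E)).
  destruct m as [| |[|]]; simpl; rewrite ?X; auto.
Qed.

End Rules.

Lemma pd_cst m c p : pd m (fcst c) p = 0%C.
Proof.
  assert (X : forall i, rpd i (fcst c) p = 0%C) by (intros i; apply rpd_cst).
  destruct m as [| |[|]]; simpl; rewrite ?X; auto; ring.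
Qed.

(** * Symmetry of second derivatives *)

Lemma set_swap i j p s t : i <> j ->
  set_coord i (set_coord j p t) s = set_coord j (set_coord i p s) t.
Proof. destruct i, j; intros N; try congruence; reflexivity. Qed.

Lemma coord_swap i j p t : i <> j -> coord i (set_coord j p t) = coord i p.
Proof. destruct i, j; intros N; try congruence; reflexivity. Qed.

Lemma set_set_bx i j p d s t : i <> j -> Rabs (s - coord i p) < d -> Rabs (t - coord j p) < d ->
  0 < d -> bx p d (set_coord j (set_coord i p s) t).
Proof.
  intros N A A' d0. assert (Z : forall a, Rabs (a - a) < d)
    by (intros a; rewrite Rminus_diag, Rabs_R0; exact d0).
  destruct i, j; try congruence; unfold bx, coord, set_coord, pu, pr, pz, Re, Im in *; simpl in *; auto.
Qed.

(** The two-dimensional statement [Schwarz] is applied to the restriction of [f] to the coordinate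
    plane through [p] in directions [i] and [j], parametrized by [Q]. *)
Lemma schwarz_real (D : pt -> Prop) (f fi fj fij fji : pt -> R) i j p : opn D -> D p -> i <> j ->
  (forall q, D q -> is_derive (fun t => f (set_coord i q t)) (coord i q) (fi q)) ->
  (forall q, D q -> is_derive (fun t => f (set_coord j q t)) (coord j q) (fj q)) ->
  (forall q, D q -> is_derive (fun t => fj (set_coord i q t)) (coord i q) (fij q)) ->
  (forall q, D q -> is_derive (fun t => fi (set_coord j q t)) (coord j q) (fji q)) ->
  contR fij p -> contR fji p -> fij p = fji p.
Proof.
  intros O Hp N Hi Hj Hij Hji Cij Cji.
  set (Q := fun s t => set_coord j (set_coord i p s) t).
  assert (N' : j <> i) by congruence.
  assert (ci : forall s t, coord i (Q s t) = s)
    by (intros; unfold Q; rewrite coord_swap, coord_set; auto).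
  assert (cj : forall s t, coord j (Q s t) = t) by (intros; unfold Q; apply coord_set).
  assert (si : forall s t s', set_coord i (Q s t) s' = Q s' t)
    by (intros; unfold Q; rewrite (set_swap i j), set_set; auto).
  assert (sj : forall s t t', set_coord j (Q s t) t' = Q s t')
    by (intros; unfold Q; apply set_set).
  assert (Q0 : Q (coord i p) (coord j p) = p) by (unfold Q; rewrite !set_coord_id; auto).
  assert (Gi : forall (g g' : pt -> R) s t, (forall q, D q -> is_derive (fun t => g (set_coord i q t)) (coord i q) (g' q)) ->
     D (Q s t) -> is_derive (fun s' => g (Q s' t)) s (g' (Q s t))).
  { intros g g' s t H Hq. pose proof (H _ Hq) as G. rewrite ci in G.
    eapply is_derive_ext; [ | exact G ]. intros; simpl; rewrite si; auto. }
  assert (Gj : forall (g g' : pt -> R) s t, (forall q, D q -> is_derive (fun t => g (set_coord j q t)) (coord j q) (g' q)) ->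
     D (Q s t) -> is_derive (fun t' => g (Q s t')) t (g' (Q s t))).
  { intros g g' s t H Hq. pose proof (H _ Hq) as G. rewrite cj in G.
    eapply is_derive_ext; [ | exact G ]. intros; simpl; rewrite sj; auto. }
  destruct (O p Hp) as (d & d0 & Hd).
  assert (L : forall s t, Rabs (s - coord i p) < d -> Rabs (t - coord j p) < d -> D (Q s t))
    by (intros; apply Hd, set_set_bx; auto).
  (* A point near (s,t) still lies in the box, so inner derivatives may be replaced locally. *)
  assert (Loc1 : forall s t, Rabs (s - coord i p) < d -> Rabs (t - coord j p) < d ->
     locally s (fun s' => D (Q s' t))).
  { intros s t A A'.
    assert (P : 0 < d - Rabs (s - coord i p)) by lra.
    exists (mkposreal _ P); intros s' Hs'. apply L; auto.
    change (Rabs (s' - s) < d - Rabs (s - coord i p)) in Hs'.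
    replace (s' - coord i p) with ((s' - s) + (s - coord i p)) by ring.
    eapply Rle_lt_trans; [ apply Rabs_triang | lra ]. }
  assert (Loc2 : forall s t, Rabs (s - coord i p) < d -> Rabs (t - coord j p) < d ->
     locally t (fun t' => D (Q s t'))).
  { intros s t A A'.
    assert (P : 0 < d - Rabs (t - coord j p)) by lra.
    exists (mkposreal _ P); intros s' Hs'. apply L; auto.
    change (Rabs (s' - t) < d - Rabs (t - coord j p)) in Hs'.
    replace (s' - coord j p) with ((s' - t) + (t - coord j p)) by ring.
    eapply Rle_lt_trans; [ apply Rabs_triang | lra ]. }
  assert (E1 : forall s t, Rabs (s - coord i p) < d -> Rabs (t - coord j p) < d ->
     is_derive (fun z => Derive (fun t => f (Q z t)) t) s (fij (Q s t))).
  { intros s t A A'. eapply is_derive_ext_loc; [ | apply (Gi fj fij s t Hij (L s t A A')) ].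
    eapply filter_imp; [ | apply (Loc1 s t A A') ]. intros s' Hs'; simpl.
    symmetry; apply is_derive_unique, (Gj f fj); auto. }
  assert (E2 : forall s t, Rabs (s - coord i p) < d -> Rabs (t - coord j p) < d ->
     is_derive (fun z => Derive (fun t => f (Q t z)) s) t (fji (Q s t))).
  { intros s t A A'. eapply is_derive_ext_loc; [ | apply (Gj fi fji s t Hji (L s t A A')) ].
    eapply filter_imp; [ | apply (Loc2 s t A A') ]. intros s' Hs'; simpl.
    symmetry; apply is_derive_unique, (Gi f fi); auto. }
  assert (Z : forall a, Rabs (a - a) < d)
    by (intros a; rewrite Rminus_diag, Rabs_R0; exact d0).
  assert (CC : forall g h, contR g p -> (forall s t, Rabs (s - coord i p) < d -> Rabs (t - coord j p) < d ->
     h s t = g (Q s t)) -> continuity_2d_pt h (coord i p) (coord j p)).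
  { intros g h Hg E eps. destruct (contR_eps g p Hg eps (cond_pos eps)) as (e & e0 & He).
    assert (P : 0 < Rmin d e) by (apply Rmin_glb_lt; auto).
    exists (mkposreal _ P); simpl. intros u v Hu Hv.
    pose proof (Rmin_l d e); pose proof (Rmin_r d e).
    rewrite !E; try apply Z; try lra. rewrite Q0. apply He, set_set_bx; auto; lra. }
  pose proof (Schwarz (fun s t => f (Q s t)) (coord i p) (coord j p)) as S.
  rewrite <- Q0.
  rewrite <- (is_derive_unique _ _ _ (E1 _ _ (Z _) (Z _))), <- (is_derive_unique _ _ _ (E2 _ _ (Z _) (Z _))).
  apply S.
  - exists (mkposreal d d0); simpl; intros u v Hu Hv. repeat split.
    + eexists; apply (Gi f fi); auto.
    + eexists; apply (Gj f fj); auto.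
    + eexists; apply E1; auto.
    + eexists; apply E2; auto.
  - apply (CC fij); auto. intros; apply is_derive_unique; auto.
  - apply (CC fji); auto. intros; apply is_derive_unique; auto.
Qed.

Lemma rpd_comm D i j F p : opn D -> smooth D F -> D p -> rpd i (rpd j F) p = rpd j (rpd i F) p.
Proof.
  intros O H Hp.
  assert (i = j \/ i <> j) as [->|N] by (destruct i, j; auto; right; discriminate); auto.
  pose proof (TB_bclass D O) as HB.
  pose proof (fun i => symbol_rpd D TB i 0 F H) as H1.
  assert (H2 : forall i j, base D (rpd i (rpd j F)))
    by (intros a b; eapply symbol_base, symbol_rpd, H1).
  assert (B0 := symbol_base _ _ _ _ H).
  assert (B1 : forall i, base D (rpd i F)) by (intros; eapply symbol_base, H1).
  assert (E0 := fun i q (Hq : D q) => ex_rpd_isd i F q (proj2 (B0 q Hq) i)).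
  assert (E1 := fun k i q (Hq : D q) => ex_rpd_isd i (rpd k F) q (proj2 (B1 k q Hq) i)).
  apply C_eq.
  - exact (schwarz_real D (fun q => Re (F q)) (fun q => Re (rpd i F q)) (fun q => Re (rpd j F q))
      (fun q => Re (rpd i (rpd j F) q)) (fun q => Re (rpd j (rpd i F) q)) i j p O Hp N
      (fun q Hq => proj1 (E0 i q Hq)) (fun q Hq => proj1 (E0 j q Hq))
      (fun q Hq => proj1 (E1 j i q Hq)) (fun q Hq => proj1 (E1 i j q Hq))
      (proj1 (proj1 (H2 i j p Hp))) (proj1 (proj1 (H2 j i p Hp)))).
  - exact (schwarz_real D (fun q => Im (F q)) (fun q => Im (rpd i F q)) (fun q => Im (rpd j F q))
      (fun q => Im (rpd i (rpd j F) q)) (fun q => Im (rpd j (rpd i F) q)) i j p O Hp N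
      (fun q Hq => proj2 (E0 i q Hq)) (fun q Hq => proj2 (E0 j q Hq))
      (fun q Hq => proj2 (E1 j i q Hq)) (fun q Hq => proj2 (E1 i j q Hq))
      (proj2 (proj1 (H2 i j p Hp))) (proj2 (proj1 (H2 j i p Hp)))).
Qed.

Lemma pd_comm D m n F p : opn D -> smooth D F -> D p -> pd m (pd n F) p = pd n (pd m F) p.
Proof.
  intros O H Hp. pose proof (TB_bclass D O) as HB.
  pose proof (fun i => symbol_rpd D TB i 0 F H) as H1.
  pose proof (symbol_cst D TB HB) as HC.
  assert (X : forall a b, rpd a (rpd b F) p = rpd b (rpd a F) p)
    by (intros; apply (rpd_comm D); auto).
  assert (H2 : forall i q, D q -> forall j, ex_rpd j (rpd i F) q).
  { intros i q Hq. eapply base_rpd; eauto. }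
  assert (L : forall i n, rpd i (pd n F) p = match n with
    | iu => rpd i (rpd du F) p | ir => rpd i (rpd dr F) p
    | ia hol => (RtoC (/ 2) * (rpd i (rpd dx F) p - Ci * rpd i (rpd dy F) p))%C
    | ia ahol => (RtoC (/ 2) * (rpd i (rpd dx F) p + Ci * rpd i (rpd dy F) p))%C end).
  { intros i n'. rewrite pd_rpd.
    assert (Y : forall c, ex_rpd i (fmul (fcst c) (rpd dy F)) p /\
       rpd i (fmul (fcst c) (rpd dy F)) p = (c * rpd i (rpd dy F) p)%C).
    { intros c. destruct (rpd_mul i (fcst c) (rpd dy F) p) as [Y1 Y2]; auto.
      - apply rpd_cst.
      - split; auto. rewrite Y2. rewrite (proj2 (rpd_cst i c p)). unfold fcst; ring. }
    assert (Y' : forall c c', rpd i (fmul (fcst c) (fadd (rpd dx F) (fmul (fcst c') (rpd dy F)))) p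
       = (c * (rpd i (rpd dx F) p + c' * rpd i (rpd dy F) p))%C).
    { intros c c'. destruct (Y c') as [Y1 Y2].
      destruct (rpd_add i (rpd dx F) (fmul (fcst c') (rpd dy F)) p) as [Z1 Z2]; auto.
      rewrite (proj2 (rpd_mul i (fcst c) _ p (proj1 (rpd_cst i c p)) Z1)), Z2, Y2.
      rewrite (proj2 (rpd_cst i c p)). unfold fcst; ring. }
    destruct n' as [| |[|]]; auto; rewrite Y'; ring. }
  assert (M : forall m G, pd m G p = match m with
    | iu => rpd du G p | ir => rpd dr G p
    | ia hol => (RtoC (/ 2) * (rpd dx G p - Ci * rpd dy G p))%C
    | ia ahol => (RtoC (/ 2) * (rpd dx G p + Ci * rpd dy G p))%C end)
    by (intros [| |[|]] G; reflexivity).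
  rewrite (M m (pd n F)), (M n (pd m F)), !L.
  destruct m as [| |[|]], n as [| |[|]]; auto;
    rewrite ?(X dx du), ?(X dy du), ?(X dx dr), ?(X dy dr), ?(X dy dx), ?(X dr du); ring.
Qed.

(** * Differentiation under the integral sign *)

Lemma im_le_Cmod (z : C) : Rabs (Im z) <= Cmod z.
Proof.
  eapply Rle_trans; [ | apply Rmax_Cmod ]. apply Rmax_r.
Qed.

Lemma Cmod_le_sum (z : C) : Cmod z <= Rabs (Re z) + Rabs (Im z).
Proof.
  destruct z as [a b]; unfold Re, Im; simpl.
  replace ((a, b) : C) with (RtoC a + Ci * RtoC b)%C by (apply injective_projections; simpl; ring).
  eapply Rle_trans; [ apply Cmod_triangle | ].
  rewrite Cmod_mult, !Cmod_R, Cmod_Ci; lra.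
Qed.

(** A quadratic remainder estimate survives integration, unlike the mere existence of a derivative.
    All derivatives of integrals below are obtained in this form, so no interchange of limits is
    ever required. *)
Lemma is_derive_quad (f : R -> R) x l d K : 0 < d ->
  (forall h, Rabs h < d -> Rabs (f (x + h) - f x - h * l) <= K * h ^ 2) -> is_derive f x l.
Proof.
  intros d0 H. apply is_derive_Reals. intros e He.
  pose proof (Rabs_pos K) as K0.
  assert (P : 0 < Rmin d (e / (Rabs K + 1))).
  { apply Rmin_glb_lt; auto. apply Rdiv_lt_0_compat; lra. }
  exists (mkposreal _ P); simpl. intros h Nh Hh.
  pose proof (Rmin_l d (e / (Rabs K + 1))); pose proof (Rmin_r d (e / (Rabs K + 1))).
  specialize (H h ltac:(lra)).
  replace ((f (x + h) - f x) / h - l) with ((f (x + h) - f x - h * l) / h) by (field; auto).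
  unfold Rdiv; rewrite Rabs_mult, Rabs_inv.
  pose proof (Rabs_pos_lt h Nh) as hp.
  apply (Rmult_lt_reg_r (Rabs h)); auto. rewrite Rmult_assoc, Rinv_l, Rmult_1_r by lra.
  eapply Rle_lt_trans; [ exact H | ].
  replace (h ^ 2) with (Rabs h * Rabs h) by (rewrite <- Rabs_mult, Rabs_pos_eq; simpl; nra).
  assert (Rabs h * (Rabs K + 1) < e).
  { apply (Rmult_lt_reg_r (/ (Rabs K + 1))); [ apply Rinv_0_lt_compat; lra | ].
    rewrite Rmult_assoc, Rinv_r, Rmult_1_r by lra. unfold Rdiv in *; lra. }
  pose proof (Rle_abs K). nra.
Qed.

Lemma isd_quad (f : R -> C) (x : R) (l : C) (d K : R) : 0 < d ->
  (forall h, Rabs h < d -> Cmod (f (x + h)%R - f x - RtoC h * l)%C <= K * h ^ 2) -> isd f x l.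
Proof.
  intros d0 H; split; apply (is_derive_quad _ _ _ d K d0); intros h Hh.
  - eapply Rle_trans; [ | apply (H h Hh) ]. eapply Rle_trans; [ | apply re_le_Cmod ].
    right; f_equal. unfold Re; simpl; ring.
  - eapply Rle_trans; [ | apply (H h Hh) ]. eapply Rle_trans; [ | apply im_le_Cmod ].
    right; f_equal. unfold Im; simpl; ring.
Qed.

(** The mean value theorem is used twice, which gives [K] in place of the sharp [K / 2]. The further
    factor 2 in [taylor2] comes from adding real and imaginary parts. *)
Lemma taylor2_real (f f1 f2 : R -> R) x d K :
  (forall t, Rabs (t - x) < d -> is_derive f t (f1 t)) ->
  (forall t, Rabs (t - x) < d -> is_derive f1 t (f2 t)) ->
  (forall t, Rabs (t - x) < d -> Rabs (f2 t) <= K) ->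
  forall h, Rabs h < d -> Rabs (f (x + h) - f x - h * f1 x) <= K * h ^ 2.
Proof.
  intros H1 H2 HK h Hh.
  assert (IN : forall y z, Rabs (y - x) < d -> Rmin x y <= z <= Rmax x y ->
     Rabs (z - x) <= Rabs (y - x)).
  { intros y z _. unfold Rmin, Rmax, Rabs; destruct (Rle_dec x y); intros;
    repeat destruct Rcase_abs; lra. }
  assert (MV : forall g g' : R -> R, (forall t, Rabs (t - x) < d -> is_derive g t (g' t)) ->
     forall y, Rabs (y - x) < d -> exists c, Rabs (c - x) <= Rabs (y - x) /\ g y - g x = g' c * (y - x)).
  { intros g g' Hg y Hy.
    destruct (MVT_gen g x y g') as (c & C1 & C2).
    - intros z Hz. apply Hg. eapply Rle_lt_trans; [ apply (IN y z) | ]; auto; lra.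
    - intros z Hz. apply continuity_pt_filterlim.
      apply (ex_derive_continuous (K:=R_AbsRing) (V:=R_NormedModule) g).
      eexists; apply Hg. eapply Rle_lt_trans; [ apply (IN y z) | ]; auto; lra.
    - exists c; split; auto. }
  assert (Hy : Rabs (x + h - x) < d) by (replace (x + h - x) with h by ring; auto).
  destruct (MV f f1 H1 (x + h) Hy) as (c & C1 & C2).
  assert (Hc : Rabs (c - x) < d) by lra.
  destruct (MV f1 f2 H2 c Hc) as (c' & C1' & C2').
  replace (f (x + h) - f x - h * f1 x) with (f2 c' * (c - x) * h).
  - replace (x + h - x) with h in * by ring. rewrite !Rabs_mult.
    specialize (HK c' ltac:(lra)).
    replace (h ^ 2) with (Rabs h * Rabs h) by (rewrite <- Rabs_mult, Rabs_pos_eq; simpl; nra).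
    pose proof (Rabs_pos (f2 c')); pose proof (Rabs_pos (c - x)); pose proof (Rabs_pos h).
    assert (Rabs (f2 c') * Rabs (c - x) <= K * Rabs h) by (apply Rmult_le_compat; auto).
    nra.
  - replace (f2 c' * (c - x)) with (f1 c - f1 x). replace (x + h - x) with h in C2 by ring. lra.
Qed.

Lemma taylor2 (f f1 f2 : R -> C) (x d K : R) :
  (forall t, Rabs (t - x) < d -> isd f t (f1 t)) ->
  (forall t, Rabs (t - x) < d -> isd f1 t (f2 t)) ->
  (forall t, Rabs (t - x) < d -> Cmod (f2 t) <= K) ->
  forall h, Rabs h < d -> Cmod (f (x + h)%R - f x - RtoC h * f1 x)%C <= 2 * K * h ^ 2.
Proof.
  intros H1 H2 HK h Hh.
  assert (A := taylor2_real (fun t => Re (f t)) (fun t => Re (f1 t)) (fun t => Re (f2 t)) x d K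
    (fun t Ht => proj1 (H1 t Ht)) (fun t Ht => proj1 (H2 t Ht))
    (fun t Ht => Rle_trans _ _ _ (re_le_Cmod _) (HK t Ht)) h Hh).
  assert (B := taylor2_real (fun t => Im (f t)) (fun t => Im (f1 t)) (fun t => Im (f2 t)) x d K
    (fun t Ht => proj2 (H1 t Ht)) (fun t Ht => proj2 (H2 t Ht))
    (fun t Ht => Rle_trans _ _ _ (im_le_Cmod _) (HK t Ht)) h Hh).
  eapply Rle_trans; [ apply Cmod_le_sum | ].
  replace (Re (f (x + h)%R - f x - RtoC h * f1 x)%C) with (Re (f (x + h)%R) - Re (f x) - h * Re (f1 x))
    by (unfold Re; simpl; ring).
  replace (Im (f (x + h)%R - f x - RtoC h * f1 x)%C) with (Im (f (x + h)%R) - Im (f x) - h * Im (f1 x))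
    by (unfold Im; simpl; ring).
  lra.
Qed.

(** * Tubes around coordinate segments, compactness, and parameter integrals *)

Definition nb (i : rdir) (p : pt) (d a b : R) (q : pt) : Prop :=
  (forall j, j <> i -> Rabs (coord j q - coord j p) < d) /\ a - d < coord i q < b + d.

Lemma bx_coord p d q : bx p d q <-> forall j, Rabs (coord j q - coord j p) < d.
Proof.
  split.
  - intros (A & B & E & F) [| | |]; assumption.
  - intros H; repeat split; [ apply (H du) | apply (H dr) | apply (H dx) | apply (H dy) ].
Qed.

(** Compactness of the segment. A radius and a constant have to be made uniform at once, so both are
    coded by one number [e]: radius [2 e], constant [1 / e]. The positive lower bound that
    [compactness_value_1d] gives for a gauge then controls the two together. The factor 2 leaves
    room for the distance from [q] to the segment in addition to the distance along it. *)
Lemma tube i p a b (P : pt -> R -> Prop) : a <= b ->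
  (forall q K K', P q K -> K <= K' -> P q K') ->
  (forall t, a <= t <= b -> exists d K, 0 < d /\ forall q, bx (set_coord i p t) d q -> P q K) ->
  exists d K, 0 < d /\ forall q, nb i p d a b q -> P q K.
Proof.
  intros Hab Mono H.
  assert (X : forall t, exists e, 0 < e /\
     (a <= t <= b -> forall q, bx (set_coord i p t) (2 * e) q -> P q (/ e))).
  { intros t. destruct (Rle_dec a t) as [A|A]; [ destruct (Rle_dec t b) as [B|B] | ];
      try (exists 1; split; [ lra | intros; exfalso; lra ]).
    destruct (H t (conj A B)) as (d & K & d0 & HK).
    pose proof (Rabs_pos K).
    assert (e0 : 0 < Rmin (d / 2) (/ (Rabs K + 1))).
    { apply Rmin_glb_lt; [ lra | apply Rinv_0_lt_compat; lra ]. }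
    exists (Rmin (d / 2) (/ (Rabs K + 1))); split; auto. intros _ q Hq.
    pose proof (Rmin_l (d / 2) (/ (Rabs K + 1))); pose proof (Rmin_r (d / 2) (/ (Rabs K + 1))).
    apply (Mono q K).
    - apply HK. rewrite bx_coord in *. intros j; specialize (Hq j); lra.
    - pose proof (Rle_abs K).
      apply (Rle_trans _ (Rabs K + 1)); [ lra | ].
      rewrite <- (Rinv_inv (Rabs K + 1)) at 1. apply Rinv_le_contravar; auto. }
  set (ds := fun t => mkposreal _ (proj1 (proj2_sig (constructive_indefinite_description _ (X t))))).
  destruct (compactness_value_1d a b ds) as [d Hd].
  exists d, (/ d); split; [ apply cond_pos | ]. intros q [Q1 Q2].
  (* The point of [[a, b]] nearest to the coordinate of [q]. *)
  set (x := Rmax a (Rmin b (coord i q))).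
  assert (Hx : a <= x <= b /\ Rabs (coord i q - x) < d).
  { pose proof (cond_pos d). unfold x, Rmax, Rmin, Rabs; repeat destruct Rle_dec; destruct Rcase_abs; lra. }
  destruct Hx as [Hx1 Hx2]. pose proof (NNPP _ (Hd x Hx1)) as (t & T1 & T2 & T3).
  unfold ds in T2, T3; simpl in T2, T3.
  destruct (constructive_indefinite_description _ (X t)) as (e & e0 & He); simpl in *.
  apply (Mono q (/ e)); [ | apply Rinv_le_contravar; auto; apply cond_pos ].
  apply He; auto. apply bx_coord. intros j.
  destruct (classic (j = i)) as [->|N].
  - rewrite coord_set. replace (coord i q - t) with ((coord i q - x) + (x - t)) by ring.
    eapply Rle_lt_trans; [ apply Rabs_triang | lra ].
  - rewrite coord_swap by auto. specialize (Q1 j N). pose proof (cond_pos d); lra.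
Qed.

Lemma cont_bound F p : cont F p -> exists d K, 0 < d /\ forall q, bx p d q -> Cmod (F q) <= K.
Proof.
  intros [A B].
  destruct (contR_eps _ p A 1 ltac:(lra)) as (d & d0 & Hd).
  destruct (contR_eps _ p B 1 ltac:(lra)) as (e & e0 & He).
  exists (Rmin d e), (Rabs (Re (F p)) + Rabs (Im (F p)) + 2); split; [ apply Rmin_glb_lt; auto | ].
  intros q Hq. pose proof (Rmin_l d e); pose proof (Rmin_r d e).
  assert (bx p d q /\ bx p e q) as [X Y].
  { rewrite !bx_coord in *; split; intros j; specialize (Hq j); lra. }
  specialize (Hd q X); specialize (He q Y); simpl in Hd, He.
  eapply Rle_trans; [ apply Cmod_le_sum | ].
  assert (T : forall x y, Rabs (x - y) < 1 -> Rabs x <= Rabs y + 1).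
  { intros x y; unfold Rabs; repeat destruct Rcase_abs; lra. }
  pose proof (T _ _ Hd); pose proof (T _ _ He); lra.
Qed.

Lemma tube_bound D F i p a b : opn D -> (forall q, D q -> cont F q) -> a <= b ->
  (forall t, a <= t <= b -> D (set_coord i p t)) ->
  exists d K, 0 < d /\ 0 <= K /\ forall q, nb i p d a b q -> D q /\ Cmod (F q) <= K.
Proof.
  intros O HF Hab H.
  destruct (tube i p a b (fun q K => D q /\ Cmod (F q) <= K) Hab) as (d & K & d0 & HK).
  - intros q K K' [A B] L; split; auto; lra.
  - intros t Ht. specialize (H t Ht). destruct (O _ H) as (d & d0 & Hd).
    destruct (cont_bound F _ (HF _ H)) as (e & K & e0 & HK).
    exists (Rmin d e), K; split; [ apply Rmin_glb_lt; auto | ].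
    intros q Hq. pose proof (Rmin_l d e); pose proof (Rmin_r d e).
    split; [ apply Hd | apply HK ]; rewrite bx_coord in *; intros j; specialize (Hq j); lra.
  - exists d, (Rabs K); repeat split; auto; [ apply Rabs_pos | apply HK; auto | ].
    destruct (HK q H0). pose proof (Rle_abs K); lra.
Qed.

Lemma lip_line (g g' : R -> R) x y K :
  (forall t, Rmin x y <= t <= Rmax x y -> is_derive g t (g' t)) ->
  (forall t, Rmin x y <= t <= Rmax x y -> Rabs (g' t) <= K) ->
  Rabs (g y - g x) <= K * Rabs (y - x).
Proof.
  intros H HK. destruct (MVT_gen g x y g') as (c & C1 & C2).
  - intros z Hz; apply H; lra.
  - intros z Hz. apply continuity_pt_filterlim.
    apply (ex_derive_continuous (K:=R_AbsRing) (V:=R_NormedModule) g). eexists; apply H; auto.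
  - rewrite C2, Rabs_mult. apply Rmult_le_compat_r; [ apply Rabs_pos | auto ].
Qed.

(** Changing one coordinate at a time gives a Lipschitz estimate with constant [4 K]; the [+ 1] in
    the denominators covers [K = 0]. Continuity of a parameter integral is deduced in this way from
    bounds on its already computed partial derivatives. *)
Lemma contR_lip (g : pt -> R) (g' : rdir -> pt -> R) p d K : 0 < d ->
  (forall i q, bx p d q -> is_derive (fun t => g (set_coord i q t)) (coord i q) (g' i q)) ->
  (forall i q, bx p d q -> Rabs (g' i q) <= K) -> contR g p.
Proof.
  intros d0 H HK. apply contR_of_eps. intros e e0.
  pose proof (HK du p) as KK.
  assert (Hp : bx p d p) by (apply bx_coord; intros; rewrite Rminus_diag, Rabs_R0; auto).
  assert (K0 : 0 <= K) by (eapply Rle_trans; [ apply Rabs_pos | apply (HK du p Hp) ]).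
  assert (d'0 : 0 < Rmin d (e / (4 * K + 1))).
  { apply Rmin_glb_lt; auto. apply Rdiv_lt_0_compat; lra. }
  exists (Rmin d (e / (4 * K + 1))); split; auto. intros q Hq.
  pose proof (Rmin_l d (e / (4 * K + 1))) as M1; pose proof (Rmin_r d (e / (4 * K + 1))) as M2.
  set (d' := Rmin d (e / (4 * K + 1))) in *.
  rewrite bx_coord in Hq.
  set (q1 := set_coord du p (coord du q)).
  set (q2 := set_coord dr q1 (coord dr q)).
  set (q3 := set_coord dx q2 (coord dx q)).
  set (q4 := set_coord dy q3 (coord dy q)).
  assert (E4 : q4 = q) by (destruct q as [[? ?] [? ?]]; reflexivity).
  assert (step : forall i q, bx p d q -> forall y, Rabs (y - coord i p) < d' ->
     Rabs (g (set_coord i q y) - g q) <= K * Rabs (y - coord i q)).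
  { intros i x Hx y Hy.
    assert (BX : forall t, Rmin (coord i x) y <= t <= Rmax (coord i x) y -> bx p d (set_coord i x t)).
    { intros t Ht. rewrite bx_coord in *. intros j.
      destruct (classic (j = i)) as [->|N].
      - rewrite coord_set. specialize (Hx i).
        revert Ht Hx Hy. unfold Rmin, Rmax, Rabs; destruct Rle_dec; repeat destruct Rcase_abs; lra.
      - rewrite coord_swap; auto. }
    rewrite <- (set_coord_id i x) at 2.
    apply (lip_line (fun t => g (set_coord i x t)) (fun t => g' i (set_coord i x t))).
    - intros t Ht. specialize (H i _ (BX t Ht)). rewrite coord_set in H.
      eapply is_derive_ext; [ | exact H ]. intros s; simpl; rewrite set_set; auto.
    - intros t Ht. apply HK, BX, Ht. }
  assert (Q : forall x, (forall j, coord j x = coord j p \/ coord j x = coord j q) -> bx p d x).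
  { intros x Hx. apply bx_coord; intros j. destruct (Hx j) as [-> | ->].
    - rewrite Rminus_diag, Rabs_R0; auto.
    - specialize (Hq j); lra. }
  pose proof (step du p Hp (coord du q) (Hq du)) as S1.
  pose proof (step dr q1 ltac:(apply Q; intros []; auto) (coord dr q) (Hq dr)) as S2.
  pose proof (step dx q2 ltac:(apply Q; intros []; auto) (coord dx q) (Hq dx)) as S3.
  pose proof (step dy q3 ltac:(apply Q; intros []; auto) (coord dy q) (Hq dy)) as S4.
  fold q1 in S1; fold q2 in S2; fold q3 in S3; fold q4 in S4.
  change (coord dr q1) with (coord dr p) in S2. change (coord dx q2) with (coord dx p) in S3.
  change (coord dy q3) with (coord dy p) in S4.
  pose proof (Hq du) as Q1; pose proof (Hq dr) as Q2; pose proof (Hq dx) as Q3; pose proof (Hq dy) as Q4.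
  rewrite <- E4 at 1.
  replace (g q4 - g p) with ((g q4 - g q3) + ((g q3 - g q2) + ((g q2 - g q1) + (g q1 - g p)))) by ring.
  assert (T : forall a b, Rabs (a + b) <= Rabs a + Rabs b) by apply Rabs_triang.
  pose proof (T (g q4 - g q3) ((g q3 - g q2) + ((g q2 - g q1) + (g q1 - g p)))).
  pose proof (T (g q3 - g q2) ((g q2 - g q1) + (g q1 - g p))).
  pose proof (T (g q2 - g q1) (g q1 - g p)).
  assert (K * Rabs (coord du q - coord du p) <= K * d') by (apply Rmult_le_compat_l; lra).
  assert (K * Rabs (coord dr q - coord dr p) <= K * d') by (apply Rmult_le_compat_l; lra).
  assert (K * Rabs (coord dx q - coord dx p) <= K * d') by (apply Rmult_le_compat_l; lra).
  assert (K * Rabs (coord dy q - coord dy p) <= K * d') by (apply Rmult_le_compat_l; lra).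
  assert ((4 * K + 1) * d' <= e).
  { apply (Rmult_le_compat_l (4 * K + 1)) in M2; [ | lra ].
    replace ((4 * K + 1) * (e / (4 * K + 1))) with e in M2 by (field; lra). exact M2. }
  lra.
Qed.

Lemma cont_lip F p d K : 0 < d -> (forall i q, bx p d q -> ex_rpd i F q) ->
  (forall i q, bx p d q -> Cmod (rpd i F q) <= K) -> cont F p.
Proof.
  intros d0 H HK; split.
  - apply (contR_lip _ (fun i q => Re (rpd i F q)) p d K d0).
    + intros i q Hq; apply (ex_rpd_isd i F q (H i q Hq)).
    + intros i q Hq; eapply Rle_trans; [ apply re_le_Cmod | auto ].
  - apply (contR_lip _ (fun i q => Im (rpd i F q)) p d K d0).
    + intros i q Hq; apply (ex_rpd_isd i F q (H i q Hq)).
    + intros i q Hq; eapply Rle_trans; [ apply im_le_Cmod | auto ].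
Qed.

(** Common to integrals over segments and over rays. *)
Record ifun (isI : (R -> C) -> C -> Prop) (S : R -> Prop) (w : R -> R) (M : R) : Prop := {
  if_lin : forall f g l m c, isI f l -> isI g m ->
    isI (fun t => f t + RtoC c * g t)%C (l + RtoC c * m)%C;
  if_bound : forall f l K, isI f l -> 0 <= K -> (forall t, S t -> Cmod (f t) <= K * w t) ->
    Cmod l <= K * M }.

(** By linearity the Taylor remainder of [L] is the integral of the remainder of [Fam]; a pointwise
    bound quadratic in [h] with majorant [w] therefore becomes a quadratic bound for [L]. *)
Lemma param_isd isI S w M (HI : ifun isI S w M) (Fam : R -> R -> C) (F' : R -> C)
    (L : R -> C) l x0 d K : 0 < d -> 0 <= K ->
  (forall h, Rabs h < d -> isI (Fam (x0 + h)) (L (x0 + h))) -> isI F' l ->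
  (forall h t, Rabs h < d -> S t ->
     Cmod (Fam (x0 + h)%R t - Fam x0 t - RtoC h * F' t)%C <= K * h ^ 2 * w t) ->
  isd L x0 l.
Proof.
  intros d0 K0 HL Hl H. apply (isd_quad _ _ _ d (K * M) d0). intros h Hh.
  assert (X0 : isI (Fam x0) (L x0)).
  { specialize (HL 0). rewrite Rplus_0_r in HL. apply HL. rewrite Rabs_R0; auto. }
  pose proof (if_lin _ _ _ _ HI _ _ _ _ (- h) (if_lin _ _ _ _ HI _ _ _ _ (-1) (HL h Hh) X0) Hl) as X.
  assert (B := if_bound _ _ _ _ HI _ _ (K * h ^ 2) X).
  replace (L (x0 + h)%R - L x0 - RtoC h * l)%C with (L (x0 + h)%R + RtoC (-1) * L x0 + RtoC (- h) * l)%C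
    by (apply injective_projections; simpl; ring).
  replace (K * M * h ^ 2) with (K * h ^ 2 * M) by ring.
  apply B.
  - apply Rmult_le_pos; auto. apply pow2_ge_0.
  - intros t Ht. eapply Rle_trans; [ | apply (H h t Hh Ht) ]. right; f_equal.
    apply injective_projections; simpl; ring.
Qed.

Definition segI (a b : R) (f : R -> C) (l : C) : Prop :=
  is_RInt (fun t => Re (f t)) a b (Re l) /\ is_RInt (fun t => Im (f t)) a b (Im l).

Definition rayI (a : R) (f : R -> C) (l : C) : Prop :=
  is_RInt_gen (fun t => Re (f t)) (at_point a) (Rbar_locally p_infty) (Re l) /\
  is_RInt_gen (fun t => Im (f t)) (at_point a) (Rbar_locally p_infty) (Im l).

Lemma segI_RInt a b f l : segI a b f l -> @RInt C_R_CompleteNormedModule f a b = l.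
Proof.
  intros [A B]. apply is_RInt_unique. destruct l.
  apply (is_RInt_fct_extend_pair (U:=R_NormedModule) (V:=R_NormedModule)); assumption.
Qed.

Lemma rayI_RInt a f l : rayI a f l ->
  @RInt_gen C_R_CompleteNormedModule f (at_point a) (Rbar_locally p_infty) = l.
Proof.
  intros [A B]. apply (@is_RInt_gen_unique C_R_CompleteNormedModule _ _ _ _).
  intros P [e He].
  assert (PA := A (fun y => Rabs (y - Re l) < e) ltac:(exists e; intros y Hy; exact Hy)).
  assert (PB := B (fun y => Rabs (y - Im l) < e) ltac:(exists e; intros y Hy; exact Hy)).
  unfold filtermapi in *. generalize (filter_and _ _ PA PB). apply filter_imp.
  intros [x y] [(z & Z1 & Z2) (z' & Z1' & Z2')].
  exists ((z, z') : C); split.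
  - apply (is_RInt_fct_extend_pair (U:=R_NormedModule) (V:=R_NormedModule)); assumption.
  - apply He. split; assumption.
Qed.

(** * Integrals along [u] *)

Lemma isd_continuous f x l : isd f x l ->
  continuous (fun t => Re (f t)) x /\ continuous (fun t => Im (f t)) x.
Proof.
  intros [A B]; split;
  [ apply (ex_derive_continuous (K:=R_AbsRing) (V:=R_NormedModule) (fun t => Re (f t)))
  | apply (ex_derive_continuous (K:=R_AbsRing) (V:=R_NormedModule) (fun t => Im (f t))) ];
  eexists; eassumption.
Qed.

Lemma segI_ex a b f : (forall t, Rmin a b <= t <= Rmax a b -> exists l, isd f t l) ->
  exists l, segI a b f l.
Proof.
  intros H.
  destruct (ex_RInt_continuous (V:=R_CompleteNormedModule) (fun t => Re (f t)) a b) as [l1 L1].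
  { intros t Ht. destruct (H t Ht) as [l Hl]; apply (isd_continuous _ _ _ Hl). }
  destruct (ex_RInt_continuous (V:=R_CompleteNormedModule) (fun t => Im (f t)) a b) as [l2 L2].
  { intros t Ht. destruct (H t Ht) as [l Hl]; apply (isd_continuous _ _ _ Hl). }
  exists (l1, l2); split; assumption.
Qed.

Lemma segI_ext a b f g l : (forall t, Rmin a b <= t <= Rmax a b -> f t = g t) ->
  segI a b f l -> segI a b g l.
Proof.
  intros H [A B]; split.
  - eapply is_RInt_ext; [ | exact A ]. intros t Ht; simpl; rewrite H; auto; lra.
  - eapply is_RInt_ext; [ | exact B ]. intros t Ht; simpl; rewrite H; auto; lra.
Qed.

Lemma segI_ifun a b : ifun (segI a b) (fun t => Rmin a b <= t <= Rmax a b) (fun _ => 1) (2 * Rabs (b - a)).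
Proof.
  split.
  - intros f g l m c [A B] [A' B']; split.
    + evar_last; [ apply (is_RInt_ext (fun t => plus (Re (f t)) (scal c (Re (g t))))) | ].
      * intros t _. unfold plus, scal, mult, Re; simpl. unfold mult; simpl. ring.
      * apply @is_RInt_plus; [ exact A | apply @is_RInt_scal; exact A' ].
      * unfold plus, scal, Re; simpl. unfold mult; simpl. ring.
    + evar_last; [ apply (is_RInt_ext (fun t => plus (Im (f t)) (scal c (Im (g t))))) | ].
      * intros t _. unfold plus, scal, mult, Im; simpl. unfold mult; simpl. ring.
      * apply @is_RInt_plus; [ exact B | apply @is_RInt_scal; exact B' ].
      * unfold plus, scal, Im; simpl. unfold mult; simpl. ring.
  - intros f l K [A B] K0 H.
    assert (X : Rabs (Re l) <= Rabs (b - a) * K).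
    { apply (norm_RInt_le_const_abs (V:=R_NormedModule) (fun t => Re (f t)) a b); [ | exact A ].
      intros t Ht. eapply Rle_trans; [ apply re_le_Cmod | rewrite <- (Rmult_1_r K); auto ]. }
    assert (Y : Rabs (Im l) <= Rabs (b - a) * K).
    { apply (norm_RInt_le_const_abs (V:=R_NormedModule) (fun t => Im (f t)) a b); [ | exact B ].
      intros t Ht. eapply Rle_trans; [ apply im_le_Cmod | rewrite <- (Rmult_1_r K); auto ]. }
    eapply Rle_trans; [ apply Cmod_le_sum | lra ].
Qed.

Lemma line_isd D F i p t : base D F -> D (set_coord i p t) ->
  isd (fun s => F (set_coord i p s)) t (rpd i F (set_coord i p t)).
Proof.
  intros H Hp. pose proof (ex_rpd_isd i F _ (proj2 (H _ Hp) i)) as X.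
  rewrite coord_set in X. eapply isd_ext; [ | exact X ].
  intros s; simpl; rewrite set_set; reflexivity.
Qed.

Definition ustar (D : pt -> Prop) : Prop :=
  forall p t, D p -> Rmin 0 (pu p) <= t <= Rmax 0 (pu p) -> D (set_coord du p t).

Definition intu (F : pt -> C) (p : pt) : C :=
  @RInt C_R_CompleteNormedModule (fun t => F (set_coord du p t)) 0 (pu p).

Lemma intu_segI D F p : base D F -> ustar D -> D p ->
  segI 0 (pu p) (fun t => F (set_coord du p t)) (intu F p).
Proof.
  intros H U Hp. destruct (segI_ex 0 (pu p) (fun t => F (set_coord du p t))) as [l Hl].
  - intros t Ht. eexists. apply (line_isd D); auto.
  - unfold intu. rewrite (segI_RInt _ _ _ _ Hl). exact Hl.
Qed.

Lemma intu_bound D F p K : base D F -> ustar D -> D p -> 0 <= K ->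
  (forall t, Rmin 0 (pu p) <= t <= Rmax 0 (pu p) -> Cmod (F (set_coord du p t)) <= K) ->
  Cmod (intu F p) <= K * (2 * Rabs (pu p)).
Proof.
  intros H U Hp K0 HK.
  pose proof (if_bound _ _ _ _ (segI_ifun 0 (pu p)) _ _ K (intu_segI D F p H U Hp) K0) as X.
  rewrite Rminus_0_r in X. apply X.
  intros t Ht. rewrite Rmult_1_r; auto.
Qed.

Lemma smooth_rpd D i F : smooth D F -> smooth D (rpd i F).
Proof. intros H k. eapply Ck_TB. apply (symbol_rpd D TB i 0 F H k). Qed.

Lemma smooth_base D F : smooth D F -> base D F.
Proof. apply symbol_base. Qed.

Lemma Rminmax_ex u : Rmin 0 u <= Rmax 0 u.
Proof. unfold Rmin, Rmax; destruct Rle_dec; lra. Qed.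

(** The second derivative of [F] in direction [j] is bounded on a tube around the compact segment of
    integration, which makes the Taylor remainder uniformly quadratic. *)
Lemma intu_isd_j D F j p : opn D -> ustar D -> smooth D F -> D p -> j <> du ->
  isd (fun t => intu F (set_coord j p t)) (coord j p) (intu (rpd j F) p).
Proof.
  intros O U H Hp N.
  pose proof (smooth_rpd _ j _ H) as H1. pose proof (smooth_rpd _ j _ H1) as H2.
  destruct (tube_bound D (rpd j (rpd j F)) du p (Rmin 0 (pu p)) (Rmax 0 (pu p)) O) as (d & K & d0 & K0 & HK).
  { intros q Hq; apply (smooth_base _ _ H2 q Hq). }
  { apply Rminmax_ex. }
  { intros t Ht; apply U; auto. }
  assert (IN : forall h t, Rabs h < d -> Rmin 0 (pu p) <= t <= Rmax 0 (pu p) ->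
    nb du p d (Rmin 0 (pu p)) (Rmax 0 (pu p)) (set_coord j (set_coord du p t) (coord j p + h))).
  { intros h t Hh Ht. split.
    - intros k Nk. destruct (classic (k = j)) as [->|Nj].
      + rewrite coord_set. replace (coord j p + h - coord j p) with h by ring; auto.
      + rewrite !coord_swap by auto. rewrite Rminus_diag, Rabs_R0; auto.
    - rewrite coord_swap, coord_set by auto. lra. }
  apply (param_isd _ _ _ _ (segI_ifun 0 (pu p)) (fun x t => F (set_coord j (set_coord du p t) x))
    (fun t => rpd j F (set_coord du p t)) _ _ _ d (2 * K)); auto; [ lra | | | ].
  - intros h Hh.
    assert (Hq : D (set_coord j p (coord j p + h))).
    { specialize (IN h (pu p) Hh). assert (E : set_coord du p (pu p) = p) by apply (set_coord_id du).
      rewrite E in IN. apply HK, IN. apply conj; unfold Rmin, Rmax; destruct Rle_dec; lra. }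
    pose proof (intu_segI D F _ (smooth_base _ _ H) U Hq) as X.
    assert (E : pu (set_coord j p (coord j p + h)) = pu p) by (apply (coord_swap du j); auto).
    rewrite E in X.
    eapply segI_ext; [ | exact X ]. intros t _; cbv beta. rewrite (set_swap du j); auto.
  - apply (intu_segI D); auto. apply smooth_base; auto.
  - intros h t Hh Ht. rewrite Rmult_1_r.
    pose proof (taylor2 (fun s => F (set_coord j (set_coord du p t) s))
      (fun s => rpd j F (set_coord j (set_coord du p t) s))
      (fun s => rpd j (rpd j F) (set_coord j (set_coord du p t) s)) (coord j p) d K) as T.
    assert (IN' : forall s, Rabs (s - coord j p) < d ->
       D (set_coord j (set_coord du p t) s) /\ Cmod (rpd j (rpd j F) (set_coord j (set_coord du p t) s)) <= K).
    { intros s Hs. replace s with (coord j p + (s - coord j p)) by ring. apply HK, IN; auto. }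
    assert (E : set_coord j (set_coord du p t) (coord j p) = set_coord du p t).
    { rewrite (set_swap j du), set_coord_id; auto. }
    cbv beta in T. rewrite E in T. rewrite E. apply T; auto.
    + intros s Hs; apply (line_isd D); [ apply smooth_base; auto | apply IN'; auto ].
    + intros s Hs; apply (line_isd D); [ apply smooth_base; auto | apply IN'; auto ].
    + intros s Hs; apply IN'; auto.
Qed.

Lemma intu_isd_u D F p : opn D -> ustar D -> base D F -> D p ->
  isd (fun t => intu F (set_coord du p t)) (pu p) (F p).
Proof.
  intros O U H Hp.
  assert (L : locally (pu p) (fun t => segI 0 t (fun s => F (set_coord du p s)) (intu F (set_coord du p t)))).
  { pose proof (opn_coord D du p O Hp) as L. eapply filter_imp; [ | exact L ].
    intros t Ht. pose proof (intu_segI D F _ H U Ht) as X.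
    eapply segI_ext; [ | exact X ]. intros s _; simpl; auto. }
  pose proof (ex_rpd_isd du F p (proj2 (H p Hp) du)) as X.
  destruct (isd_continuous _ _ _ X) as [C1 C2].
  assert (E : F p = F (set_coord du p (pu p))) by (f_equal; symmetry; apply (set_coord_id du)).
  rewrite E. split.
  - apply (is_derive_RInt (fun s => Re (F (set_coord du p s))) (fun t => Re (intu F (set_coord du p t))) 0); auto.
    eapply filter_imp; [ | exact L ]. intros t [A B]; exact A.
  - apply (is_derive_RInt (fun s => Im (F (set_coord du p s))) (fun t => Im (intu F (set_coord du p t))) 0); auto.
    eapply filter_imp; [ | exact L ]. intros t [A B]; exact B.
Qed.

Lemma intu_rpd D F i p : opn D -> ustar D -> smooth D F -> D p ->
  ex_rpd i (intu F) p /\ rpd i (intu F) p = match i with du => F p | _ => intu (rpd i F) p end.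
Proof.
  intros O U H Hp. apply isd_rpd.
  destruct i; try (apply (intu_isd_j D); auto; discriminate).
  apply (intu_isd_u D); auto. apply smooth_base; auto.
Qed.

Lemma intu_loc_bound D F p : opn D -> ustar D -> smooth D F -> D p ->
  exists d K, 0 < d /\ forall q, bx p d q -> D q /\ Cmod (F q) <= K /\ Cmod (intu F q) <= K.
Proof.
  intros O U H Hp. pose proof (smooth_base _ _ H) as HB.
  destruct (tube_bound D F du p (Rmin 0 (pu p)) (Rmax 0 (pu p)) O) as (d & K & d0 & K0 & HK).
  { intros q Hq; apply (HB q Hq). }
  { apply Rminmax_ex. }
  { intros t Ht; apply U; auto. }
  assert (d1 : 0 < Rmin d 1) by (apply Rmin_glb_lt; lra).
  exists (Rmin d 1), (K + K * (2 * (Rabs (pu p) + 1))); split; auto. intros q Hq.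
  pose proof (Rmin_l d 1); pose proof (Rmin_r d 1). rewrite bx_coord in Hq.
  assert (IN : forall t, Rmin 0 (pu q) <= t <= Rmax 0 (pu q) ->
    nb du p d (Rmin 0 (pu p)) (Rmax 0 (pu p)) (set_coord du q t)).
  { intros t Ht; split.
    - intros j Nj. rewrite coord_swap by auto. specialize (Hq j); lra.
    - rewrite coord_set. specialize (Hq du). change (Rabs (pu q - pu p) < Rmin d 1) in Hq.
      revert Ht Hq. unfold Rmin at 1, Rmax at 1, Rmin at 2, Rmax at 1.
      repeat destruct Rle_dec; unfold Rabs; destruct Rcase_abs; lra. }
  assert (E : set_coord du q (pu q) = q) by apply (set_coord_id du).
  assert (Q : D q /\ Cmod (F q) <= K).
  { rewrite <- E. apply HK, IN. unfold Rmin, Rmax; destruct Rle_dec; lra. }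
  destruct Q as [Q1 Q2].
  assert (0 <= K * (2 * (Rabs (pu p) + 1))).
  { pose proof (Rabs_pos (pu p)). apply Rmult_le_pos; lra. }
  repeat split; auto; [ lra | ].
  eapply Rle_trans; [ apply (intu_bound D F q K); auto | ].
  { intros t Ht; apply HK, IN, Ht. }
  assert (Rabs (pu q) <= Rabs (pu p) + 1).
  { specialize (Hq du). change (Rabs (pu q - pu p) < Rmin d 1) in Hq.
    revert Hq H1. unfold Rabs; repeat destruct Rcase_abs; lra. }
  assert (K * (2 * Rabs (pu q)) <= K * (2 * (Rabs (pu p) + 1))) by (apply Rmult_le_compat_l; lra).
  lra.
Qed.

(** Each partial derivative of [intu F] is [F] or once more an [intu] of a smooth function, so the
    induction reproduces itself. Continuity is the only analytic point and follows from local bounds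
    on the four partial derivatives. *)
Lemma intu_smooth D F : opn D -> ustar D -> smooth D F -> smooth D (intu F).
Proof.
  intros O U H k. revert F H. pose proof (TB_bclass D O) as HB.
  assert (Bs : forall F, smooth D F -> base D (intu F)).
  { intros F H p Hp; split; [ | intros i; apply (intu_rpd D F i p O U H Hp) ].
    destruct (intu_loc_bound D F p O U H Hp) as (d & K & d0 & HK).
    destruct (intu_loc_bound D (rpd dr F) p O U (smooth_rpd _ _ _ H) Hp) as (d1 & K1 & d01 & HK1).
    destruct (intu_loc_bound D (rpd dx F) p O U (smooth_rpd _ _ _ H) Hp) as (d2 & K2 & d02 & HK2).
    destruct (intu_loc_bound D (rpd dy F) p O U (smooth_rpd _ _ _ H) Hp) as (d3 & K3 & d03 & HK3).
    set (e := Rmin (Rmin d d1) (Rmin d2 d3)).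
    assert (e <= d /\ e <= d1 /\ e <= d2 /\ e <= d3) as (E0 & E1 & E2 & E3).
    { unfold e. pose proof (Rmin_l (Rmin d d1) (Rmin d2 d3)); pose proof (Rmin_r (Rmin d d1) (Rmin d2 d3)).
      pose proof (Rmin_l d d1); pose proof (Rmin_r d d1). pose proof (Rmin_l d2 d3); pose proof (Rmin_r d2 d3). lra. }
    assert (e0 : 0 < e) by (unfold e; repeat apply Rmin_glb_lt; auto).
    assert (SH : forall q d', e <= d' -> bx p e q -> bx p d' q).
    { intros q d' L; rewrite !bx_coord; intros X j; specialize (X j); lra. }
    apply (cont_lip _ p e (Rmax (Rmax K K1) (Rmax K2 K3)) e0).
    - intros i q Hq. apply (intu_rpd D F i q O U H). apply (HK q (SH q d E0 Hq)).
    - intros i q Hq. rewrite (proj2 (intu_rpd D F i q O U H (proj1 (HK q (SH q d E0 Hq))))).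
      pose proof (Rmax_l (Rmax K K1) (Rmax K2 K3)); pose proof (Rmax_r (Rmax K K1) (Rmax K2 K3)).
      pose proof (Rmax_l K K1); pose proof (Rmax_r K K1); pose proof (Rmax_l K2 K3); pose proof (Rmax_r K2 K3).
      destruct (HK q (SH q d E0 Hq)) as (_ & A & _).
      destruct (HK1 q (SH q d1 E1 Hq)) as (_ & _ & A1).
      destruct (HK2 q (SH q d2 E2 Hq)) as (_ & _ & A2).
      destruct (HK3 q (SH q d3 E3 Hq)) as (_ & _ & A3).
      destruct i; lra. }
  induction k as [|k IH]; intros F H; (split; [ apply Bs; auto | split; [ exact I | ] ]); auto.
  intros i. apply (Ck_TB _ _ 0).
  apply (Ck_ext D TB HB k 0 (match i with du => F | _ => intu (rpd i F) end)).
  - intros p Hp. destruct (intu_rpd D F i p O U H Hp) as [_ E]. destruct i; auto.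
  - pose proof (fun i => IH _ (smooth_rpd D i F H)). destruct i; auto.
Qed.

(** * Integrals along rays *)

(** The integrable majorant used along rays; unlike [r^-2] it is bounded on all of [R]. *)
Definition wt (t : R) : R := / (1 + t ^ 2).

Lemma wt_pos t : 0 < wt t.
Proof. apply Rinv_0_lt_compat. pose proof (pow2_ge_0 t). lra. Qed.

Lemma is_derive_atan t : is_derive atan t (wt t).
Proof. apply is_derive_Reals. unfold wt.  apply derivable_pt_lim_atan. Qed.

Lemma atan_lim : filterlim atan (Rbar_locally p_infty) (locally (PI / 2)).
Proof.
  intros P [e He].
  pose proof PI2_1. set (e' := Rmin (e / 2) 1). pose proof (cond_pos e).
  assert (e'0 : 0 < e') by (apply Rmin_glb_lt; lra).
  assert (e' <= e / 2 /\ e' <= 1) as [E1 E2] by (split; [ apply Rmin_l | apply Rmin_r ]).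
  exists (tan (PI / 2 - e')). intros x Hx. apply He.
  apply atan_increasing in Hx. rewrite atan_tan in Hx by lra.
  destruct (atan_bound x). change (Rabs (atan x - PI / 2) < e).
  rewrite Rabs_left; lra.
Qed.

Lemma ray_lim a (f g : R -> R) (l : R) : (forall b, a < b -> is_RInt f a b (g b)) ->
  filterlim g (Rbar_locally p_infty) (locally l) ->
  is_RInt_gen f (at_point a) (Rbar_locally p_infty) l.
Proof.
  intros H L P HP.
  exists (fun x => x = a) (fun b => a < b /\ P (g b)).
  - reflexivity.
  - apply filter_and; [ exists a; auto | apply L, HP ].
  - intros x b -> [A B]. exists (g b); simpl; auto.
Qed.

Lemma wt_ray a : is_RInt_gen wt (at_point a) (Rbar_locally p_infty) (PI / 2 - atan a).
Proof.
  apply (ray_lim a wt (fun b => atan b - atan a)).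
  - intros b _. apply (is_RInt_derive atan wt).
    + intros; apply is_derive_atan.
    + intros t _. apply (ex_derive_continuous (K:=R_AbsRing) (V:=R_NormedModule) wt).
      unfold wt. auto_derive. pose proof (pow2_ge_0 t). simpl in *. lra.
  - apply (filterlim_comp _ _ _ atan (fun y => y - atan a) _ _ _ atan_lim).
    apply (ex_derive_continuous (K:=R_AbsRing) (V:=R_NormedModule) (fun y => y - atan a)).
    auto_derive; auto.
Qed.

Lemma wt_mass a : 0 < PI / 2 - atan a < 4.
Proof. pose proof (atan_bound a). pose proof PI_4. lra. Qed.

(** Cauchy criterion at infinity: the integral from [b] to [c] is at most [K (atan c - atan b)], and
    [atan] converges. *)
Lemma ray_ex_real (f : R -> R) a K : (forall t, a <= t -> continuous f t) ->
  (forall t, a <= t -> Rabs (f t) <= K * wt t) ->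
  exists l, is_RInt_gen f (at_point a) (Rbar_locally p_infty) l.
Proof.
  intros C H.
  assert (X : forall b c, a <= b -> a <= c -> is_RInt f b c (RInt f b c)).
  { intros b c Hb Hc. apply (RInt_correct (V:=R_CompleteNormedModule)), (ex_RInt_continuous (V:=R_CompleteNormedModule)).
    intros t Ht; apply C. revert Ht; unfold Rmin; destruct Rle_dec; lra. }
  assert (W : forall b c, is_RInt wt b c (atan c - atan b)).
  { intros b c. apply (is_RInt_derive atan wt).
    + intros; apply is_derive_atan.
    + intros t _. apply (ex_derive_continuous (K:=R_AbsRing) (V:=R_NormedModule) wt).
      unfold wt. auto_derive. pose proof (pow2_ge_0 t). simpl in *. lra. }
  assert (K0 : 0 <= K).
  { specialize (H a (Rle_refl a)). pose proof (Rabs_pos (f a)). pose proof (wt_pos a). nra. }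
  assert (BD : forall b c, a <= b -> b <= c -> Rabs (RInt f b c) <= K * (atan c - atan b)).
  { intros b c Hb Hc.
    apply (norm_RInt_le (V:=R_NormedModule) f (fun t => K * wt t) b c _ _ Hc).
    - intros t Ht; apply H; lra.
    - apply X; lra.
    - apply (is_RInt_scal (V:=R_NormedModule)), W. }
  assert (E : exists l, filterlim (fun b => RInt f a b) (Rbar_locally p_infty) (locally l)).
  { apply (filterlim_locally_cauchy (U:=R_CompleteSpace)). intros e.
    assert (e' : 0 < e / (2 * (K + 1))) by (apply Rdiv_lt_0_compat; [ apply cond_pos | lra ]).
    exists (fun b => a < b /\ Rabs (atan b - PI / 2) < e / (2 * (K + 1))). split.
    - apply filter_and; [ exists a; auto | ].
      apply (atan_lim (fun y => Rabs (y - PI / 2) < e / (2 * (K + 1)))).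
      exists (mkposreal _ e'); intros y Hy; exact Hy.
    - assert (G : forall b c, a < b -> b <= c -> Rabs (atan b - PI / 2) < e / (2 * (K + 1)) ->
         Rabs (atan c - PI / 2) < e / (2 * (K + 1)) -> Rabs (RInt f a c - RInt f a b) < e).
      { intros b c Hb Hc A B.
        replace (RInt f a c - RInt f a b) with (RInt f b c).
        2:{ assert (Y : RInt f a c = RInt f a b + RInt f b c); [ | lra ].
            apply (is_RInt_unique (V:=R_CompleteNormedModule)).
            apply (is_RInt_Chasles (V:=R_NormedModule) f a b c); apply X; lra. }
        eapply Rle_lt_trans; [ apply BD; lra | ].
        assert (atan c - atan b < e / (K + 1)).
        { replace (e / (K + 1)) with (e / (2 * (K + 1)) + e / (2 * (K + 1))) by (field; lra).
          revert A B. unfold Rabs; repeat destruct Rcase_abs; lra. }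
        assert (atan b <= atan c) by (destruct (Req_dec b c); [ subst; lra | left; apply atan_increasing; lra ]).
        apply (Rle_lt_trans _ ((K + 1) * (atan c - atan b))); [ nra | ].
        apply (Rmult_lt_compat_l (K + 1)) in H0; [ | lra ].
        replace ((K + 1) * (e / (K + 1))) with (pos e) in H0 by (field; lra). exact H0. }
      intros b c [A1 A2] [B1 B2]. change (Rabs (RInt f a c - RInt f a b) < e).
      destruct (Rle_dec b c); [ apply G; auto | ].
      rewrite Rabs_minus_sym. apply G; auto; lra. }
  destruct E as [l Hl]. exists l. apply (ray_lim a f (fun b => RInt f a b)); auto.
  intros b Hb; apply X; lra.
Qed.

Lemma rayI_ex a f K : (forall t, a <= t -> exists l, isd f t l) ->
  (forall t, a <= t -> Cmod (f t) <= K * wt t) -> exists l, rayI a f l.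
Proof.
  intros H HK.
  destruct (ray_ex_real (fun t => Re (f t)) a K) as [l1 L1].
  { intros t Ht. destruct (H t Ht) as [l Hl]; apply (isd_continuous _ _ _ Hl). }
  { intros t Ht; eapply Rle_trans; [ apply re_le_Cmod | auto ]. }
  destruct (ray_ex_real (fun t => Im (f t)) a K) as [l2 L2].
  { intros t Ht. destruct (H t Ht) as [l Hl]; apply (isd_continuous _ _ _ Hl). }
  { intros t Ht; eapply Rle_trans; [ apply im_le_Cmod | auto ]. }
  exists (l1, l2); split; assumption.
Qed.

Lemma ray_filter a (P : R -> R -> Prop) : (forall b, a <= b -> P a b) ->
  filter_prod (at_point a) (Rbar_locally p_infty) (fun ab => P (fst ab) (snd ab)).
Proof.
  intros H. exists (fun x => x = a) (fun b => a < b).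
  - reflexivity.
  - exists a; auto.
  - intros x b -> Hb; apply H, Rlt_le, Hb.
Qed.

Lemma rayI_ext a f g l : (forall t, a <= t -> f t = g t) -> rayI a f l -> rayI a g l.
Proof.
  intros H [A B]; split.
  - eapply is_RInt_gen_ext; [ | exact A ].
    apply (ray_filter a (fun a b => forall x, Rmin a b < x < Rmax a b -> Re (f x) = Re (g x))).
    intros b Hb x Hx. rewrite H; auto. rewrite Rmin_left, Rmax_right in Hx by lra; lra.
  - eapply is_RInt_gen_ext; [ | exact B ].
    apply (ray_filter a (fun a b => forall x, Rmin a b < x < Rmax a b -> Im (f x) = Im (g x))).
    intros b Hb x Hx. rewrite H; auto. rewrite Rmin_left, Rmax_right in Hx by lra; lra.
Qed.

Lemma ray_bound_real a f l K : (forall t, a <= t -> Rabs (f t) <= K * wt t) ->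
  is_RInt_gen f (at_point a) (Rbar_locally p_infty) l -> Rabs l <= K * (PI / 2 - atan a).
Proof.
  intros H A.
  apply (RInt_gen_norm (V:=R_CompleteNormedModule) (Fa := at_point a) (Fb := Rbar_locally p_infty)
    f (fun t => K * wt t) l (K * (PI / 2 - atan a))).
  - apply (ray_filter a (fun a b => a <= b)); auto.
  - apply (ray_filter a (fun a b => forall x, a <= x <= b -> Rabs (f x) <= K * wt x)).
    intros b Hb x Hx; apply H; lra.
  - exact A.
  - apply (is_RInt_gen_scal (V:=R_NormedModule)), wt_ray.
Qed.

Lemma rayI_ifun a : ifun (rayI a) (fun t => a <= t) wt (2 * (PI / 2 - atan a)).
Proof.
  split.
  - intros f g l m c [A B] [A' B']; split.
    + replace (Re (l + RtoC c * m)%C) with (plus (Re l) (scal c (Re m)))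
        by (unfold plus, scal, Re; simpl; unfold mult; simpl; ring).
      eapply (is_RInt_gen_ext (V:=R_NormedModule)); [ | apply (is_RInt_gen_plus (V:=R_NormedModule)); [ exact A | apply (is_RInt_gen_scal (V:=R_NormedModule)); exact A' ] ].
      apply filter_forall. intros ab t _. unfold plus, scal, mult, Re; simpl. unfold mult; simpl. ring.
    + replace (Im (l + RtoC c * m)%C) with (plus (Im l) (scal c (Im m)))
        by (unfold plus, scal, Im; simpl; unfold mult; simpl; ring).
      eapply (is_RInt_gen_ext (V:=R_NormedModule)); [ | apply (is_RInt_gen_plus (V:=R_NormedModule)); [ exact B | apply (is_RInt_gen_scal (V:=R_NormedModule)); exact B' ] ].
      apply filter_forall. intros ab t _. unfold plus, scal, mult, Im; simpl. unfold mult; simpl. ring.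
  - intros f l K [A B] K0 H.
    assert (X : Rabs (Re l) <= K * (PI / 2 - atan a)).
    { apply (ray_bound_real a (fun t => Re (f t))); auto.
      intros t Ht. eapply Rle_trans; [ apply re_le_Cmod | auto ]. }
    assert (Y : Rabs (Im l) <= K * (PI / 2 - atan a)).
    { apply (ray_bound_real a (fun t => Im (f t))); auto.
      intros t Ht. eapply Rle_trans; [ apply im_le_Cmod | auto ]. }
    eapply Rle_trans; [ apply Cmod_le_sum | lra ].
Qed.

Lemma powerRZ_neg2 r : 1 <= r -> powerRZ r (-2) <= 2 * wt r.
Proof.
  intros H. unfold wt. simpl. rewrite !Rmult_1_r.
  assert (0 < 1 + r * r) by nra.
  replace (2 * / (1 + r * r)) with (/ ((1 + r * r) / 2)) by (field; lra).
  apply Rinv_le_contravar; nra.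
Qed.

(** One integrable majorant for all rays close to the one through [p]. Beyond [M] it comes from the
    decay of order -2, on the remaining compact part from continuity through [tube_bound]. *)
Lemma ray_bound D F p : dom D -> (forall q, D q -> cont F q) -> SB D (-2) F -> D p ->
  exists d K, 0 < d /\ 0 <= K /\ forall q, (forall j, j <> dr -> Rabs (coord j q - coord j p) < d) ->
    pr p - d < pr q -> D q /\ Cmod (F q) <= K * wt (pr q).
Proof.
  intros HD HF HS Hp.
  destruct (HS p Hp) as (K1 & K10 & d1 & M & d10 & M1 & H1).
  set (b := Rmax (pr p) (M + 1)).
  assert (pr p <= b /\ M + 1 <= b) as [B1 B2] by (split; [ apply Rmax_l | apply Rmax_r ]).
  destruct (tube_bound D F dr p (pr p) b (dom_open _ HD) HF B1) as (d2 & K2 & d20 & K20 & H2).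
  { intros t Ht. apply (dom_up _ HD p); auto. change (pr p <= t); lra. }
  (* On the compact part [|r| <= N], hence [1 <= (1 + N^2) wt r], and a constant bound turns into a
     multiple of [wt]. *)
  set (N := Rabs (pr p) + d2 + Rabs M + 2).
  exists (Rmin d1 d2), (2 * K1 + K2 * (1 + N ^ 2)).
  pose proof (pow2_ge_0 N). pose proof (Rmin_l d1 d2); pose proof (Rmin_r d1 d2).
  assert (0 <= K2 * (1 + N ^ 2)) by (apply Rmult_le_pos; lra).
  split; [ apply Rmin_glb_lt; auto | split; [ lra | ] ].
  intros q Hq Hr. pose proof (wt_pos (pr q)) as W.
  destruct (Rle_dec (pr q) M) as [L|L].
  - destruct (H2 q) as [Q1 Q2].
    { split; [ intros j Hj; specialize (Hq j Hj); lra | change (coord dr q) with (pr q); lra ]. }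
    split; auto.
    assert (1 <= (1 + N ^ 2) * wt (pr q)).
    { unfold wt. apply (Rmult_le_reg_r (1 + pr q ^ 2)); [ pose proof (pow2_ge_0 (pr q)); lra | ].
      rewrite Rmult_assoc, Rinv_l by (pose proof (pow2_ge_0 (pr q)); lra).
      assert (Rabs (pr q) <= N).
      { unfold N. revert L Hr. unfold Rabs; repeat destruct Rcase_abs; lra. }
      assert (pr q ^ 2 <= N ^ 2) by (apply pow_maj_Rabs; auto). lra. }
    nra.
  - assert (Q : D q).
    { destruct (Rle_dec b (pr q)).
      - apply (dom_up _ HD (set_coord dr q b)); try reflexivity; auto. apply H2. split.
        + intros j Hj. rewrite coord_swap by auto. specialize (Hq j Hj); lra.
        + rewrite coord_set. lra.
      - apply H2. split; [ intros j Hj; specialize (Hq j Hj); lra | change (coord dr q) with (pr q); lra ]. }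
    split; auto. specialize (H1 q). simpl in H1.
    assert (nearuz p d1 q).
    { repeat split; [ pose proof (Hq du ltac:(discriminate)) | pose proof (Hq dx ltac:(discriminate))
       | pose proof (Hq dy ltac:(discriminate)) ]; simpl in *; lra. }
    specialize (H1 H5 ltac:(lra)).
    pose proof (powerRZ_neg2 (pr q) ltac:(lra)) as P. simpl in P.
    assert (K1 * / (pr q * (pr q * 1)) <= K1 * (2 * wt (pr q))) by (apply Rmult_le_compat_l; auto).
    nra.
Qed.

Definition J (F : pt -> C) (p : pt) : C :=
  @RInt_gen C_R_CompleteNormedModule (fun t => F (set_coord dr p t))
    (at_point (pr p)) (Rbar_locally p_infty).

Lemma J_of_ray F p l : rayI (pr p) (fun t => F (set_coord dr p t)) l -> J F p = l.
Proof. intros H. unfold J. exact (rayI_RInt _ _ _ H). Qed.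

Section Ray.
Context (D : pt -> Prop) (HD : dom D).

Lemma symb_base n F : symb D n F -> base D F.
Proof. apply symbol_base. Qed.

Lemma symb_SB n F : symb D n F -> SB D n F.
Proof. intros H. apply (Ck_bound _ _ _ _ _ (H O)). Qed.

Lemma symb_mono m n F : (m <= n)%Z -> symb D m F -> symb D n F.
Proof. apply symbol_mono, SB_bclass, HD. Qed.

Lemma symb_rpd i n F : symb D n F -> symb D (lower i n) (rpd i F).
Proof. apply symbol_rpd. Qed.

Lemma up_ray p t : D p -> pr p <= t -> D (set_coord dr p t).
Proof. intros Hp Ht. apply (dom_up _ HD p); auto. Qed.

Lemma J_rayI F p : symb D (-2) F -> D p -> rayI (pr p) (fun t => F (set_coord dr p t)) (J F p).
Proof.
  intros H Hp. pose proof (symb_base _ _ H) as HB.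
  destruct (ray_bound D F p HD (fun q Hq => proj1 (HB q Hq)) (symb_SB _ _ H) Hp) as (d & K & d0 & K0 & HK).
  destruct (rayI_ex (pr p) (fun t => F (set_coord dr p t)) K) as [l Hl].
  - intros t Ht. eexists. apply (line_isd D); auto using up_ray.
  - intros t Ht. apply (HK (set_coord dr p t)).
    + intros j Hj. rewrite coord_swap, Rminus_diag, Rabs_R0; auto.
    + change (pr p - d < t); lra.
  - unfold J. rewrite (rayI_RInt _ _ _ Hl). exact Hl.
Qed.

Lemma J_isd_j F j p : symb D (-2) F -> D p -> j <> dr ->
  isd (fun t => J F (set_coord j p t)) (coord j p) (J (rpd j F) p).
Proof.
  intros H Hp N.
  assert (H1 : symb D (-2) (rpd j F)) by (generalize (symb_rpd j _ _ H); destruct j; auto; congruence).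
  assert (H2 : symb D (-2) (rpd j (rpd j F))) by (generalize (symb_rpd j _ _ H1); destruct j; auto; congruence).
  destruct (ray_bound D (rpd j (rpd j F)) p HD (fun q Hq => proj1 (symb_base _ _ H2 q Hq)) (symb_SB _ _ H2) Hp)
    as (d & K & d0 & K0 & HK).
  assert (IN : forall h t, Rabs h < d -> pr p <= t ->
    D (set_coord j (set_coord dr p t) (coord j p + h)) /\ Cmod (rpd j (rpd j F) (set_coord j (set_coord dr p t) (coord j p + h))) <= K * wt t).
  { intros h t Hh Ht.
    assert (E : pr (set_coord j (set_coord dr p t) (coord j p + h)) = t).
    { change (coord dr (set_coord j (set_coord dr p t) (coord j p + h)) = t).
      rewrite coord_swap, coord_set; auto. }
    destruct (HK (set_coord j (set_coord dr p t) (coord j p + h))) as [A B].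
    - intros k Nk. destruct (classic (k = j)) as [->|Nj].
      + rewrite coord_set. replace (coord j p + h - coord j p) with h by ring; auto.
      + rewrite !coord_swap by auto. rewrite Rminus_diag, Rabs_R0; auto.
    - rewrite E; lra.
    - rewrite E in B; auto. }
  apply (param_isd _ _ _ _ (rayI_ifun (pr p)) (fun x t => F (set_coord j (set_coord dr p t) x))
    (fun t => rpd j F (set_coord dr p t)) _ _ _ d (2 * K)); auto; [ lra | | | ].
  - intros h Hh.
    assert (Hq : D (set_coord j p (coord j p + h))).
    { destruct (IN h (pr p) Hh (Rle_refl _)) as [A _].
      assert (E : set_coord dr p (pr p) = p) by apply (set_coord_id dr).
      rewrite E in A; exact A. }
    pose proof (J_rayI F _ H Hq) as X.
    assert (E : pr (set_coord j p (coord j p + h)) = pr p) by (apply (coord_swap dr j); auto).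
    rewrite E in X.
    eapply rayI_ext; [ | exact X ]. intros t _; cbv beta. rewrite (set_swap dr j); auto.
  - apply J_rayI; auto.
  - intros h t Hh Ht.
    pose proof (taylor2 (fun s => F (set_coord j (set_coord dr p t) s))
      (fun s => rpd j F (set_coord j (set_coord dr p t) s))
      (fun s => rpd j (rpd j F) (set_coord j (set_coord dr p t) s)) (coord j p) d (K * wt t)) as T.
    assert (IN' : forall s, Rabs (s - coord j p) < d ->
       D (set_coord j (set_coord dr p t) s) /\
       Cmod (rpd j (rpd j F) (set_coord j (set_coord dr p t) s)) <= K * wt t).
    { intros s Hs. replace s with (coord j p + (s - coord j p)) by ring. apply IN; auto. }
    assert (E : set_coord j (set_coord dr p t) (coord j p) = set_coord dr p t).
    { rewrite (set_swap j dr), set_coord_id; auto. }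
    cbv beta in T. rewrite E in T. rewrite E.
    replace (2 * K * h ^ 2 * wt t) with (2 * (K * wt t) * h ^ 2) by ring. apply T; auto.
    + intros s Hs; apply (line_isd D); [ apply (symb_base _ _ H) | apply IN'; auto ].
    + intros s Hs; apply (line_isd D); [ apply (symb_base _ _ H1) | apply IN'; auto ].
    + intros s Hs; apply IN'; auto.
Qed.

Lemma J_isd_r F p : symb D (-2) F -> D p ->
  isd (fun t => J F (set_coord dr p t)) (pr p) (- F p).
Proof.
  intros H Hp. pose proof (symb_base _ _ H) as HB.
  pose proof (opn_coord D dr p (dom_open _ HD) Hp) as L. simpl in L.
  set (f := fun t => F (set_coord dr p t)).
  (* Splitting the ray at [p] leaves an integral over a segment with moving lower end, to which the
     fundamental theorem of calculus applies. *)
  assert (X : forall t, D (set_coord dr p t) -> segI t (pr p) f (J F (set_coord dr p t) - J F p)%C).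
  { intros t Ht.
    assert (DD : forall s, Rmin t (pr p) <= s <= Rmax t (pr p) -> D (set_coord dr p s)).
    { intros s Hs. destruct (Rle_dec t (pr p)) as [A|A].
      - apply (dom_up _ HD (set_coord dr p t)); auto. change (t <= s). rewrite Rmin_left in Hs; lra.
      - apply up_ray; auto. rewrite Rmin_right in Hs; lra. }
    destruct (segI_ex t (pr p) f) as [l Hl].
    { intros s Hs. eexists; apply (line_isd D); auto. }
    assert (E : J F (set_coord dr p t) = (l + J F p)%C).
    { apply J_of_ray. change (rayI t f (l + J F p)%C). destruct (J_rayI F p H Hp) as [A1 A2]. destruct Hl as [B1 B2]. split.
      - apply (is_RInt_gen_Chasles (V:=R_NormedModule) _ (pr p) (Re l) (Re (J F p))); [ | exact A1 ].
        apply is_RInt_gen_at_point. exact B1.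
      - apply (is_RInt_gen_Chasles (V:=R_NormedModule) _ (pr p) (Im l) (Im (J F p))); [ | exact A2 ].
        apply is_RInt_gen_at_point. exact B2. }
    rewrite E. replace (l + J F p - J F p)%C with l by ring. exact Hl. }
  pose proof (ex_rpd_isd dr F p (proj2 (HB p Hp) dr)) as Y.
  destruct (isd_continuous _ _ _ Y) as [C1 C2].
  assert (E : F p = f (pr p)) by (unfold f; f_equal; symmetry; apply (set_coord_id dr)).
  rewrite E.
  apply (isd_ext_loc (fun t => (J F (set_coord dr p t) - J F p) + J F p)%C);
    [ apply filter_forall; intros; ring | ].
  replace (- f (pr p))%C with (- f (pr p) + 0)%C by ring.
  apply isd_add; [ | apply isd_const ].
  split.
  - apply (is_derive_RInt' (V:=R_NormedModule) (fun s => Re (f s)) (fun t => Re (J F (set_coord dr p t) - J F p)%C) (pr p) (pr p)); auto.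
    eapply filter_imp; [ | exact L ]. intros t Ht. apply (X t Ht).
  - apply (is_derive_RInt' (V:=R_NormedModule) (fun s => Im (f s)) (fun t => Im (J F (set_coord dr p t) - J F p)%C) (pr p) (pr p)); auto.
    eapply filter_imp; [ | exact L ]. intros t Ht. apply (X t Ht).
Qed.

Lemma J_rpd F i p : symb D (-2) F -> D p ->
  ex_rpd i (J F) p /\ rpd i (J F) p = match i with dr => (- F p)%C | _ => J (rpd i F) p end.
Proof.
  intros H Hp. apply isd_rpd.
  destruct i; [ | exact (J_isd_r F p H Hp) | | ].
  - exact (J_isd_j F du p H Hp ltac:(discriminate)).
  - exact (J_isd_j F dx p H Hp ltac:(discriminate)).
  - exact (J_isd_j F dy p H Hp ltac:(discriminate)).
Qed.

Lemma J_bound F p K : symb D (-2) F -> D p -> 0 <= K ->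
  (forall t, pr p <= t -> Cmod (F (set_coord dr p t)) <= K * wt t) ->
  Cmod (J F p) <= K * (2 * (PI / 2 - atan (pr p))).
Proof.
  intros H Hp K0 HK. apply (if_bound _ _ _ _ (rayI_ifun (pr p)) _ _ K (J_rayI F p H Hp) K0 HK).
Qed.

Lemma J_loc_bound F p : symb D (-2) F -> D p ->
  exists d K, 0 < d /\ forall q, bx p d q -> D q /\ Cmod (F q) <= K /\ Cmod (J F q) <= K.
Proof.
  intros H Hp. pose proof (symb_base _ _ H) as HB.
  destruct (ray_bound D F p HD (fun q Hq => proj1 (HB q Hq)) (symb_SB _ _ H) Hp) as (d & K & d0 & K0 & HK).
  exists d, (8 * K); split; auto. intros q Hq. rewrite bx_coord in Hq.
  assert (IN : forall t, pr q <= t -> D (set_coord dr q t) /\ Cmod (F (set_coord dr q t)) <= K * wt t).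
  { intros t Ht. apply (HK (set_coord dr q t)).
    - intros j Hj. rewrite coord_swap by auto. apply Hq.
    - specialize (Hq dr). change (Rabs (pr q - pr p) < d) in Hq. change (pr p - d < t).
      revert Hq; unfold Rabs; destruct Rcase_abs; lra. }
  assert (E : set_coord dr q (pr q) = q) by apply (set_coord_id dr).
  destruct (IN (pr q) (Rle_refl _)) as [Q1 Q2]. rewrite E in Q1, Q2.
  assert (W : wt (pr q) <= 1).
  { unfold wt. rewrite <- Rinv_1. apply Rinv_le_contravar; [ lra | ]. pose proof (pow2_ge_0 (pr q)); lra. }
  pose proof (wt_pos (pr q)). pose proof (wt_mass (pr q)).
  repeat split; auto; [ nra | ].
  eapply Rle_trans; [ apply (J_bound F q K); auto; apply IN | nra ].
Qed.

(** For [t >= r] and [n + 2 <= 0] one has [t^n <= r^(n+2) t^(-2)], and the tail of the weight beyond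
    [r] has mass at most [1 / r]. Of the constant [4 K], one factor 2 comes from [t^(-2) <= 2 wt t]
    and the other from bounding real and imaginary parts separately. *)
Lemma J_SB n F : symb D n F -> (n <= -2)%Z -> SB D (n + 1) (J F).
Proof.
  intros H Hn p Hp.
  assert (H2 : symb D (-2) F) by (apply (symb_mono n); auto).
  destruct (symb_SB _ _ H p Hp) as (K & K0 & HK).
  exists (4 * K); split; [ lra | ].
  destruct (nsc_and _ _ _ HK (nsc_D D p HD Hp)) as (d & M & d0 & M1 & X).
  exists d, M; split; auto; split; auto. intros q Hq Hr.
  destruct (X q Hq Hr) as [_ Dq].
  set (r := pr q) in *.
  assert (r1 : 1 <= r) by lra.
  assert (P0 : 0 < powerRZ r (n + 2)) by (apply powerRZ_lt; lra).
  eapply Rle_trans.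
  - apply (J_bound F q (K * (2 * powerRZ r (n + 2))) H2 Dq).
    + apply Rmult_le_pos; lra.
    + intros t Ht. fold r in Ht.
      destruct (X (set_coord dr q t) Hq) as [Y _]; [ change (M < t); lra | ]. change (pr (set_coord dr q t)) with t in Y.
      eapply Rle_trans; [ exact Y | ].
      rewrite Rmult_assoc. apply Rmult_le_compat_l; auto.
      replace n with ((n + 2) + -2)%Z at 1 by lia. rewrite (powerRZ_add t (n + 2) (-2)) by lra.
      assert (powerRZ t (n + 2) <= powerRZ r (n + 2)).
      { replace (n + 2)%Z with (- Z.of_nat (Z.to_nat (- (n + 2))))%Z by lia.
        rewrite !powerRZ_neg', <- !pow_powerRZ.
        apply Rinv_le_contravar; [ apply pow_lt; lra | apply pow_incr; lra ]. }
      pose proof (powerRZ_neg2 t ltac:(lra)).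
      assert (0 < powerRZ t (n + 2)) by (apply powerRZ_lt; lra).
      assert (0 < powerRZ t (-2)) by (apply powerRZ_lt; lra).
      replace (2 * powerRZ r (n + 2) * wt t) with (powerRZ r (n + 2) * (2 * wt t)) by ring.
      apply Rmult_le_compat; lra.
  - fold r.
    (* The tail mass is [atan (1 / r)], and [atan] has derivative at most 1. *)
    assert (A : PI / 2 - atan r <= / r).
    { rewrite <- atan_inv by lra.
      assert (i0 : 0 < / r) by (apply Rinv_0_lt_compat; lra).
      destruct (MVT_gen atan 0 (/ r) wt) as (c & C1 & C2).
      - intros; apply is_derive_atan.
      - intros x _. apply continuity_pt_filterlim.
        apply (ex_derive_continuous (K:=R_AbsRing) (V:=R_NormedModule) atan). eexists; apply is_derive_atan.
      - rewrite atan_0 in C2.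
        assert (wt c <= 1).
        { unfold wt. rewrite <- Rinv_1. apply Rinv_le_contravar; [ lra | ]. pose proof (pow2_ge_0 c); lra. }
        nra. }
    replace (n + 1)%Z with ((n + 2) + -1)%Z by lia. rewrite (powerRZ_add r (n + 2) (-1)) by lra.
    replace (powerRZ r (-1)) with (/ r) by (simpl; rewrite Rmult_1_r; auto).
    assert (0 <= K * powerRZ r (n + 2)) by (apply Rmult_le_pos; lra).
    replace (4 * K * (powerRZ r (n + 2) * / r)) with (4 * (K * powerRZ r (n + 2)) * / r) by ring.
    replace (K * (2 * powerRZ r (n + 2)) * (2 * (PI / 2 - atan r)))
      with (4 * (K * powerRZ r (n + 2)) * (PI / 2 - atan r)) by ring.
    apply Rmult_le_compat_l; lra.
Qed.

(** Derivatives other than [d_r] pass under the integral and keep the order, while the radial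
    derivative is [- F], of order [n = (n + 1) - 1]: exactly the pattern that symbols of order
    [n + 1] require. *)
Lemma J_symb n F : symb D n F -> (n <= -2)%Z -> symb D (n + 1) (J F).
Proof.
  intros H Hn k. revert F H. pose proof (SB_bclass D HD) as HB.
  assert (Bs : forall F, symb D n F -> base D (J F)).
  { intros F H0 p Hp.
    assert (H : symb D (-2) F) by (apply (symb_mono n); auto).
    split; [ | intros i; apply (J_rpd F i p H Hp) ].
    assert (Hi : forall i, i <> dr -> symb D (-2) (rpd i F)).
    { intros i Ni. generalize (symb_rpd i _ _ H). destruct i; auto; congruence. }
    destruct (J_loc_bound F p H Hp) as (d & K & d0 & HK).
    destruct (J_loc_bound (rpd du F) p (Hi du ltac:(discriminate)) Hp) as (d1 & K1 & d01 & HK1).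
    destruct (J_loc_bound (rpd dx F) p (Hi dx ltac:(discriminate)) Hp) as (d2 & K2 & d02 & HK2).
    destruct (J_loc_bound (rpd dy F) p (Hi dy ltac:(discriminate)) Hp) as (d3 & K3 & d03 & HK3).
    set (e := Rmin (Rmin d d1) (Rmin d2 d3)).
    assert (e <= d /\ e <= d1 /\ e <= d2 /\ e <= d3) as (E0 & E1 & E2 & E3).
    { unfold e. pose proof (Rmin_l (Rmin d d1) (Rmin d2 d3)); pose proof (Rmin_r (Rmin d d1) (Rmin d2 d3)).
      pose proof (Rmin_l d d1); pose proof (Rmin_r d d1). pose proof (Rmin_l d2 d3); pose proof (Rmin_r d2 d3). lra. }
    assert (e0 : 0 < e) by (unfold e; repeat apply Rmin_glb_lt; auto).
    assert (SH : forall q d', e <= d' -> bx p e q -> bx p d' q).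
    { intros q d' L; rewrite !bx_coord; intros X j; specialize (X j); lra. }
    apply (cont_lip _ p e (Rmax (Rmax K K1) (Rmax K2 K3)) e0).
    - intros i q Hq. apply (J_rpd F i q H). apply (HK q (SH q d E0 Hq)).
    - intros i q Hq. rewrite (proj2 (J_rpd F i q H (proj1 (HK q (SH q d E0 Hq))))).
      pose proof (Rmax_l (Rmax K K1) (Rmax K2 K3)); pose proof (Rmax_r (Rmax K K1) (Rmax K2 K3)).
      pose proof (Rmax_l K K1); pose proof (Rmax_r K K1); pose proof (Rmax_l K2 K3); pose proof (Rmax_r K2 K3).
      destruct (HK q (SH q d E0 Hq)) as (_ & A & _).
      destruct (HK1 q (SH q d1 E1 Hq)) as (_ & _ & A1).
      destruct (HK2 q (SH q d2 E2 Hq)) as (_ & _ & A2).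
      destruct (HK3 q (SH q d3 E3 Hq)) as (_ & _ & A3).
      destruct i; rewrite ?Cmod_opp; lra. }
  induction k as [|k IH]; intros F H; (split; [ apply Bs; auto | split; [ apply J_SB; auto | ] ]); auto.
  assert (H2 : symb D (-2) F) by (apply (symb_mono n); auto).
  intros i.
  apply (Ck_ext D (SB D) HB k _ (match i with dr => fopp F | _ => J (rpd i F) end)).
  - intros p Hp. destruct (J_rpd F i p H2 Hp) as [_ E]. destruct i; auto.
    rewrite E. unfold fopp, fmul, fcst; ring.
  - destruct i; simpl; try (apply IH; apply (symb_rpd du _ _ H) || apply (symb_rpd dx _ _ H) || apply (symb_rpd dy _ _ H)).
    replace (n + 1 - 1)%Z with n by lia. apply Ck_opp; auto.
Qed.

(** The uniqueness principle behind every identity between radial integrals: a function constant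
    along a ray and bounded by [K / r] vanishes there. *)
Lemma ray_zero H p : symb D (-1) H -> (forall q, D q -> pd ir H q = 0%C) -> D p -> H p = 0%C.
Proof.
  intros HS E Hp. pose proof (symb_base _ _ HS) as HB.
  assert (C : forall t, pr p <= t -> H (set_coord dr p t) = H p).
  { intros t Ht.
    assert (X : forall s, pr p <= s -> isd (fun s => H (set_coord dr p s)) s 0%C).
    { intros s Hs. eapply isd_eq; [ apply (line_isd D); auto using up_ray | ].
      apply (E (set_coord dr p s)); apply up_ray; auto. }
    assert (Z : H (set_coord dr p (pr p)) = H p) by (f_equal; apply (set_coord_id dr)).
    rewrite <- Z. destruct (Req_dec t (pr p)) as [->|N]; auto.
    apply C_eq; symmetry.
    - apply (eq_is_derive (fun s => Re (H (set_coord dr p s))) (pr p) t); [ | lra ].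
      intros s Hs; apply X; lra.
    - apply (eq_is_derive (fun s => Im (H (set_coord dr p s))) (pr p) t); [ | lra ].
      intros s Hs; apply X; lra. }
  destruct (symb_SB _ _ HS p Hp) as (K & K0 & HK).
  destruct (nsc_ray _ _ HK) as (M & M1 & X).
  apply Cmod_eq_0. destruct (Rle_lt_or_eq_dec _ _ (Cmod_ge_0 (H p))) as [L|L]; auto.
  (* At this radius [t |H p| >= K + 1], contradicting [t |H p| <= K]. *)
  exfalso. set (t := Rmax (pr p) (M + 1) + (K + 1) / Cmod (H p)).
  assert (0 < (K + 1) / Cmod (H p)) by (apply Rdiv_lt_0_compat; lra).
  pose proof (Rmax_l (pr p) (M + 1)); pose proof (Rmax_r (pr p) (M + 1)).
  assert (T : M < t /\ pr p <= t /\ (K + 1) / Cmod (H p) <= t) by (unfold t; lra).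
  destruct T as (T1 & T2 & T3).
  specialize (X t T1). simpl in X. rewrite Rmult_1_r in X.
  change (pu p, t, pz p) with (set_coord dr p t) in X. rewrite (C t T2) in X.
  apply (Rmult_le_compat_r t) in X; [ | lra ].
  rewrite Rmult_assoc, Rinv_l, Rmult_1_r in X by lra.
  apply (Rmult_le_compat_l (Cmod (H p))) in T3; [ | lra ].
  replace (Cmod (H p) * ((K + 1) / Cmod (H p))) with (K + 1) in T3 by (field; lra). lra.
Qed.
End Ray.

(** * Calculus of smooth functions and symbols *)

Definition ofR (f : pt -> R) : pt -> C := fun p => RtoC (f p).

Section SmoothRules.
Context (D : pt -> Prop) (O : opn D).
Let HB := TB_bclass D O.

Lemma sm_ext F G : (forall p, D p -> F p = G p) -> smooth D F -> smooth D G.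
Proof. apply (symbol_ext D TB HB). Qed.
Lemma sm_add F G : smooth D F -> smooth D G -> smooth D (fadd F G).
Proof. apply (symbol_add D TB HB). Qed.
Lemma sm_mul F G : smooth D F -> smooth D G -> smooth D (fmul F G).
Proof. apply (symbol_mul D TB HB 0 0). Qed.
Lemma sm_opp F : smooth D F -> smooth D (fopp F).
Proof. apply (symbol_opp D TB HB). Qed.
Lemma sm_cst c : smooth D (fcst c).
Proof. apply (symbol_cst D TB HB). Qed.
Lemma sm_inv F : smooth D F -> (forall p, D p -> F p <> 0%C) -> smooth D (finv F).
Proof. intros H N. apply (symbol_inv D TB HB 0); auto. exact I. Qed.
Lemma sm_pd m F : smooth D F -> smooth D (pd m F).
Proof. intros H k. eapply Ck_TB. apply (symbol_pd D TB HB m 0 F H k). Qed.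

Lemma pd_add m F G p : smooth D F -> smooth D G -> D p -> pd m (fadd F G) p = (pd m F p + pd m G p)%C.
Proof. apply symbol_pd_add. Qed.
Lemma pd_mul m F G p : smooth D F -> smooth D G -> D p ->
  pd m (fmul F G) p = (pd m F p * G p + F p * pd m G p)%C.
Proof. apply symbol_pd_mul. Qed.
Lemma pd_opp m F p : smooth D F -> D p -> pd m (fopp F) p = (- pd m F p)%C.
Proof.
  intros H Hp. unfold fopp. rewrite pd_mul; auto using sm_cst. rewrite pd_cst. unfold fcst; ring.
Qed.
Lemma pd_inv m F p : smooth D F -> D p -> F p <> 0%C ->
  pd m (finv F) p = (- pd m F p * (/ F p * / F p))%C.
Proof. apply symbol_pd_inv. Qed.
Lemma pd_ext m F G p : (forall q, D q -> F q = G q) -> D p -> pd m F p = pd m G p.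
Proof. apply (pd_ext_on D TB HB). Qed.

(** The last hypothesis is phrased level by level so that it can feed the induction: for [exp] the
    derivative is the same function and the hypothesis is an identity, for [ln] the derivative is an
    inverse whose smoothness is known beforehand. *)
Lemma sm_comp_real (g g' : R -> R) (f : pt -> R) :
  (forall p, D p -> is_derive g (f p) (g' (f p))) -> smooth D (ofR f) ->
  (forall k, Ck D TB k 0 (ofR (fun p => g (f p))) -> Ck D TB k 0 (ofR (fun p => g' (f p)))) ->
  smooth D (ofR (fun p => g (f p))).
Proof.
  intros Hg Hf HS k. pose proof (smooth_base _ _ Hf) as Bf.
  assert (Bs : base D (ofR (fun p => g (f p)))).
  { intros p Hp. destruct (Bf p Hp) as [[C1 _] E]. split.
    - split; [ | apply continuous_const ].
      apply (contR_comp g f p); [ eexists; apply Hg; auto | exact C1 ].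
    - intros i. apply (rpd_comp_real i g g' f p (Hg p Hp) (E i)). }
  induction k as [|k IH]; (split; [ exact Bs | split; [ exact I | ] ]); auto.
  intros i. apply (Ck_TB _ _ 0).
  apply (Ck_ext D TB HB k 0 (fmul (ofR (fun p => g' (f p))) (rpd i (ofR f)))).
  - intros p Hp. symmetry. apply (rpd_comp_real i g g' f p (Hg p Hp)). apply (Bf p Hp).
  - apply (Ck_mul D TB HB k 0 0); auto. apply (smooth_rpd _ i _ Hf).
Qed.

Lemma sm_exp f : smooth D (ofR f) -> smooth D (ofR (fun p => exp (f p))).
Proof.
  intros H. apply (sm_comp_real exp exp); auto. intros; apply is_derive_exp.
Qed.

Lemma is_derive_ln' x : 0 < x -> is_derive ln x (/ x).
Proof. intros H. apply is_derive_Reals, derivable_pt_lim_ln, H. Qed.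

Lemma sm_ln f : (forall p, D p -> 0 < f p) -> smooth D (ofR f) -> smooth D (ofR (fun p => ln (f p))).
Proof.
  intros P H. apply (sm_comp_real ln Rinv); auto.
  - intros; apply is_derive_ln'; auto.
  - intros k _. revert k. change (smooth D (ofR (fun p => / f p))).
    apply (sm_ext (finv (ofR f))).
    + intros p Hp. unfold finv, ofR. rewrite RtoC_inv; auto. apply Rgt_not_eq, P, Hp.
    + apply sm_inv; auto. intros p Hp E. apply RtoC_inj in E. specialize (P p Hp); lra.
Qed.

Lemma pd_exp m f p : smooth D (ofR f) -> D p ->
  pd m (ofR (fun p => exp (f p))) p = (RtoC (exp (f p)) * pd m (ofR f) p)%C.
Proof.
  intros H Hp. apply (symbol_pd_comp_real D TB m 0 exp exp f p H Hp), is_derive_exp.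
Qed.

Lemma pd_ln m f p : smooth D (ofR f) -> D p -> 0 < f p ->
  pd m (ofR (fun p => ln (f p))) p = (RtoC (/ f p) * pd m (ofR f) p)%C.
Proof.
  intros H Hp P. apply (symbol_pd_comp_real D TB m 0 ln Rinv f p H Hp), is_derive_ln', P.
Qed.
End SmoothRules.

Create HintDb sm.
#[export] Hint Resolve sm_add sm_mul sm_opp sm_cst sm_pd sm_exp : sm.

Lemma smooth_sub (D D' : pt -> Prop) F : (forall p, D' p -> D p) -> smooth D F -> smooth D' F.
Proof.
  intros S H k. revert F H. induction k as [|k IH]; intros F H;
    (split; [ intros p Hp; apply (smooth_base _ _ H), S, Hp | split; [ exact I | ] ]); auto.
  intros i. eapply Ck_TB, IH, smooth_rpd, H.
Qed.

(** * Functions independent of [r] *)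

Definition rindep (F : pt -> C) : Prop := forall q t, F (set_coord dr q t) = F q.

(** Independence is demanded at all points and not only in a domain. Since [Derive] is total and
    depends on the function alone, it then passes to every derivative with no differentiability at
    hand. *)
Lemma rindep_rpd i F : rindep F -> rindep (rpd i F).
Proof.
  intros H q t. destruct (classic (i = dr)) as [->|N].
  - assert (E : forall q, rpd dr F q = (0, 0)).
    { intros q'. unfold rpd. f_equal.
      - rewrite (Derive_ext _ (fun _ => Re (F q'))); [ apply Derive_const | intros s; rewrite H; auto ].
      - rewrite (Derive_ext _ (fun _ => Im (F q'))); [ apply Derive_const | intros s; rewrite H; auto ]. }
    rewrite !E; auto.
  - unfold rpd. rewrite (coord_swap i dr) by auto.
    f_equal; apply Derive_ext; intros s; rewrite (set_swap i dr), H; auto.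
Qed.

Lemma rindep_rpd_r F q : rindep F -> rpd dr F q = 0%C.
Proof.
  intros H. unfold rpd. apply injective_projections; simpl.
  - rewrite (Derive_ext _ (fun _ => Re (F q))); [ apply Derive_const | intros s; rewrite <- (H q s); auto ].
  - rewrite (Derive_ext _ (fun _ => Im (F q))); [ apply Derive_const | intros s; rewrite <- (H q s); auto ].
Qed.

Lemma rindep_pd m F : rindep F -> rindep (pd m F).
Proof.
  intros H q t. pose proof (fun i => rindep_rpd i F H q t) as X.
  destruct m as [| |[|]]; simpl; rewrite ?X; auto.
Qed.

Lemma rindep_pd_r F q : rindep F -> pd ir F q = 0%C.
Proof. apply rindep_rpd_r. Qed.

Lemma rindep_add F G : rindep F -> rindep G -> rindep (fadd F G).
Proof. intros H H' q t; unfold fadd; rewrite H, H'; auto. Qed.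
Lemma rindep_mul F G : rindep F -> rindep G -> rindep (fmul F G).
Proof. intros H H' q t; unfold fmul; rewrite H, H'; auto. Qed.
Lemma rindep_cst c : rindep (fcst c).
Proof. intros q t; reflexivity. Qed.
Lemma rindep_opp F : rindep F -> rindep (fopp F).
Proof. intros H; apply rindep_mul; auto using rindep_cst. Qed.
Lemma rindep_uz F : rindep (lift_uz F).
Proof. intros q t; reflexivity. Qed.
Lemma rindep_z F : rindep (lift_z F).
Proof. intros q t; reflexivity. Qed.
Lemma rindep_intu F : rindep F -> rindep (intu F).
Proof.
  intros H q t. unfold intu. change (pu (set_coord dr q t)) with (pu q).
  f_equal. apply functional_extensionality; intros s. rewrite (set_swap du dr) by discriminate. apply H.
Qed.
Lemma rindep_comp (g : R -> R) f : rindep (ofR f) -> rindep (ofR (fun p => g (f p))).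
Proof. intros H q t. specialize (H q t). apply RtoC_inj in H. unfold ofR; rewrite H; auto. Qed.

#[export] Hint Resolve rindep_pd rindep_add rindep_mul rindep_cst rindep_opp rindep_uz rindep_z rindep_intu : sm.

(** Data independent of [r] are only smooth on the union of the rays that meet [D]. *)
Definition cyl (D : pt -> Prop) (q : pt) : Prop := exists t, D (set_coord dr q t).

Lemma cyl_sub D q : D q -> cyl D q.
Proof. intros H; exists (pr q). destruct q as [[u r] z]; exact H. Qed.

Lemma cyl_opn D : opn D -> opn (cyl D).
Proof.
  intros O q [t Ht]. destruct (O _ Ht) as (d & d0 & Hd). exists d; split; auto.
  intros q' Hq'. exists t. apply Hd. rewrite bx_coord in *. intros j.
  destruct (classic (j = dr)) as [->|N].
  - rewrite !coord_set, Rminus_diag, Rabs_R0; auto.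
  - rewrite !(coord_swap j dr) by auto; auto.
Qed.

Lemma cyl_set D q t : cyl D q -> cyl D (set_coord dr q t).
Proof. intros [s Hs]; exists s; rewrite set_set; auto. Qed.

Lemma rindep_cont F q t : rindep F -> cont F (set_coord dr q t) -> cont F q.
Proof.
  intros H. assert (X : forall g : C -> R, contR (fun x => g (F x)) (set_coord dr q t) -> contR (fun x => g (F x)) q).
  { intros g Hg. apply contR_of_eps. intros e e0.
    destruct (contR_eps _ _ Hg e e0) as (d & d0 & Hd). exists d; split; auto.
    intros x Hx. specialize (Hd (set_coord dr x t)). cbv beta in Hd. rewrite !H in Hd. apply Hd.
    rewrite bx_coord in *. intros j.
    destruct (classic (j = dr)) as [->|N].
    - rewrite !coord_set, Rminus_diag, Rabs_R0; auto.
    - rewrite !(coord_swap j dr) by auto; auto. }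
  intros [A B]; split; [ apply (X Re A) | apply (X Im B) ].
Qed.

(** A shift along the ray carries a point of the cylinder into [D] and changes neither [F] nor its
    derivatives transverse to the ray. *)
Lemma smooth_cyl D F : opn D -> rindep F -> smooth D F -> smooth (cyl D) F.
Proof.
  intros O H HS k. revert F H HS. induction k as [|k IH]; intros F H HS.
  all: assert (Bs : base (cyl D) F).
  1, 3: intros q [t Ht]; pose proof (smooth_base _ _ HS _ Ht) as [A B]; split;
    [ apply (rindep_cont F q t H A) | intros i; destruct (classic (i = dr)) as [->|N];
      [ apply (isd_rpd dr F q 0%C); apply (isd_ext (fun _ => F q)); [ intros s; auto | apply isd_const ]
      | destruct (B i) as [B1 B2]; rewrite (coord_swap i dr) in B1, B2 by auto; split;
        [ eapply ex_derive_ext; [ | exact B1 ] | eapply ex_derive_ext; [ | exact B2 ] ];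
        intros s; cbv beta; rewrite (set_swap i dr) by auto; rewrite H; auto ] ].
  - split; [ exact Bs | split; [ exact I | exact I ] ].
  - split; [ exact Bs | split; [ exact I | ] ]. intros i.
    eapply Ck_TB. apply IH; [ apply rindep_rpd, H | apply smooth_rpd, HS ].
Qed.

(** The values near [p] are repeated along all nearby rays, so a local bound is already a bound of
    order 0; the radial derivative is zero and satisfies every bound. *)
Lemma rindep_symb D F : dom D -> rindep F -> smooth (cyl D) F -> symb D 0 F.
Proof.
  intros HD H HS k. revert F H HS. pose proof (SB_bclass D HD) as HB.
  induction k as [|k IH]; intros F H HS;
    (split; [ intros p Hp; apply (smooth_base _ _ HS p (cyl_sub D p Hp)) | ]).
  all: assert (SBF : SB D 0 F).
  1, 3: intros p Hp; destruct (cont_bound F p) as (d & K & d0 & HK);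
    [ apply (smooth_base _ _ HS p (cyl_sub D p Hp)) | ];
    exists (Rabs K); split; [ apply Rabs_pos | ];
    exists d, 1; split; [ auto | split; [ lra | ] ]; intros q (A & B & E) L;
    rewrite <- (H q (pr p)); simpl; rewrite Rmult_1_r;
    eapply Rle_trans; [ apply HK | apply Rle_abs ];
    repeat split; auto; change (Rabs (pr p - pr p) < d); rewrite Rminus_diag, Rabs_R0; auto.
  - split; auto.
  - split; auto. intros i. destruct (classic (i = dr)) as [->|N].
    + apply (Ck_ext D (SB D) HB k _ (fcst 0%C)); [ | apply Ck_zero; auto ].
      intros p _; symmetry; apply rindep_rpd_r, H.
    + replace (lower i 0) with 0%Z by (destruct i; auto; congruence).
      apply IH; [ apply rindep_rpd, H | apply smooth_rpd, HS ].
Qed.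

Definition rr : pt -> C := fun p => RtoC (pr p).

Lemma rpd_rr i p : ex_rpd i rr p /\ rpd i rr p = match i with dr => 1%C | _ => 0%C end.
Proof.
  apply isd_rpd. destruct i;
  [ exact (isd_const (RtoC (pr p)) (pu p)) | | exact (isd_const (RtoC (pr p)) (Re (pz p)))
  | exact (isd_const (RtoC (pr p)) (Im (pz p))) ].
  split.
  - apply (is_derive_ext (fun t => t)); [ reflexivity | exact (is_derive_id (pr p)) ].
  - exact (is_derive_const 0 (pr p)).
Qed.

Lemma pd_rr m p : pd m rr p = match m with ir => 1%C | _ => 0%C end.
Proof.
  pose proof (fun i => proj2 (rpd_rr i p)) as X.
  destruct m as [| |[|]]; simpl; rewrite ?X; auto; ring.
Qed.

Section Symb.
Context (D : pt -> Prop) (HD : dom D).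
Let HB := SB_bclass D HD.

Lemma so_ext n F G : (forall p, D p -> F p = G p) -> symb D n F -> symb D n G.
Proof. apply (symbol_ext D (SB D) HB). Qed.
Lemma so_le n m F : symb D m F -> (m <=? n)%Z = true -> symb D n F.
Proof. intros H L. apply (symb_mono D HD m); auto. apply Z.leb_le, L. Qed.
Lemma so_add m n F G : symb D m F -> symb D n G -> symb D (Z.max m n) (fadd F G).
Proof.
  intros H H'. apply (symbol_add D (SB D) HB);
  [ apply (symb_mono D HD m) | apply (symb_mono D HD n) ]; auto; lia.
Qed.
Lemma so_mul m n F G : symb D m F -> symb D n G -> symb D (m + n) (fmul F G).
Proof. apply (symbol_mul D (SB D) HB). Qed.
Lemma so_opp n F : symb D n F -> symb D n (fopp F).
Proof. apply (symbol_opp D (SB D) HB). Qed.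
Lemma so_cst c : symb D 0 (fcst c).
Proof. apply (symbol_cst D (SB D) HB). Qed.
Lemma so_pd_u n F : symb D n F -> symb D n (pd iu F).
Proof. apply (symbol_pd D (SB D) HB iu). Qed.
Lemma so_pd_r n F : symb D n F -> symb D (n - 1) (pd ir F).
Proof. apply (symbol_pd D (SB D) HB ir). Qed.
Lemma so_pd_a n A F : symb D n F -> symb D n (pd (ia A) F).
Proof. apply (symbol_pd D (SB D) HB (ia A)). Qed.
Lemma so_J n F : symb D n F -> (n <=? -2)%Z = true -> symb D (n + 1) (J F).
Proof. intros H L. apply J_symb; auto. apply Z.leb_le, L. Qed.

Lemma so_rr : symb D 1 rr.
Proof.
  assert (C : forall p, cont rr p).
  { intros p. split; [ | apply continuous_const ].
    apply contR_of_eps. intros e He. exists e; split; auto. intros q (_ & A & _); exact A. }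
  assert (B : base D rr) by (intros p _; split; auto; intros i; apply rpd_rr).
  intros k.
  assert (S : SB D 1 rr).
  { intros p Hp. exists 1; split; [ lra | ]. generalize (nsc_r p 1). apply nsc_imp.
    intros q [L _]. unfold rr. rewrite Cmod_R, Rabs_pos_eq by lra. simpl; lra. }
  destruct k; (split; [ exact B | split; [ exact S | ] ]); auto.
  intros i. apply (Ck_ext D (SB D) HB k _ (fcst (match i with dr => 1%C | _ => 0%C end))).
  - intros p _. rewrite (proj2 (rpd_rr i p)). reflexivity.
  - destruct i; simpl; try apply Ck_zero; auto. apply Ck_cst; auto.
Qed.

Lemma so_inv n F : symb D n F -> (forall p, D p -> F p <> 0%C) ->
  (forall p, D p -> exists c, 0 < c /\ nsc p (fun q => c * powerRZ (pr q) n <= Cmod (F q))) ->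
  symb D (- n) (finv F).
Proof.
  intros H N L. apply (symbol_inv D (SB D) HB); auto.
  intros p Hp. destruct (L p Hp) as (c & c0 & Hc). exists (/ c).
  split; [ left; apply Rinv_0_lt_compat; auto | ].
  generalize (nsc_and _ _ _ Hc (nsc_r p 1)). apply nsc_imp. intros q [A [B _]].
  assert (P : 0 < powerRZ (pr q) n) by (apply powerRZ_lt; lra).
  assert (P' : 0 < c * powerRZ (pr q) n) by (apply Rmult_lt_0_compat; auto).
  unfold finv. rewrite Cmod_inv.
  2:{ intros E. rewrite E, Cmod_0 in A. lra. }
  rewrite powerRZ_neg', <- Rinv_mult. apply Rinv_le_contravar; auto.
Qed.
End Symb.

Create HintDb so.

(** The order of an expression is computed from its syntax, by addition over products and maximum
    over sums, and then compared with the claimed order by evaluating [Z.leb]. For this reason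
    functions are written with [fadd], [fmul] and [pd], and each estimate below first rewrites its
    function so that the leading terms are gone from the syntax. *)
Ltac so_rec D HD := lazymatch goal with
  | |- symb _ _ (fadd _ _) => eapply (so_add D HD); so_rec D HD
  | |- symb _ _ (fmul _ _) => eapply (so_mul D HD); so_rec D HD
  | |- symb _ _ (fopp _) => eapply (so_opp D HD); so_rec D HD
  | |- symb _ _ (fcst _) => apply (so_cst D HD)
  | |- symb _ _ (pd iu _) => eapply (so_pd_u D HD); so_rec D HD
  | |- symb _ _ (pd ir _) => eapply (so_pd_r D HD); so_rec D HD
  | |- symb _ _ (pd (ia _) _) => eapply (so_pd_a D HD); so_rec D HD
  | |- symb _ _ rr => apply (so_rr D HD)
  | _ => solve [eauto 2 with so | eauto 4 with so] end.
Ltac so := lazymatch goal with HD : dom ?D |- symb ?D ?n _ =>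
  eapply (so_le D HD n); [ so_rec D HD | reflexivity ] end.

(** * The radial equations *)

Definition fsum2 (F : ang -> pt -> C) : pt -> C := fadd (F hol) (F ahol).
Definition fsum4 (F : idx -> pt -> C) : pt -> C :=
  fadd (fadd (F iu) (F ir)) (fsum2 (fun A => F (ia A))).
Definition fsub (F G : pt -> C) : pt -> C := fadd F (fopp G).
Definition along (X : vfield) (F : pt -> C) : pt -> C := fsum4 (fun n => fmul (X n) (pd n F)).

Definition flie (X Y : vfield) (m : idx) : pt -> C := fsub (along X (Y m)) (along Y (X m)).

Ltac unf := unfold flie, along, fsub, fsum4, fsum2 in *.
Ltac feval := unfold fopp, fadd, fmul, fcst.

Lemma fadd_e F G p : fadd F G p = (F p + G p)%C.
Proof. reflexivity. Qed.
Lemma fmul_e F G p : fmul F G p = (F p * G p)%C.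
Proof. reflexivity. Qed.
Lemma fopp_e F p : fopp F p = (- F p)%C.
Proof. unfold fopp, fmul, fcst; ring. Qed.
Lemma fcst_e c p : fcst c p = c.
Proof. reflexivity. Qed.

Lemma flie_eq X Y m p : flie X Y m p = lie_bracket X Y m p.
Proof. unf; unfold lie_bracket, sum4, sum2; feval; ring. Qed.

Section Bulk.
Context (D : pt -> Prop) (O : opn D).
Context (V : ang -> pt -> C) (gi : ang -> ang -> pt -> C) (W : pt -> C).
Context (smV : forall A, smooth D (V A)).
Context (smg : forall A B, smooth D (gi A B)).
Context (gsym : forall A B q, D q -> gi A B q = gi B A q).

Definition graise (A : ang) (F : pt -> C) : pt -> C := fsum2 (fun B => fmul (gi A B) (pd B F)).

Record NUvector (X : vfield) : Prop := {
  nv_smooth : forall m, smooth D (X m);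
  nv_u : forall q, D q -> pd ir (X iu) q = 0%C;
  nv_a : forall A q, D q -> pd ir (X (ia A)) q = graise A (X iu) q;
  nv_r : forall q, D q -> pd ir (X ir) q =
    fopp (fadd (pd iu (X iu)) (fsum2 (fun A => fmul (V A) (pd A (X iu))))) q }.

(** The variations of the inverse angular metric and of the shift induced by the Lie derivative along [X]. *)
Definition dginv (X : vfield) (A B : ang) : pt -> C :=
  fadd (fsub (along X (gi A B))
    (fsum2 (fun E => fadd (fmul (gi E B) (pd E (X (ia A)))) (fmul (gi A E) (pd E (X (ia B)))))))
  (fadd (fmul (V B) (graise A (X iu))) (fmul (V A) (graise B (X iu)))).

(** The inverse of a Newman-Unti metric has [g^{ur} = -1], [g^{rr} = -W], [g^{rA} = -V^A] and zero
    [uu] and [uA] entries. The formula is minus the Lie derivative of [g^{rA}], with [d_r X^A]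
    replaced by [graise A (X iu)] according to the radial equation; [dginv] arises from [g^{AB}] in
    the same manner. *)
Definition dshift (X : vfield) (A : ang) : pt -> C :=
  fsub (fadd (fsub (along X (V A)) (fmul (V A) (pd ir (X ir)))) (graise A (X ir)))
    (fadd (pd iu (X (ia A)))
      (fadd (fmul W (graise A (X iu))) (fsum2 (fun B => fmul (V B) (pd B (X (ia A))))))).

Context (X1 X2 : vfield) (e12 e21 fh : pt -> C).
Context (N1 : NUvector X1).
Context (N2 : NUvector X2).
Context (sm12 : smooth D e12).
Context (sm21 : smooth D e21).
Context (Hfh : forall q, D q -> fh q = fadd (fsub (flie X1 X2 iu) e12) e21 q).

Let smX1 := nv_smooth _ N1.
Let smX2 := nv_smooth _ N2.

Ltac sm := solve [auto 12 with sm].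
Ltac pdx := repeat (first [ rewrite (pd_add D) by sm | rewrite (pd_mul D) by sm | rewrite (pd_opp D O) by sm ]).

Lemma pd_ir_pd X (N : NUvector X) n p : D p ->
  pd ir (pd n (X iu)) p = 0%C /\
  (forall A, pd ir (pd n (X (ia A))) p = pd n (graise A (X iu)) p) /\
  pd ir (pd n (X ir)) p = pd n (fopp (fadd (pd iu (X iu)) (fsum2 (fun A => fmul (V A) (pd A (X iu)))))) p.
Proof.
  intros Hp. pose proof (nv_smooth _ N) as S. split; [ | split ].
  - rewrite (pd_comm D ir n) by auto.
    rewrite (pd_ext D O n _ (fcst 0%C)); auto using pd_cst. apply (nv_u _ N).
  - intros A. rewrite (pd_comm D ir n) by auto. apply (pd_ext D O); auto. apply (nv_a _ N).
  - rewrite (pd_comm D ir n) by auto. apply (pd_ext D O); auto. apply (nv_r _ N).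
Qed.

Lemma pd_n_ir X (N : NUvector X) n p : D p -> pd n (pd ir (X iu)) p = 0%C.
Proof. intros Hp. rewrite <- (pd_comm D ir n) by (auto; apply (nv_smooth _ N)). exact (proj1 (pd_ir_pd X N n p Hp)). Qed.

(** The two parenthesized terms are the radial derivatives of the variations of [xi^A]. Once the
    radial equations are inserted and [d_r] is commuted inward, only a polynomial identity in the
    remaining derivatives is left; the symmetry of [gi] closes it. *)
Lemma bulk_a A p : D p ->
  (pd ir (flie X1 X2 (ia A)) p
   - (graise A e12 p + sum2 (fun B => dginv X1 A B p * pd B (X2 iu) p))
   + (graise A e21 p + sum2 (fun B => dginv X2 A B p * pd B (X1 iu) p)))%C
  = graise A fh p.
Proof.
  intros Hp.
  assert (E : forall B : ang, pd B fh p = pd B (fadd (fsub (flie X1 X2 iu) e12) e21) p)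
    by (intros B; apply (pd_ext D O); auto).
  change (graise A fh p) with (gi A hol p * pd hol fh p + gi A ahol p * pd ahol fh p)%C.
  rewrite !E. clear E.
  unf. pdx.
  rewrite !(nv_u _ N1), !(nv_u _ N2), !(nv_a _ N1), !(nv_a _ N2), !(nv_r _ N1), !(nv_r _ N2) by auto.
  repeat match goal with
  | |- context [pd ir (pd ?n (X1 (ia A))) p] => rewrite (proj1 (proj2 (pd_ir_pd X1 N1 n p Hp)) A)
  | |- context [pd ir (pd ?n (X2 (ia A))) p] => rewrite (proj1 (proj2 (pd_ir_pd X2 N2 n p Hp)) A)
  end.
  rewrite !(pd_n_ir X1 N1), !(pd_n_ir X2 N2) by auto.
  unfold dginv, graise, sum2. unf. pdx.
  rewrite !(proj1 (pd_ir_pd X1 N1 _ p Hp)), !(proj1 (pd_ir_pd X2 N2 _ p Hp)).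
  feval. rewrite ?(nv_u _ N1), ?(nv_u _ N2) by auto.
  rewrite ?(pd_comm D hol iu), ?(pd_comm D ahol iu), ?(pd_comm D ahol hol) by (auto; apply smX1 || apply smX2).
  rewrite (gsym ahol hol) by auto.
  destruct A; ring.
Qed.

(** The same mechanism for [xi^r], with opposite signs because [V] enters its radial equation
    negatively. [W] occurs only in the two shift variations, multiplied by [g^{AB} d_A f1 d_B f2],
    and drops out by symmetry. *)
Lemma bulk_r p : D p ->
  (pd ir (flie X1 X2 ir) p
   + (pd iu e12 p + sum2 (fun B => V B p * pd B e12 p + dshift X1 B p * pd B (X2 iu) p))
   - (pd iu e21 p + sum2 (fun B => V B p * pd B e21 p + dshift X2 B p * pd B (X1 iu) p)))%C
  = (- (pd iu fh p + sum2 (fun B => V B p * pd B fh p)))%C.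
Proof.
  intros Hp.
  assert (E : forall m, pd m fh p = pd m (fadd (fsub (flie X1 X2 iu) e12) e21) p)
    by (intros m; apply (pd_ext D O); auto).
  unfold sum2. rewrite !E. clear E.
  unf. pdx.
  rewrite ?(nv_u _ N1), ?(nv_u _ N2), ?(nv_a _ N1), ?(nv_a _ N2), ?(nv_r _ N1), ?(nv_r _ N2) by auto.
  repeat match goal with
  | |- context [pd ir (pd ?n (X1 ir)) p] => rewrite (proj2 (proj2 (pd_ir_pd X1 N1 n p Hp)))
  | |- context [pd ir (pd ?n (X2 ir)) p] => rewrite (proj2 (proj2 (pd_ir_pd X2 N2 n p Hp)))
  end.
  rewrite ?(pd_n_ir X1 N1), ?(pd_n_ir X2 N2) by auto.
  unfold dshift, graise. unf. pdx.
  rewrite ?(proj1 (pd_ir_pd X1 N1 _ p Hp)), ?(proj1 (pd_ir_pd X2 N2 _ p Hp)).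
  feval. rewrite ?(nv_u _ N1), ?(nv_u _ N2), ?(nv_r _ N1), ?(nv_r _ N2) by auto. feval.
  rewrite ?(pd_comm D hol iu), ?(pd_comm D ahol iu), ?(pd_comm D ahol hol) by (auto; apply smX1 || apply smX2).
  rewrite ?(gsym ahol hol) by auto. unf; feval.
  ring.
Qed.
End Bulk.

(** * Newman-Unti geometry at null infinity *)

Ltac sm_rec D := lazymatch goal with
  | |- smooth D (fadd _ _) => apply (sm_add D); [ solve [ auto ] | sm_rec D | sm_rec D ]
  | |- smooth D (fmul _ _) => apply (sm_mul D); [ solve [ auto ] | sm_rec D | sm_rec D ]
  | |- smooth D (fopp _) => apply (sm_opp D); [ solve [ auto ] | sm_rec D ]
  | |- smooth D (pd _ _) => first [ apply (sm_pd D); [ solve [ auto ] | sm_rec D ] | solve [ auto with sm ] ]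
  | |- _ => solve [ auto 2 with sm | auto 20 with sm ] end.
Ltac sm := lazymatch goal with |- smooth ?D _ => sm_rec D | |- _ => solve [ auto 20 with sm ] end.
Ltac pdx D O := repeat (first [ rewrite (pd_add D) by sm | rewrite (pd_mul D) by sm | rewrite (pd_opp D O) by sm
  | rewrite pd_cst | rewrite pd_rr | rewrite fadd_e | rewrite fmul_e | rewrite fopp_e | rewrite fcst_e ]).

(** Remainder of the angular metric after its [r^2] term; [Wrem] is that of [W] after its linear
    term. Their orders, 1 and 0, are the form in which the fall-off conditions enter all
    estimates. *)
Definition hrem (phi : R -> C -> R) (h : ang -> ang -> pt -> C) (A B : ang) : pt -> C :=
  fsub (h A B) (fmul (fmul rr rr) (gam phi A B)).
Definition cfac (phi : R -> C -> R) : pt -> R := fun p => phi (pu p) (pz p).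
Definition Wrem (phi : R -> C -> R) (W : pt -> C) : pt -> C :=
  fadd W (fmul (fmul (fcst (RtoC 2)) rr) (pd iu (ofR (cfac phi)))).

Record NUgeom (D : pt -> Prop) (W : pt -> C) (V : ang -> pt -> C) (h : ang -> ang -> pt -> C)
    (phi : R -> C -> R) : Prop := {
  ng_W : smooth D W;
  ng_h : forall A B, smooth D (h A B);
  ng_sym : forall A B p, D p -> h A B p = h B A p;
  ng_det : forall p, D p -> det2 (fun A B => h A B p) <> RtoC 0;
  ng_phi : smooth (cyl D) (ofR (cfac phi));
  ng_hrem : forall A B, symb D 1 (hrem phi h A B);
  ng_V : forall A, symb D (-2) (V A);
  ng_Wrem : symb D 0 (Wrem phi W) }.

Section Geometry.
Context (D : pt -> Prop) (HD : dom D).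
Let O := dom_open D HD.
Context (W : pt -> C) (V : ang -> pt -> C) (h : ang -> ang -> pt -> C) (phi : R -> C -> R).
Context (G : NUgeom D W V h phi).
Local Notation ph := (cfac phi).
Local Notation hr := (hrem phi h).
Local Notation wr := (Wrem phi W).
Let smW : smooth D W := ng_W _ _ _ _ _ G.
Let smh : forall A B, smooth D (h A B) := ng_h _ _ _ _ _ G.
Let hsym : forall A B p, D p -> h A B p = h B A p := ng_sym _ _ _ _ _ G.
Let hdet : forall p, D p -> det2 (fun A B => h A B p) <> RtoC 0 := ng_det _ _ _ _ _ G.
Let smph : smooth (cyl D) (ofR ph) := ng_phi _ _ _ _ _ G.
Let soH : forall A B, symb D 1 (hr A B) := ng_hrem _ _ _ _ _ G.
Let soV : forall A, symb D (-2) (V A) := ng_V _ _ _ _ _ G.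
Let soW : symb D 0 wr := ng_Wrem _ _ _ _ _ G.

Lemma smV A : smooth D (V A).
Proof. eapply symb_smooth, soV. Qed.
Lemma sm_rr : smooth D rr.
Proof. eapply symb_smooth, (so_rr D HD). Qed.
Hint Resolve smV sm_rr smW smh : sm.

Lemma sm_exp_ph c : smooth (cyl D) (ofR (fun p => exp (c * ph p))).
Proof.
  apply (sm_exp _ (cyl_opn D O) (fun p => c * ph p)).
  apply (sm_ext (cyl D) (cyl_opn D O) (fmul (fcst (RtoC c)) (ofR ph))).
  - intros p _; unfold fmul, fcst, ofR. rewrite RtoC_mult; auto.
  - apply sm_mul; auto using sm_cst, cyl_opn.
Qed.

Lemma pd_exp_ph m c p : cyl D p ->
  pd m (ofR (fun p => exp (c * ph p))) p = (RtoC (c * exp (c * ph p)) * pd m (ofR ph) p)%C.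
Proof.
  intros Hp.
  rewrite (pd_exp (cyl D) m (fun p => c * ph p)); auto.
  - rewrite (pd_ext (cyl D) (cyl_opn D O) m _ (fmul (fcst (RtoC c)) (ofR ph))); auto.
    + rewrite (pd_mul (cyl D)); auto using sm_cst, cyl_opn. rewrite pd_cst. unfold fcst.
      rewrite RtoC_mult. ring.
    + intros q _; unfold fmul, fcst, ofR. rewrite RtoC_mult; auto.
  - apply (sm_ext (cyl D) (cyl_opn D O) (fmul (fcst (RtoC c)) (ofR ph))).
    + intros q _; unfold fmul, fcst, ofR. rewrite RtoC_mult; auto.
    + apply sm_mul; auto using sm_cst, cyl_opn.
Qed.

Lemma rindep_exp_ph c : rindep (ofR (fun p => exp (c * ph p))).
Proof. intros q t; reflexivity. Qed.
Lemma rindep_ph : rindep (ofR ph).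
Proof. intros q t; reflexivity. Qed.

Lemma so_exp_ph c : symb D 0 (ofR (fun p => exp (c * ph p))).
Proof. apply rindep_symb; auto using rindep_exp_ph, sm_exp_ph. Qed.
Lemma so_ph : symb D 0 (ofR ph).
Proof. apply rindep_symb; auto using rindep_ph. Qed.
Hint Resolve so_exp_ph so_ph soH soV soW : so.

Lemma gam_eq A B p : gam phi A B p = match A, B with
  | hol, ahol | ahol, hol => fmul (fcst (RtoC (/ 2))) (ofR (fun p => exp (2 * ph p))) p
  | _, _ => 0%C end.
Proof.
  destruct A, B; auto; unfold gam, fmul, fcst, ofR, cfac; unfold Rdiv; rewrite RtoC_mult; ring.
Qed.

Lemma so_gam A B : symb D 0 (gam phi A B).
Proof.
  destruct A, B.
  1, 4: apply (so_ext D HD _ (fcst 0%C)); [ intros; rewrite gam_eq; auto | so ].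
  all: apply (so_ext D HD _ (fmul (fcst (RtoC (/ 2))) (ofR (fun p => exp (2 * ph p)))));
    [ intros; rewrite gam_eq; auto | so ].
Qed.
Hint Resolve so_gam : so.

Lemma h_split A B p : h A B p = fadd (fmul (fmul rr rr) (gam phi A B)) (hr A B) p.
Proof. unfold hrem; unf; feval; ring. Qed.

Lemma so_h A B : symb D 2 (h A B).
Proof.
  apply (so_ext D HD _ (fadd (fmul (fmul rr rr) (gam phi A B)) (hr A B))).
  - intros; symmetry; apply h_split.
  - so.
Qed.
Hint Resolve so_h : so.

Definition fdet : pt -> C := fsub (fmul (h hol hol) (h ahol ahol)) (fmul (h hol ahol) (h ahol hol)).

Lemma fdet_eq p : fdet p = det2 (fun A B => h A B p).
Proof. unfold fdet, det2; unf; feval; ring. Qed.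

Lemma fdet_ne p : D p -> fdet p <> 0%C.
Proof. intros Hp; rewrite fdet_eq; auto. Qed.

(** The determinant is [- r^4 exp (4 phi) / 4] up to order 3, so for large [r] its modulus is at
    least a multiple of [r^4]. This is the lower bound under which inverting the angular metric
    stays within symbols. *)
Lemma fdet_lower p : D p ->
  exists c, 0 < c /\ nsc p (fun q => c * powerRZ (pr q) 4 <= Cmod (fdet q)).
Proof.
  intros Hp.
  set (N := fsub (fmul (h hol hol) (h ahol ahol))
     (fadd (fmul (hr hol ahol) (h ahol hol)) (fmul (fmul (fmul rr rr) (gam phi hol ahol)) (hr ahol hol)))).
  assert (SN : symb D 3 N).
  { unfold N; unf.
    (* [gam] has no diagonal entries in [(zeta, conj zeta)], so this entry gains one order; the
       generic order 2 would make [N] as large as the leading term. *)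
    assert (A0 : symb D 1 (h hol hol)).
    { apply (so_ext D HD _ (hr hol hol)); auto.
      intros q _; rewrite h_split; feval. rewrite gam_eq; ring. }
    eapply (so_le D HD 3);
      [ apply so_add; auto; [ apply so_mul; [ auto | exact A0 | apply so_h ] | so_rec D HD ] | reflexivity ]. }
  destruct (symb_SB _ _ _ SN p Hp) as (K & K0 & HK).
  assert (C4 : contR (fun q => exp (4 * ph q)) p).
  { apply (proj1 (proj1 (smooth_base _ _ (sm_exp_ph 4) p (cyl_sub D p Hp)))). }
  set (e4 := exp (4 * ph p)). assert (e40 : 0 < e4) by apply exp_pos.
  destruct (contR_eps _ p C4 (e4 / 2) ltac:(lra)) as (d & d0 & Hd).
  (* By continuity [exp (4 phi)] stays above [e4 / 2], so the leading term is at least [e4 r^4 / 8].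
     For [r > 16 K / e4] the remainder takes away at most half of it. *)
  exists (e4 / 16). split; [ lra | ].
  assert (N1 : nsc p (fun q => e4 / 2 <= exp (4 * ph q))).
  { exists d, 1; split; auto; split; [ lra | ]. intros q (A & B & E) _.
    specialize (Hd (set_coord dr q (pr p))).
    change (ph (set_coord dr q (pr p))) with (ph q) in Hd. fold e4 in Hd.
    assert (X : bx p d (set_coord dr q (pr p))).
    { repeat split; auto. change (Rabs (pr p - pr p) < d). rewrite Rminus_diag, Rabs_R0; auto. }
    specialize (Hd X). revert Hd. unfold Rabs; destruct Rcase_abs; lra. }
  generalize (nsc_and _ _ _ (nsc_r p (16 * K / e4)) (nsc_and _ _ _ HK N1)). apply nsc_imp.
  intros q [[R1 R2] [A B]].
  assert (E : fdet q = (RtoC (- (/ 4) * pr q ^ 4 * exp (4 * ph q)) + N q)%C).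
  { unfold fdet, N; unf; feval.
    rewrite (h_split hol ahol), (h_split ahol hol). feval. rewrite !gam_eq. unfold fmul, fcst, ofR, rr.
    replace (exp (4 * ph q)) with (exp (2 * ph q) * exp (2 * ph q)) by (rewrite <- exp_plus; f_equal; ring).
    rewrite !RtoC_mult, !RtoC_opp, !RtoC_inv, !RtoC_pow by lra.
    apply injective_projections; simpl; field. }
  assert (P : K * powerRZ (pr q) 3 <= e4 / 16 * pr q ^ 4).
  { simpl powerRZ. apply (Rmult_lt_compat_r e4) in R2; [ | lra ].
    replace (16 * K / e4 * e4) with (16 * K) in R2 by (field; lra).
    assert (0 < pr q ^ 3) by (apply pow_lt; lra). simpl in *. nra. }
  change (powerRZ (pr q) 4) with (pr q ^ 4). simpl in P.
  assert (Q : 0 < pr q ^ 4) by (apply pow_lt; lra).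
  rewrite E.
  assert (T : Cmod (RtoC (- / 4 * pr q ^ 4 * exp (4 * ph q))) = / 4 * pr q ^ 4 * exp (4 * ph q)).
  { rewrite Cmod_R, Rabs_left1; [ ring | ]. pose proof (exp_pos (4 * ph q)).
    assert (0 < pr q ^ 4 * exp (4 * ph q)) by (apply Rmult_lt_0_compat; auto). lra. }
  assert (T2 : Cmod (RtoC (- / 4 * pr q ^ 4 * exp (4 * ph q))) <=
     Cmod (RtoC (- / 4 * pr q ^ 4 * exp (4 * ph q)) + N q)%C + Cmod (N q)).
  { replace (RtoC (- / 4 * pr q ^ 4 * exp (4 * ph q))) with
      ((RtoC (- / 4 * pr q ^ 4 * exp (4 * ph q)) + N q) + - N q)%C at 1 by ring.
    eapply Rle_trans; [ apply Cmod_triangle | rewrite Cmod_opp; lra ]. }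
  rewrite T in T2. simpl in A.
  assert (pr q ^ 4 * (e4 / 2) <= pr q ^ 4 * exp (4 * ph q)) by (apply Rmult_le_compat_l; lra).
  simpl in *. lra.
Qed.

Definition idet : pt -> C := finv fdet.

Lemma so_idet : symb D (-4) idet.
Proof.
  apply (so_inv D HD 4).
  - unfold fdet; unf. so.
  - apply fdet_ne.
  - apply fdet_lower.
Qed.
Hint Resolve so_idet : so.

Definition gi : ang -> ang -> pt -> C := ginv (nu_metric W V h).

Definition gic (A B : ang) : pt -> C := match A, B with
  | hol, hol => fmul (h ahol ahol) idet
  | ahol, ahol => fmul (h hol hol) idet
  | _, _ => fmul (fopp (h A B)) idet end.

Lemma gi_eq A B : gi A B = gic A B.
Proof.
  apply functional_extensionality; intros p. unfold gi, ginv, inv2. simpl nu_metric.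
  destruct A, B; unfold gic, idet, finv; feval; rewrite fdet_eq; unfold Cdiv; try ring.
Qed.

Lemma so_gi A B : symb D (-2) (gi A B).
Proof. rewrite gi_eq; destruct A, B; unfold gic; so. Qed.
Hint Resolve so_gi : so.
Lemma sm_gi A B : smooth D (gi A B).
Proof. eapply symb_smooth, so_gi. Qed.
Lemma sm_idet : smooth D idet.
Proof. eapply symb_smooth, so_idet. Qed.
Hint Resolve sm_gi sm_idet : sm.

Lemma gi_sym A B p : D p -> gi A B p = gi B A p.
Proof.
  intros Hp; rewrite !gi_eq; destruct A, B; auto; unfold gic; feval; rewrite (hsym hol ahol) by auto; auto.
Qed.

Lemma det_ne p : D p -> (h hol hol p * h ahol ahol p - h hol ahol p * h hol ahol p)%C <> 0%C.
Proof.
  intros Hp E. apply (hdet p Hp). unfold det2. rewrite (hsym ahol hol) by auto. exact E.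
Qed.

Lemma idet_val p : D p -> idet p = (/ (h hol hol p * h ahol ahol p - h hol ahol p * h hol ahol p))%C.
Proof.
  intros Hp. unfold idet, finv. f_equal. unfold fdet; unf; feval. rewrite (hsym ahol hol) by auto. ring.
Qed.

Lemma gi_h A B p : D p -> sum2 (fun E => gi A E p * h E B p)%C =
  match A, B with hol, hol | ahol, ahol => 1%C | _, _ => 0%C end.
Proof.
  intros Hp. unfold sum2. rewrite !gi_eq. pose proof (det_ne p Hp) as N.
  destruct A, B; unfold gic; feval; rewrite ?(hsym ahol hol), idet_val by auto; field; exact N.
Qed.

Lemma pd_gi m A B p : D p -> pd m (gi A B) p =
  (- sum2 (fun E => sum2 (fun F => gi A E p * pd m (h E F) p * gi F B p)))%C.
Proof.
  intros Hp. unfold sum2. rewrite !gi_eq. pose proof (det_ne p Hp) as N.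
  assert (I : pd m idet p = (- pd m fdet p * (idet p * idet p))%C).
  { apply (pd_inv D); auto; [ | apply fdet_ne; auto ]. unfold fdet; unf; sm. }
  assert (S : pd m (h ahol hol) p = pd m (h hol ahol) p).
  { apply (pd_ext D O); auto. }
  destruct A, B; unfold gic; pdx D O; rewrite I; unfold fdet; unf; pdx D O; feval; rewrite S;
    rewrite ?(hsym ahol hol), idet_val by auto; field; exact N.
Qed.

Definition gaminv (A B : ang) : pt -> C := match A, B with
  | hol, ahol | ahol, hol => fmul (fcst (RtoC 2)) (ofR (fun p => exp (-2 * ph p)))
  | _, _ => fcst 0%C end.

Lemma so_gaminv A B : symb D 0 (gaminv A B).
Proof. destruct A, B; unfold gaminv; so. Qed.
Hint Resolve so_gaminv : so.

Lemma exp_ph_cancel q : (RtoC (exp (-2 * ph q)) * RtoC (exp (2 * ph q)))%C = 1%C.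
Proof. rewrite <- RtoC_mult, <- exp_plus. replace (-2 * ph q + 2 * ph q) with 0 by ring. rewrite exp_0; auto. Qed.

(** Resolvent identity, in matrix form: [r^2 g^{-1} - gam^{-1} = - g^{-1} (h - r^2 gam) gam^{-1}],
    of order [-2 + 1 + 0]. *)
Lemma so_gi_lead A B : symb D (-1) (fsub (fmul (fmul rr rr) (gi A B)) (gaminv A B)).
Proof.
  apply (so_ext D HD _ (fopp (fsum2 (fun E => fsum2 (fun F => fmul (gi A E) (fmul (hr E F) (gaminv F B))))))).
  - intros p Hp. unf. feval. unfold hrem; unf; feval. rewrite !gam_eq; unfold gaminv. feval. unfold ofR.
    pose proof (gi_h A hol p Hp) as H1. pose proof (gi_h A ahol p Hp) as H2. unfold sum2 in *.
    pose proof (exp_ph_cancel p) as X.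
    set (e := RtoC (exp (2 * ph p))) in *. set (e' := RtoC (exp (-2 * ph p))) in *.
    set (r := rr p) in *.
    assert (H3 : RtoC (/ 2) = (/ 2)%C) by (rewrite RtoC_inv; auto; lra).
    destruct B.
    + transitivity (r * r * gi A hol p * (e' * e) - (gi A hol p * h hol ahol p + gi A ahol p * h ahol ahol p) * (2 * e'))%C.
      { rewrite H3. cbv beta iota. change (RtoC (exp (-2 * ph p))) with e'. field. }
      rewrite H2, X. destruct A; unfold fmul, fcst, ofR; fold e'; ring.
    + transitivity (r * r * gi A ahol p * (e' * e) - (gi A hol p * h hol hol p + gi A ahol p * h ahol hol p) * (2 * e'))%C.
      { rewrite H3. cbv beta iota. change (RtoC (exp (-2 * ph p))) with e'. field. }
      rewrite H1, X. destruct A; unfold fmul, fcst, ofR; fold e'; ring.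
  - unf. so.
Qed.

(** In matrix form the function is [- g^{-1} (r d_r h - 2 h) g^{-1}]. The operator [r d_r - 2]
    annihilates [r^2 gam], so the middle factor has order 1 only. *)
Lemma so_gi_r A B : symb D (-3) (fadd (fmul (fcst (RtoC 2)) (gi A B)) (fmul rr (pd ir (gi A B)))).
Proof.
  apply (so_ext D HD _ (fopp (fsum2 (fun E => fsum2 (fun F => fmul (gi A E)
    (fmul (fsub (fmul rr (pd ir (hr E F))) (fmul (fcst (RtoC 2)) (hr E F))) (gi F B))))))).
  - intros p Hp.
    assert (X : forall E F, (rr p * pd ir (hr E F) p - 2 * hr E F p = rr p * pd ir (h E F) p - 2 * h E F p)%C).
    { intros E F. unfold hrem. unf. pose proof (symb_smooth _ _ _ (so_gam E F)). pdx D O.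
      rewrite (rindep_pd_r (gam phi E F)) by (intros ? ?; destruct E, F; reflexivity).
      feval. ring. }
    unf. feval.
    replace (fun x => - (1) * x)%C with (fun x => - x)%C by (apply functional_extensionality; intros; ring).
    rewrite (pd_gi ir A B p Hp). unfold sum2.
    assert (X' : forall E F, (rr p * pd ir (hr E F) p + - (1) * (2 * hr E F p) = rr p * pd ir (h E F) p - 2 * h E F p)%C).
    { intros E F; rewrite <- X; ring. }
    rewrite !X'.
    pose proof (gi_h A hol p Hp) as H1. pose proof (gi_h A ahol p Hp) as H2. unfold sum2 in *.
    transitivity (2 * ((gi A hol p * h hol hol p + gi A ahol p * h ahol hol p) * gi hol B p
       + (gi A hol p * h hol ahol p + gi A ahol p * h ahol ahol p) * gi ahol B p)
       - rr p * (gi A hol p * pd ir (h hol hol) p * gi hol B p + gi A hol p * pd ir (h hol ahol) p * gi ahol B p +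
       (gi A ahol p * pd ir (h ahol hol) p * gi hol B p + gi A ahol p * pd ir (h ahol ahol) p * gi ahol B p)))%C.
    { ring. }
    rewrite H1, H2. destruct A; ring.
  - unf. so.
Qed.

(** The same argument with [d_u - 2 d_u phi], which annihilates [r^2 gam] because [gam] is
    proportional to [exp (2 phi)]. *)
Lemma so_gi_u A B : symb D (-3) (fadd (pd iu (gi A B)) (fmul (fcst (RtoC 2)) (fmul (pd iu (ofR ph)) (gi A B)))).
Proof.
  apply (so_ext D HD _ (fopp (fsum2 (fun E => fsum2 (fun F => fmul (gi A E)
    (fmul (fsub (pd iu (hr E F)) (fmul (fcst (RtoC 2)) (fmul (pd iu (ofR ph)) (hr E F)))) (gi F B))))))).
  - intros p Hp.
    assert (X : forall E F, (pd iu (hr E F) p + - (1) * (2 * (pd iu (ofR ph) p * hr E F p))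
       = pd iu (h E F) p - 2 * pd iu (ofR ph) p * h E F p)%C).
    { intros E F. unfold hrem. unf. pose proof (symb_smooth _ _ _ (so_gam E F)). pdx D O.
      assert (Y : pd iu (gam phi E F) p = (2 * pd iu (ofR ph) p * gam phi E F p)%C).
      { destruct E, F.
        1, 4: rewrite (pd_ext D O _ _ (fcst 0%C)) by (auto; intros; rewrite gam_eq; auto);
          rewrite pd_cst, gam_eq; ring.
        all: rewrite (pd_ext D O _ _ (fmul (fcst (RtoC (/ 2))) (ofR (fun p => exp (2 * ph p)))))
            by (auto; intros; rewrite gam_eq; auto);
          rewrite (pd_mul D) by (auto using sm_cst; apply (symb_smooth D 0), so_exp_ph);
          rewrite pd_cst, pd_exp_ph by (apply cyl_sub; auto); rewrite gam_eq; unfold fmul, fcst, ofR;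
          rewrite RtoC_mult; ring. }
      rewrite Y. feval. ring. }
    unf. feval. rewrite (pd_gi iu A B p Hp). unfold sum2. rewrite !X.
    pose proof (gi_h A hol p Hp) as H1. pose proof (gi_h A ahol p Hp) as H2. unfold sum2 in *.
    transitivity (2 * pd iu (ofR ph) p * ((gi A hol p * h hol hol p + gi A ahol p * h ahol hol p) * gi hol B p
       + (gi A hol p * h hol ahol p + gi A ahol p * h ahol ahol p) * gi ahol B p)
       - (gi A hol p * pd iu (h hol hol) p * gi hol B p + gi A hol p * pd iu (h hol ahol) p * gi ahol B p +
       (gi A ahol p * pd iu (h ahol hol) p * gi hol B p + gi A ahol p * pd iu (h ahol ahol) p * gi ahol B p)))%C.
    { ring. }
    rewrite H1, H2. destruct A; ring.
  - unf. so.
Qed.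

(** Integration by parts: [J g - r g = J (2 g + r d_r g)], since both sides have the same radial
    derivative and both decay. The integrand on the right is of order -3 by [so_gi_r]. *)
Lemma so_J_gi A B : symb D (-2) (fsub (J (gi A B)) (fmul rr (gi A B))).
Proof.
  set (Q := fadd (fmul (fcst (RtoC 2)) (gi A B)) (fmul rr (pd ir (gi A B)))).
  pose proof (so_gi_r A B) as SQ. fold Q in SQ.
  assert (JQ : symb D (-2) (J Q)) by (apply (so_J D HD (-3)); auto).
  assert (JG : symb D (-1) (J (gi A B))) by (apply (so_J D HD (-2)); auto with so).
  apply (so_ext D HD _ (J Q)); auto.
  intros p Hp.
  assert (Z : fsub (fsub (J (gi A B)) (fmul rr (gi A B))) (J Q) p = 0%C).
  { apply (ray_zero D HD); auto.
    - unf. eapply (so_le D HD (-1)); [ so_rec D HD | reflexivity ].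
    - intros q Hq. unf.
      pose proof (symb_smooth _ _ _ JQ); pose proof (symb_smooth _ _ _ JG).
      pdx D O. change (pd ir (J Q) q) with (rpd dr (J Q) q). change (pd ir (J (gi A B)) q) with (rpd dr (J (gi A B)) q).
      rewrite (proj2 (J_rpd D HD Q dr q ltac:(so) Hq)), (proj2 (J_rpd D HD (gi A B) dr q ltac:(auto with so) Hq)).
      unfold Q; feval. ring. }
  unf; feval. revert Z. unf; feval. intros Z.
  transitivity (J Q p + (J (gi A B) p + - (1) * (rr p * gi A B p) + - (1) * J Q p))%C; [ rewrite Z; ring | ring ].
Qed.
End Geometry.

(** * The generators *)

Definition fdiv (phi : R -> C -> R) (Y : ang -> pt -> C) : pt -> C :=
  fsum2 (fun A => fadd (pd A (Y A)) (fmul (fcst (RtoC 2)) (fmul (Y A) (pd A (ofR (cfac phi)))))).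

Definition flap (phi : R -> C -> R) (F : pt -> C) : pt -> C :=
  fmul (fmul (fcst (RtoC 4)) (ofR (fun p => exp (-2 * cfac phi p)))) (pd hol (pd ahol F)).

(** Generators [xi] with [f] in place of its integral formula, which enters only through its [u]-derivative. *)
Record generator (D : pt -> Prop) (phi : R -> C -> R) (Y : ang -> pt -> C) (f w : pt -> C) : Prop := {
  gn_Y : forall A, smooth (cyl D) (Y A);
  gn_f : smooth (cyl D) f;
  gn_w : smooth (cyl D) w;
  gn_Yr : forall A, rindep (Y A);
  gn_fr : rindep f;
  gn_wr : rindep w;
  gn_Yu : forall A q, pd iu (Y A) q = 0%C;
  gn_hol : forall A q, cyl D q -> pd (abar A) (Y A) q = 0%C;
  gn_fu : forall q, cyl D q -> pd iu f q =
    (f q * pd iu (ofR (cfac phi)) q + RtoC (/ 2) * (fdiv phi Y q - RtoC 2 * w q))%C }.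

Section Vectors.
Context (D : pt -> Prop) (HD : dom D).
Let O := dom_open D HD.
Context (W : pt -> C) (V : ang -> pt -> C) (h : ang -> ang -> pt -> C) (phi : R -> C -> R).
Context (G : NUgeom D W V h phi).
Local Notation ph := (cfac phi).
Local Notation hr := (hrem phi h).
Local Notation wr := (Wrem phi W).
Local Notation gi := (gi W V h).
Let smh : forall A B, smooth D (h A B) := ng_h _ _ _ _ _ G.
Let hsym : forall A B p, D p -> h A B p = h B A p := ng_sym _ _ _ _ _ G.
Let soH : forall A B, symb D 1 (hr A B) := ng_hrem _ _ _ _ _ G.
Let soV : forall A, symb D (-2) (V A) := ng_V _ _ _ _ _ G.
Let soW : symb D 0 wr := ng_Wrem _ _ _ _ _ G.
Let smV : forall A, smooth D (V A) := ltac:(intros; eapply smV; eassumption).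
Let smrr : smooth D rr := ltac:(intros; eapply sm_rr; eassumption).
Let sogi : forall A B, symb D (-2) (gi A B) := ltac:(intros; eapply so_gi; eassumption).
Let smgi : forall A B, smooth D (gi A B) := ltac:(intros; eapply sm_gi; eassumption).
Let soh : forall A B, symb D 2 (h A B) := ltac:(intros; eapply so_h; eassumption).
Let soph : symb D 0 (ofR ph) := ltac:(intros; eapply so_ph; eassumption).
Let sogam : forall A B, symb D 0 (gam phi A B) := ltac:(intros; eapply so_gam; eassumption).
Let soexp : forall c, symb D 0 (ofR (fun p => exp (c * ph p))) := ltac:(intros; eapply so_exp_ph; eassumption).
Hint Resolve soexp : so.

Lemma so_JV A : symb D (-1) (J (V A)).
Proof. apply (so_J D HD (-2)); auto. Qed.
Lemma so_Jgi A B : symb D (-1) (J (gi A B)).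
Proof. apply (so_J D HD (-2)); auto. Qed.
Hint Resolve so_JV so_Jgi : so.
Lemma sm_JV A : smooth D (J (V A)).
Proof. eapply symb_smooth, so_JV. Qed.
Lemma sm_Jgi A B : smooth D (J (gi A B)).
Proof. eapply symb_smooth, so_Jgi. Qed.
Hint Resolve sm_JV sm_Jgi : sm.
Let smgam : forall A B, smooth D (gam phi A B) := fun A B => symb_smooth _ _ _ (sogam A B).
Let smexp : forall c, smooth D (ofR (fun p => exp (c * ph p))) := fun c => symb_smooth _ _ _ (soexp c).

Lemma pd_ir_J F n p : symb D n F -> (n <= -2)%Z -> D p -> pd ir (J F) p = (- F p)%C.
Proof.
  intros H L Hp. apply (J_rpd D HD F dr p); auto. apply (symb_mono D HD n); auto.
Qed.

Lemma pd_gam m A B p : D p -> pd m (gam phi A B) p =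
  match m with ir => 0%C | _ => (2 * pd m (ofR ph) p * gam phi A B p)%C end.
Proof.
  intros Hp.
  assert (X : pd m (gam phi A B) p = (2 * pd m (ofR ph) p * gam phi A B p)%C).
  { destruct A, B.
    1, 4: rewrite (pd_ext D O _ _ (fcst 0%C)) by (auto; intros; rewrite gam_eq; auto);
      rewrite pd_cst, gam_eq; ring.
    all: rewrite (pd_ext D O _ _ (fmul (fcst (RtoC (/ 2))) (ofR (fun p => exp (2 * ph p)))))
        by (auto; intros; rewrite gam_eq; auto);
      rewrite (pd_mul D) by (auto using sm_cst);
      rewrite pd_cst, (pd_exp_ph D HD W V h phi G) by (apply cyl_sub; auto); rewrite gam_eq; unfold fmul, fcst, ofR;
      rewrite RtoC_mult; ring. }
  rewrite X. destruct m; auto. rewrite (rindep_pd_r (ofR ph)) by (intros ? ?; reflexivity). ring.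
Qed.

Definition gsh (A : ang) : pt -> C := fopp (fsum2 (fun B => fmul (h A B) (V B))).

Definition Xf (Y : ang -> pt -> C) (f : pt -> C) : vfield := fun m =>
  match m with
  | iu => f
  | ia A => fsub (Y A) (fsum2 (fun B => fmul (pd B f) (J (gi A B))))
  | ir => fadd (fadd (fopp (fmul rr (pd iu f))) (fmul (fcst (RtoC (/ 2))) (flap phi f)))
      (fsum2 (fun A => fmul (pd A f) (J (V A))))
  end.

Context (Y : ang -> pt -> C) (f w : pt -> C) (N : generator D phi Y f w).
Local Notation X := (Xf Y f).

Let soY A : symb D 0 (Y A) := rindep_symb D (Y A) HD (gn_Yr _ _ _ _ _ N A) (gn_Y _ _ _ _ _ N A).
Let sof : symb D 0 f := rindep_symb D f HD (gn_fr _ _ _ _ _ N) (gn_f _ _ _ _ _ N).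
Let sow : symb D 0 w := rindep_symb D w HD (gn_wr _ _ _ _ _ N) (gn_w _ _ _ _ _ N).
Let smY A : smooth D (Y A) := symb_smooth _ _ _ (soY A).
Let smf : smooth D f := symb_smooth _ _ _ sof.

(** The decaying part of [xi^A], of order -1. Likewise [Mr] is [xi^r] freed of its linear term, of
    order 0 with limit half the Laplacian of [f]. *)
Definition Ta (A : ang) : pt -> C := fsub (X (ia A)) (Y A).
Definition Mr : pt -> C := fadd (X ir) (fmul rr (pd iu f)).

Lemma so_T A : symb D (-1) (Ta A).
Proof.
  apply (so_ext D HD _ (fopp (fsum2 (fun B => fmul (pd B f) (J (gi A B)))))).
  - intros; unfold Ta; simpl; unf; feval; ring.
  - unf. so.
Qed.
Hint Resolve so_T : so.

Lemma so_M_rem : symb D (-1) (fsub Mr (fmul (fcst (RtoC (/ 2))) (flap phi f))).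
Proof.
  apply (so_ext D HD _ (fsum2 (fun A => fmul (pd A f) (J (V A))))).
  - intros; unfold Mr; simpl; unf; feval; ring.
  - unf. so.
Qed.

Lemma so_M : symb D 0 Mr.
Proof.
  apply (so_ext D HD _ (fadd (fmul (fcst (RtoC (/ 2))) (flap phi f)) (fsum2 (fun A => fmul (pd A f) (J (V A)))))).
  - intros; unfold Mr; simpl; unf; feval; ring.
  - unfold flap; unf. so.
Qed.
Hint Resolve so_M : so.

Lemma so_X m : symb D (match m with ir => 1 | _ => 0 end)%Z (X m).
Proof. destruct m; simpl; unfold flap; unf; so. Qed.
Lemma so_Xa A : symb D 0 (X (ia A)).
Proof. apply (so_X (ia A)). Qed.
Lemma so_Xr : symb D 1 (X ir).
Proof. apply (so_X ir). Qed.
Hint Resolve so_Xa so_Xr : so.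
Lemma sm_X m : smooth D (X m).
Proof. eapply symb_smooth, so_X. Qed.
Hint Resolve sm_X : sm.

Lemma NU_X : NUvector D V gi X.
Proof.
  assert (Rf : forall m n q, pd ir (pd m f) q = 0%C /\ pd ir (pd m (pd n f)) q = 0%C).
  { intros m n q; split; apply rindep_pd_r; repeat apply rindep_pd; apply (gn_fr _ _ _ _ _ N). }
  assert (Re : forall q, pd ir (ofR (fun p => exp (-2 * ph p))) q = 0%C).
  { intros q; apply rindep_pd_r; intros ? ?; reflexivity. }
  split.
  - apply sm_X.
  - intros q Hq. apply rindep_pd_r, (gn_fr _ _ _ _ _ N).
  - intros A q Hq. unfold Xf, graise. unf. pdx D O.
    rewrite (rindep_pd_r (Y A) q) by apply (gn_Yr _ _ _ _ _ N).
    rewrite ?(proj1 (Rf _ iu _)), ?(pd_ir_J (gi _ _) (-2)) by (auto; lia). feval. ring.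
  - intros q Hq. unfold Xf, flap. unf. pdx D O.
    rewrite ?(proj2 (Rf _ _ _)), ?(proj1 (Rf _ iu _)), ?(pd_ir_J (V _) (-2)), ?Re by (auto; lia). feval. ring.
Qed.

Definition kab (A B : ang) : pt -> C :=
  fadd (fadd (along X (h A B))
    (fsum2 (fun E => fadd (fmul (h E B) (pd A (X (ia E)))) (fmul (h A E) (pd B (X (ia E)))))))
  (fadd (fmul (gsh B) (pd A f)) (fmul (gsh A) (pd B f))).

Definition guu : pt -> C := fadd W (fsum2 (fun A => fsum2 (fun B => fmul (fmul (h A B) (V A)) (V B)))).

Definition kua (A : ang) : pt -> C :=
  fadd (fadd (along X (gsh A)) (fadd (fmul (gsh A) (pd iu f)) (fsum2 (fun E => fmul (h E A) (pd iu (X (ia E)))))))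
  (fadd (fsub (fmul guu (pd A f)) (pd A (X ir))) (fsum2 (fun E => fmul (gsh E) (pd A (X (ia E)))))).

Lemma nu_gsh A : nu_metric W V h iu (ia A) = gsh A.
Proof.
  apply functional_extensionality; intros p. simpl. unfold gsh, sum2; unf; feval; ring.
Qed.
Lemma nu_gsh' A : nu_metric W V h (ia A) iu = gsh A.
Proof.
  apply functional_extensionality; intros p. simpl. unfold gsh, sum2; unf; feval; ring.
Qed.

Lemma lie_kab A B p : lie_derivative X (nu_metric W V h) (ia A) (ia B) p = kab A B p.
Proof.
  unfold lie_derivative, sum4.
  rewrite !nu_gsh, !nu_gsh'.
  change (nu_metric W V h (ia A) (ia B)) with (h A B).
  unfold kab, sum2; unf; feval. simpl nu_metric. change (X iu) with f. ring.
Qed.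

Lemma lie_kua A p : lie_derivative X (nu_metric W V h) iu (ia A) p = kua A p.
Proof.
  unfold lie_derivative, sum4.
  assert (E : nu_metric W V h iu iu p = guu p).
  { simpl. unfold guu, sum2; unf; feval; ring. }
  unfold sum2. rewrite !nu_gsh, ?nu_gsh', E.
  unfold kua, sum2; unf; feval. simpl nu_metric. change (X iu) with f.
  generalize (guu p). intros. ring.
Qed.

Lemma so_gsh A : symb D 0 (gsh A).
Proof. unfold gsh; unf. so. Qed.
Hint Resolve so_gsh : so.

Lemma so_kab A B : symb D 2 (kab A B).
Proof. unfold kab; unf. so. Qed.
Hint Resolve so_kab : so.

(** This is the statement that [xi] changes the conformal factor by [w]. At order [r^2] the Lie
    derivative gives [2 f d_u phi + D_A Y^A - 2 d_u f] times [gam], and the [u]-equation of [f]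
    turns the bracket into [2 w]. *)
Lemma so_kab_lead :
  symb D 1 (fsub (kab hol ahol) (fmul (fmul (fcst (RtoC 2)) w) (fmul (fmul rr rr) (gam phi hol ahol)))).
Proof.
  (* The radial derivative of [r^2 gam], which [Mr] multiplies. *)
  set (G2 := fmul (fmul (fcst (RtoC 2)) rr) (gam phi hol ahol)).
  apply (so_ext D HD _
    (fadd (fsum2 (fun E => fadd (fmul (fmul (fmul rr rr) (gam phi hol ahol))
            (fadd (fmul (fmul (fcst (RtoC 2)) (pd E (ofR ph))) (Ta E)) (pd E (Ta E))))
          (fmul (hr hol ahol) (pd E (X (ia E))))))
     (fadd (fadd (fadd (fmul Mr G2) (along X (hr hol ahol)))
        (fadd (fmul (hr ahol ahol) (pd hol (X ahol))) (fmul (hr hol hol) (pd ahol (X hol)))))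
        (fadd (fmul (gsh ahol) (pd hol f)) (fmul (gsh hol) (pd ahol f)))))).
  - intros p Hp. unfold kab, Ta, Mr, G2, hrem. unf. pdx D O.
    change (X iu) with f. rewrite !pd_gam by auto.
    feval. rewrite (gn_fu _ _ _ _ _ N) by (apply cyl_sub; auto).
    unfold fdiv. unf; feval. rewrite !(gam_eq phi hol hol), !(gam_eq phi ahol ahol).
    rewrite RtoC_inv by lra. field.
  - unfold G2; unf. so.
Qed.

(** The usual variation [- g^{-1} k g^{-1}] of an inverse matrix. It reconciles [dginv], which was
    read off from the full inverse metric, with the inverse of the angular block alone. *)
Lemma dginv_k A B p : D p -> dginv V gi X A B p =
  (- sum2 (fun E => sum2 (fun F => gi A E p * kab E F p * gi F B p)))%C.
Proof.
  intros Hp. unfold dginv, kab, graise, gsh, sum2. unf. feval. change (X iu) with f.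
  rewrite !(pd_gi D HD W V h phi G) by auto. unfold sum2.
  pose proof (det_ne D W V h phi G p Hp) as Nz.
  rewrite !gi_eq. unfold gic.
  destruct A, B; feval; rewrite ?(hsym ahol hol), ?(idet_val D W V h phi G) by auto; field; exact Nz.
Qed.

Lemma so_dginv A B : symb D (-2) (dginv V gi X A B).
Proof. unfold dginv, graise; unf. so. Qed.
Hint Resolve so_dginv : so.

(** The terms of order [1/r] in [dshift] cancel. *)
Lemma so_dshift A : symb D (-2) (dshift V gi W X A).
Proof.
  (* [K] and [Q] are the errors in [J g = r g] and [d_u g = - 2 (d_u phi) g] for the inverse metric
     [g]. Up to them, the terms of order [1/r] are [- r g d_B d_u f] from [xi^r],
     [r g d_u d_B f - 2 r (d_u phi) g d_B f] from [- d_u xi^A], and [+ 2 r (d_u phi) g d_B f] from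
     [- W g d_B f]; their sum is zero. *)
  set (K := fun B => fsub (J (gi A B)) (fmul rr (gi A B))).
  set (Q := fun B => fadd (pd iu (gi A B)) (fmul (fcst (RtoC 2)) (fmul (pd iu (ofR ph)) (gi A B)))).
  assert (soK : forall B, symb D (-2) (K B)) by (intros B; exact (so_J_gi D HD W V h phi G A B)).
  assert (soQ : forall B, symb D (-3) (Q B)) by (intros B; exact (so_gi_u D HD W V h phi G A B)).
  apply (so_ext D HD _
    (fadd (fsub (along X (V A)) (fadd (fmul (V A) (pd ir (X ir))) (fsum2 (fun B => fmul (V B) (pd B (X (ia A)))))))
     (fsub (fadd (graise gi A Mr)
        (fsum2 (fun B => fadd (fmul (pd iu (pd B f)) (K B))
          (fmul (pd B f) (fadd (fmul rr (Q B)) (pd iu (K B)))))))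
       (fmul wr (graise gi A f))))).
  - intros p Hp. unfold dshift, graise, Mr, K, Q, Wrem. unf.
    assert (E : pd iu (X (ia A)) p = (- sum2 (fun B => pd iu (pd B f) p * J (gi A B) p + pd B f p * pd iu (J (gi A B)) p))%C).
    { unfold Xf. unf. pdx D O. rewrite (gn_Yu _ _ _ _ _ N). unfold sum2. ring. }
    pdx D O. rewrite E. change (X iu) with f. unfold sum2.
    rewrite (pd_comm D hol iu f), (pd_comm D ahol iu f) by auto. ring.
  - unfold graise; unf. so.
Qed.
Hint Resolve so_dshift : so.

(** Product rule applied to [V^A = - g^{AB} g_{uB}]. *)
Lemma dshift_k A p : D p -> dshift V gi W X A p =
  (- sum2 (fun B => dginv V gi X A B p * gsh B p + gi A B p * kua B p))%C.
Proof.
  intros Hp. pose proof (det_ne D W V h phi G p Hp) as Nz.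
  unfold sum2. unfold dshift, dginv, kua, guu, gsh, graise. unf. pdx D O.
  rewrite (nv_r _ _ _ _ NU_X) by auto. unf. pdx D O.
  change (X iu) with f.
  rewrite ?(pd_ext D O _ (h ahol hol) (h hol ahol)) by auto.
  rewrite !(pd_gi D HD W V h phi G) by auto. unfold sum2.
  rewrite ?(pd_ext D O _ (h ahol hol) (h hol ahol)) by auto.
  rewrite !gi_eq. unfold gic.
  destruct A; feval; rewrite ?(hsym ahol hol), ?(idet_val D W V h phi G) by auto; field; exact Nz.
Qed.

(** Term by term [kua] would grow like [r]. The bound is obtained backwards: [dshift_k] is solved
    for [kua] with the help of [h], and the cancellation already established in [so_dshift] is
    inherited. *)
Lemma so_kua A : symb D 0 (kua A).
Proof.
  apply (so_ext D HD _ (fopp (fsum2 (fun B => fmul (h A B)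
    (fadd (dshift V gi W X B) (fsum2 (fun E => fmul (dginv V gi X B E) (gsh E)))))))).
  - intros p Hp. unf. rewrite fopp_e, !fadd_e, !fmul_e, !fadd_e, !fmul_e, !dshift_k by auto. unfold sum2.
    pose proof (gi_h D W V h phi G) as GH. unfold sum2 in GH.
    pose proof (gi_sym D W V h phi G hol ahol p Hp) as S. pose proof (hsym hol ahol p Hp) as S'.
    pose proof (GH hol A p Hp) as H1. pose proof (GH ahol A p Hp) as H2.
    transitivity ((gi hol hol p * h hol A p + gi hol ahol p * h ahol A p) * kua hol p
      + (gi ahol hol p * h hol A p + gi ahol ahol p * h ahol A p) * kua ahol p)%C.
    + destruct A; rewrite <- S, ?S'; ring.
    + rewrite H1, H2. destruct A; ring.
  - unf. so.
Qed.
End Vectors.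

(** * Closure of the bracket *)

Lemma pd2_add D (HD : dom D) F G p : smooth D F -> smooth D G -> D p ->
  pd hol (pd ahol (fadd F G)) p = (pd hol (pd ahol F) p + pd hol (pd ahol G) p)%C.
Proof.
  intros HF HG Hp. pose proof (dom_open D HD) as O.
  rewrite (pd_ext D O hol _ (fadd (pd ahol F) (pd ahol G))); auto.
  - apply (pd_add D); auto using sm_pd.
  - intros; apply (pd_add D); auto.
Qed.

Lemma pd2_mul D (HD : dom D) F G p : smooth D F -> smooth D G -> D p ->
  pd hol (pd ahol (fmul F G)) p = (pd hol (pd ahol F) p * G p + pd ahol F p * pd hol G p
    + (pd hol F p * pd ahol G p + F p * pd hol (pd ahol G) p))%C.
Proof.
  intros HF HG Hp. pose proof (dom_open D HD) as O.
  rewrite (pd_ext D O hol _ (fadd (fmul (pd ahol F) G) (fmul F (pd ahol G)))); auto.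
  - pdx D O. ring.
  - intros; apply (pd_mul D); auto.
Qed.

Lemma pd2_opp D (HD : dom D) F p : smooth D F -> D p ->
  pd hol (pd ahol (fopp F)) p = (- pd hol (pd ahol F) p)%C.
Proof.
  intros HF Hp. pose proof (dom_open D HD) as O.
  rewrite (pd_ext D O hol _ (fopp (pd ahol F))); auto.
  - rewrite (pd_opp D O); auto using sm_pd.
  - intros; rewrite fopp_e; apply (pd_opp D O); auto.
Qed.

Section Closure.
Context (D : pt -> Prop) (HD : dom D).
Let O := dom_open D HD.
Context (W : pt -> C) (V : ang -> pt -> C) (h : ang -> ang -> pt -> C) (phi : R -> C -> R).
Context (G : NUgeom D W V h phi).
Local Notation ph := (cfac phi).
Local Notation gi := (gi W V h).
Local Notation Xg := (Xf W V h phi).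

Let soV : forall A, symb D (-2) (V A) := ng_V _ _ _ _ _ G.
Let smV : forall A, smooth D (V A) := ltac:(intros; eapply smV; eassumption).
Let smrr : smooth D rr := ltac:(eapply sm_rr; eassumption).
Let sogi : forall A B, symb D (-2) (gi A B) := ltac:(intros; eapply so_gi; eassumption).
Let smgi : forall A B, smooth D (gi A B) := ltac:(intros; eapply sm_gi; eassumption).
Let soJV : forall A, symb D (-1) (J (V A)) := ltac:(intros; eapply so_JV; eassumption).
Let soJgi : forall A B, symb D (-1) (J (gi A B)) := ltac:(intros; eapply so_Jgi; eassumption).
Let smJV : forall A, smooth D (J (V A)) := fun A => symb_smooth _ _ _ (soJV A).
Let smJgi : forall A B, smooth D (J (gi A B)) := fun A B => symb_smooth _ _ _ (soJgi A B).
Let soexp : forall c, symb D 0 (ofR (fun p => exp (c * ph p))) := ltac:(intros; eapply so_exp_ph; eassumption).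
Let smexp : forall c, smooth D (ofR (fun p => exp (c * ph p))) := fun c => symb_smooth _ _ _ (soexp c).
Let soph : symb D 0 (ofR ph) := ltac:(eapply so_ph; eassumption).
Let gsym : forall A B q, D q -> gi A B q = gi B A q := ltac:(intros; eapply gi_sym; eassumption).

(** The variation of [Xf Y f2] when the metric varies by its Lie derivative along [X1]: then [phi] varies
    by [w1] and [f2] by [e]. *)
Definition Vf (X1 : vfield) (w1 e f2 : pt -> C) : vfield := fun m =>
  match m with
  | iu => e
  | ia A => fopp (fsum2 (fun B => fadd (fmul (pd B e) (J (gi A B))) (fmul (pd B f2) (J (dginv V gi X1 A B)))))
  | ir => fadd (fadd (fopp (fmul rr (pd iu e)))
        (fmul (fcst (RtoC (/ 2))) (fadd (fopp (fmul (fmul (fcst (RtoC 2)) w1) (flap phi f2))) (flap phi e))))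
      (fsum2 (fun A => fadd (fmul (pd A e) (J (V A))) (fmul (pd A f2) (J (dshift V gi W X1 A)))))
  end.

Context (Y1 Y2 Yh : ang -> pt -> C) (f1 f2 w1 w2 e12 e21 fh : pt -> C).
Context (N1 : generator D phi Y1 f1 w1) (N2 : generator D phi Y2 f2 w2).
Context (sce12 : smooth (cyl D) e12).
Context (sce21 : smooth (cyl D) e21).
Context (re12 : rindep e12).
Context (re21 : rindep e21).
Context (rYh : forall A, rindep (Yh A)).
Context (scYh : forall A, smooth (cyl D) (Yh A)).
Context (EYh : forall A q, D q -> Yh A q = sum2 (fun B => Y1 B q * pd B (Y2 A) q - Y2 B q * pd B (Y1 A) q)%C).
(** The [u]-component of the modified bracket after two simplifications: [xi^r] does not act on [f],
    and the terms [d_A f1 d_B f2 J (g^{AB})] cancel by symmetry. Only data independent of [r]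
    remain. *)
Definition Uexp : pt -> C :=
  fadd (fsub (fsub (fadd (fmul f1 (pd iu f2)) (fsum2 (fun A => fmul (Y1 A) (pd A f2))))
    (fadd (fmul f2 (pd iu f1)) (fsum2 (fun A => fmul (Y2 A) (pd A f1))))) e12) e21.
Context (scfh : smooth (cyl D) fh).
Context (rfh : rindep fh).
Context (Efh : forall q, D q -> fh q = Uexp q).

Local Notation X1 := (Xg Y1 f1).
Local Notation X2 := (Xg Y2 f2).

Let so0 F (r : rindep F) (s : smooth (cyl D) F) : symb D 0 F := rindep_symb D F HD r s.
Let soY1 A : symb D 0 (Y1 A) := so0 _ (gn_Yr _ _ _ _ _ N1 A) (gn_Y _ _ _ _ _ N1 A).
Let soY2 A : symb D 0 (Y2 A) := so0 _ (gn_Yr _ _ _ _ _ N2 A) (gn_Y _ _ _ _ _ N2 A).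
Let sof1 : symb D 0 f1 := so0 _ (gn_fr _ _ _ _ _ N1) (gn_f _ _ _ _ _ N1).
Let sof2 : symb D 0 f2 := so0 _ (gn_fr _ _ _ _ _ N2) (gn_f _ _ _ _ _ N2).
Let sow1 : symb D 0 w1 := so0 _ (gn_wr _ _ _ _ _ N1) (gn_w _ _ _ _ _ N1).
Let sow2 : symb D 0 w2 := so0 _ (gn_wr _ _ _ _ _ N2) (gn_w _ _ _ _ _ N2).
Let soe12 : symb D 0 e12 := so0 _ re12 sce12.
Let soe21 : symb D 0 e21 := so0 _ re21 sce21.
Let sofh : symb D 0 fh := so0 _ rfh scfh.
Let soYh A : symb D 0 (Yh A) := so0 _ (rYh A) (scYh A).
Let smY1 A : smooth D (Y1 A) := symb_smooth _ _ _ (soY1 A).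
Let smY2 A : smooth D (Y2 A) := symb_smooth _ _ _ (soY2 A).
Let smf1 : smooth D f1 := symb_smooth _ _ _ sof1.
Let smf2 : smooth D f2 := symb_smooth _ _ _ sof2.
Let smw1 : smooth D w1 := symb_smooth _ _ _ sow1.
Let smw2 : smooth D w2 := symb_smooth _ _ _ sow2.
Let sme12 : smooth D e12 := symb_smooth _ _ _ soe12.
Let sme21 : smooth D e21 := symb_smooth _ _ _ soe21.
Let smfh : smooth D fh := symb_smooth _ _ _ sofh.
Let smYh A : smooth D (Yh A) := symb_smooth _ _ _ (soYh A).
Let NV1 : NUvector D V gi X1 := NU_X D HD W V h phi G Y1 f1 w1 N1.
Let NV2 : NUvector D V gi X2 := NU_X D HD W V h phi G Y2 f2 w2 N2.
Let smX1 m : smooth D (X1 m) := sm_X D HD W V h phi G Y1 f1 w1 N1 m.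
Let smX2 m : smooth D (X2 m) := sm_X D HD W V h phi G Y2 f2 w2 N2 m.
Let soX1a A : symb D 0 (X1 (ia A)) := so_Xa D HD W V h phi G Y1 f1 w1 N1 A.
Let soX2a A : symb D 0 (X2 (ia A)) := so_Xa D HD W V h phi G Y2 f2 w2 N2 A.
Let soX1r : symb D 1 (X1 ir) := so_Xr D HD W V h phi G Y1 f1 w1 N1.
Let soX2r : symb D 1 (X2 ir) := so_Xr D HD W V h phi G Y2 f2 w2 N2.
Local Notation T1 := (Ta W V h phi Y1 f1).
Local Notation T2 := (Ta W V h phi Y2 f2).
Let soT1 A : symb D (-1) (T1 A) := so_T D HD W V h phi G Y1 f1 w1 N1 A.
Let soT2 A : symb D (-1) (T2 A) := so_T D HD W V h phi G Y2 f2 w2 N2 A.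
Let sodg1 A B : symb D (-2) (dginv V gi X1 A B) := so_dginv D HD W V h phi G Y1 f1 w1 N1 A B.
Let sodg2 A B : symb D (-2) (dginv V gi X2 A B) := so_dginv D HD W V h phi G Y2 f2 w2 N2 A B.
Let sods1 A : symb D (-2) (dshift V gi W X1 A) := so_dshift D HD W V h phi G Y1 f1 w1 N1 A.
Let sods2 A : symb D (-2) (dshift V gi W X2 A) := so_dshift D HD W V h phi G Y2 f2 w2 N2 A.

Lemma so_J2 F : symb D (-2) F -> symb D (-1) (J F).
Proof. intros H. apply (so_J D HD (-2)); auto. Qed.
Hint Resolve so_J2 : so.
Let sJdg1 A B : smooth D (J (dginv V gi X1 A B)) := symb_smooth _ _ _ (so_J2 _ (sodg1 A B)).
Let sJdg2 A B : smooth D (J (dginv V gi X2 A B)) := symb_smooth _ _ _ (so_J2 _ (sodg2 A B)).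
Let sJds1 A : smooth D (J (dshift V gi W X1 A)) := symb_smooth _ _ _ (so_J2 _ (sods1 A)).
Let sJds2 A : smooth D (J (dshift V gi W X2 A)) := symb_smooth _ _ _ (so_J2 _ (sods2 A)).

Lemma J_gi_sym A B p : D p -> J (gi A B) p = J (gi B A) p.
Proof.
  intros Hp. symmetry. apply J_of_ray. eapply rayI_ext; [ | apply (J_rayI D HD (gi A B) p); auto ].
  intros t Ht; cbv beta. apply gsym, (up_ray D HD); auto.
Qed.

Definition defect (m : idx) : pt -> C :=
  fsub (fadd (fsub (flie X1 X2 m) (Vf X1 w1 e12 f2 m)) (Vf X2 w2 e21 f1 m)) (Xg Yh fh m).

Lemma closure_u p : D p -> defect iu p = 0%C.
Proof.
  intros Hp. unfold defect, Vf, Xf. unf. pdx D O.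
  rewrite (Efh p Hp). unfold Uexp; unf; pdx D O.
  rewrite (rindep_pd_r f1), (rindep_pd_r f2) by (apply (gn_fr _ _ _ _ _ N1) || apply (gn_fr _ _ _ _ _ N2)).
  rewrite (J_gi_sym ahol hol p Hp). ring.
Qed.

Lemma fh_flie q : D q -> fh q = fadd (fsub (flie X1 X2 iu) e12) e21 q.
Proof.
  intros Hq. set (S := fadd (fsub (flie X1 X2 iu) e12) e21).
  assert (E : (S q + - fh q)%C = 0%C).
  { rewrite <- (closure_u q Hq). change (defect iu q) with (fadd S (fopp fh) q).
    rewrite fadd_e, fopp_e. reflexivity. }
  transitivity (S q - (S q + - fh q))%C; [ ring | rewrite E; ring ].
Qed.

Lemma pd_ir_re m e q : rindep e -> pd ir (pd m e) q = 0%C.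
Proof. intros r. apply rindep_pd_r, rindep_pd, r. Qed.

Ltac pdr := repeat first
  [ rewrite (pd_ir_re _ _ _ re12) | rewrite (pd_ir_re _ _ _ re21)
  | rewrite (pd_ir_re _ _ _ (gn_fr _ _ _ _ _ N1)) | rewrite (pd_ir_re _ _ _ (gn_fr _ _ _ _ _ N2))
  | rewrite (pd_ir_re _ _ _ rfh)
  | rewrite (rindep_pd_r w1) by apply (gn_wr _ _ _ _ _ N1) | rewrite (rindep_pd_r w2) by apply (gn_wr _ _ _ _ _ N2) ].

Lemma defect_a A q : D q -> pd ir (defect (ia A)) q = 0%C.
Proof.
  intros Hq.
  pose proof (bulk_a D O V gi smgi gsym X1 X2 e12 e21 fh NV1 NV2 sme12 sme21 fh_flie A q Hq) as B.
  assert (smL : smooth D (flie X1 X2 (ia A))) by (unf; sm).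
  (* The bracket becomes opaque here, so that its radial derivative is known only through the bulk
     identity [B] and is not expanded a second time. *)
  unfold defect, fsub. generalize dependent (flie X1 X2 (ia A)). intros L B smL.
  unfold Vf. change (Xg Yh fh (ia A)) with (fsub (Yh A) (fsum2 (fun B => fmul (pd B fh) (J (gi A B))))).
  unf. pdx D O. pdr. rewrite (rindep_pd_r (Yh A)) by apply rYh.
  rewrite !(pd_ir_J D HD _ (-2)) by (auto; lia).
  revert B. unfold graise, sum2; unf; feval. change (X1 iu) with f1. change (X2 iu) with f2.
  intros B.
  match type of B with ?l = ?r => transitivity (l - r)%C; [ ring | rewrite B; ring ] end.
Qed.

Lemma defect_r q : D q -> pd ir (defect ir) q = 0%C.
Proof.
  intros Hq.
  pose proof (bulk_r D O V gi W smV gsym X1 X2 e12 e21 fh NV1 NV2 sme12 sme21 fh_flie q Hq) as B.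
  assert (smL : smooth D (flie X1 X2 ir)) by (unf; sm).
  unfold defect, fsub. generalize dependent (flie X1 X2 ir). intros L B smL.
  unfold Vf. unfold Xf at 3.
  assert (Rl : forall F, rindep F -> pd ir (pd hol (pd ahol F)) q = 0%C)
    by (intros F r; apply pd_ir_re, rindep_pd, r).
  assert (Re : pd ir (ofR (fun p => exp (-2 * ph p))) q = 0%C)
    by (apply rindep_pd_r; intros ? ?; reflexivity).
  unfold flap. unf. pdx D O. pdr.
  rewrite ?(Rl e12), ?(Rl e21), ?(Rl fh), ?(Rl f1), ?(Rl f2), ?Re
    by (auto; apply (gn_fr _ _ _ _ _ N1) || apply (gn_fr _ _ _ _ _ N2)).
  rewrite !(pd_ir_J D HD _ (-2)) by (auto; lia).
  revert B. unfold sum2; unf; feval. change (X1 iu) with f1. change (X2 iu) with f2.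
  intros B.
  match type of B with ?l = ?r => transitivity (l - r)%C; [ ring | rewrite B; ring ] end.
Qed.

(** With [xi^A = Y^A + T^A] the commutator of the [Y] parts is exactly [Yh]. Every other term
    contains a [T], a radial integral, or [xi^r] of order 1 multiplied by a radial derivative of [T]
    of order -2. *)
Lemma so_defect_a A : symb D (-1) (defect (ia A)).
Proof.
  apply (so_ext D HD _
    (fadd
     (fsub (fadd (fadd (fmul f1 (pd iu (T2 A))) (fmul (X1 ir) (pd ir (T2 A))))
       (fsum2 (fun B => fadd (fmul (Y1 B) (pd B (T2 A))) (fmul (T1 B) (pd B (X2 (ia A)))))))
      (fadd (fadd (fmul f2 (pd iu (T1 A))) (fmul (X2 ir) (pd ir (T1 A))))
       (fsum2 (fun B => fadd (fmul (Y2 B) (pd B (T1 A))) (fmul (T2 B) (pd B (X1 (ia A))))))))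
     (fadd (fsub (Vf X2 w2 e21 f1 (ia A)) (Vf X1 w1 e12 f2 (ia A))) (fsum2 (fun B => fmul (pd B fh) (J (gi A B))))))).
  - intros p Hp. unfold defect, Vf, Ta.
    change (Xg Yh fh (ia A)) with (fsub (Yh A) (fsum2 (fun B => fmul (pd B fh) (J (gi A B))))).
    unf. pdx D O. rewrite (EYh A p Hp). unfold sum2.
    rewrite (gn_Yu _ _ _ _ _ N1), (gn_Yu _ _ _ _ _ N2).
    rewrite (rindep_pd_r (Y1 A)), (rindep_pd_r (Y2 A)) by (apply (gn_Yr _ _ _ _ _ N1) || apply (gn_Yr _ _ _ _ _ N2)).
    change (X1 iu) with f1. change (X2 iu) with f2. ring.
  - unfold Vf; unf. so.
Qed.

Lemma closure_a A p : D p -> defect (ia A) p = 0%C.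
Proof. intros Hp. apply (ray_zero D HD); auto using so_defect_a. intros; apply defect_a; auto. Qed.

Local Notation R1 := (fsub (Mr W V h phi Y1 f1) (fmul (fcst (RtoC (/ 2))) (flap phi f1))).
Local Notation R2 := (fsub (Mr W V h phi Y2 f2) (fmul (fcst (RtoC (/ 2))) (flap phi f2))).
Let soR1 : symb D (-1) R1 := so_M_rem D HD W V h phi G Y1 f1 w1 N1.
Let soR2 : symb D (-1) R2 := so_M_rem D HD W V h phi G Y2 f2 w2 N2.

(** Error in replacing [r J (g^{AB})] by its limit, the inverse of [gam]. Such products arise when
    the decaying part of [xi^A] differentiates the linear term of [xi^r]. *)
Definition Sg (A B : ang) : pt -> C := fsub (fmul rr (J (gi A B))) (gaminv phi A B).

Lemma so_Sg A B : symb D (-1) (Sg A B).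
Proof.
  set (K := fsub (J (gi A B)) (fmul rr (gi A B))).
  set (L := fsub (fmul (fmul rr rr) (gi A B)) (gaminv phi A B)).
  assert (soK : symb D (-2) K) by exact (so_J_gi D HD W V h phi G A B).
  assert (soL : symb D (-1) L) by exact (so_gi_lead D HD W V h phi G A B).
  apply (so_ext D HD _ (fadd (fmul rr K) L)).
  - intros p _. unfold Sg, K, L; unf; feval; ring.
  - so.
Qed.
Hint Resolve so_Sg : so.

(** What is left of one half of the bracket, [X] acting on the [r]-component of [X'], when the terms
    of order [r] and 1 are removed: each summand contains a factor [R], [R'], [T] or [Sg], of order
    -1. *)
Definition rem_r (X X' : vfield) (T : ang -> pt -> C) (f f' : pt -> C) (R R' : pt -> C) : pt -> C :=
  fadd (fsub (along X R') (fmul R (pd iu f')))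
   (fsum2 (fun A => fadd (fmul (fmul (fcst (RtoC (/ 2))) (T A)) (pd A (flap phi f')))
     (fmul (fsum2 (fun B => fmul (pd B f) (Sg A B))) (pd A (pd iu f'))))).

Lemma sc_flap F : smooth (cyl D) F -> smooth D (flap phi F).
Proof.
  intros H. assert (smooth D F) by (apply (smooth_sub (cyl D)); auto using cyl_sub).
  unfold flap. sm.
Qed.

Lemma so_flap F : symb D 0 F -> symb D 0 (flap phi F).
Proof. intros H. unfold flap. so. Qed.

Lemma pd3 F m p : smooth D F -> D p ->
  pd hol (pd ahol (pd m F)) p = pd m (pd hol (pd ahol F)) p.
Proof.
  intros H Hp.
  rewrite (pd_ext D O hol (pd ahol (pd m F)) (pd m (pd ahol F))) by (auto; intros; apply (pd_comm D); auto).
  apply (pd_comm D); auto using sm_pd.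
Qed.

Lemma pd_flap m F p : smooth D F -> D p -> m <> ir -> pd m (flap phi F) p =
  (4 * RtoC (exp (-2 * ph p)) * (pd m (pd hol (pd ahol F)) p - 2 * pd m (ofR ph) p * pd hol (pd ahol F) p))%C.
Proof.
  intros H Hp Nm. unfold flap. pdx D O. rewrite (pd_exp_ph D HD W V h phi G) by (apply cyl_sub; auto).
  unfold ofR. rewrite RtoC_mult. replace (RtoC (-2)) with (- RtoC 2)%C by (rewrite <- RtoC_opp; auto). ring.
Qed.

Lemma pd2_hol Y f w (N : generator D phi Y f w) p : D p ->
  pd ahol (Y hol) p = 0%C /\ pd hol (Y ahol) p = 0%C /\
  pd hol (pd ahol (Y hol)) p = 0%C /\ pd hol (pd ahol (Y ahol)) p = 0%C.
Proof.
  intros Hp. assert (S : forall A, smooth D (Y A)).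
  { intros A; apply (smooth_sub (cyl D)); auto using cyl_sub. apply (gn_Y _ _ _ _ _ N). }
  assert (A1 : forall q, D q -> pd ahol (Y hol) q = 0%C)
    by (intros q Hq; apply (gn_hol _ _ _ _ _ N hol q (cyl_sub D q Hq))).
  assert (A2 : forall q, D q -> pd hol (Y ahol) q = 0%C)
    by (intros q Hq; apply (gn_hol _ _ _ _ _ N ahol q (cyl_sub D q Hq))).
  repeat split; auto.
  - rewrite (pd_ext D O hol _ (fcst 0%C)); auto. apply pd_cst.
  - rewrite (pd_comm D hol ahol) by auto. rewrite (pd_ext D O ahol _ (fcst 0%C)); auto. apply pd_cst.
Qed.

Lemma flap_fh p : D p -> flap phi fh p = flap phi Uexp p.
Proof.
  intros Hp. unfold flap. rewrite !fmul_e. f_equal. apply (pd_ext D O); auto.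
  intros q Hq. apply (pd_ext D O); auto.
Qed.

Lemma gn_w_eq Y f w (N : generator D phi Y f w) p : D p ->
  w p = (f p * pd iu (ofR ph) p - pd iu f p + RtoC (/ 2) * fdiv phi Y p)%C.
Proof.
  intros Hp. rewrite (gn_fu _ _ _ _ _ N p (cyl_sub D p Hp)).
  rewrite RtoC_inv by lra. field.
Qed.

(** The exact cancellation at orders [r] and 1. At order 1 the Laplacian of [fh] has to match the
    commutator of the Laplacian terms, the contribution of the inverse of [gam], and the variation
    [- 2 w] of the factor [exp (-2 phi)]; the mixed derivatives of [Y] vanish by holomorphy. *)
Lemma defect_r_rem p : D p ->
  fsub (fadd (fsub (rem_r X1 X2 T1 f1 f2 R1 R2) (rem_r X2 X1 T2 f2 f1 R2 R1))
    (fsub (fsum2 (fun A => fadd (fmul (pd A e21) (J (V A))) (fmul (pd A f1) (J (dshift V gi W X2 A)))))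
          (fsum2 (fun A => fadd (fmul (pd A e12) (J (V A))) (fmul (pd A f2) (J (dshift V gi W X1 A)))))))
    (fsum2 (fun A => fmul (pd A fh) (J (V A)))) p = defect ir p.
Proof.
  intros Hp.
  assert (Euh : pd iu fh p = pd iu Uexp p) by (apply (pd_ext D O); auto).
  pose proof (pd2_hol _ _ _ N1 p Hp) as (H1 & H2 & H3 & H4).
  pose proof (pd2_hol _ _ _ N2 p Hp) as (K1 & K2 & K3 & K4).
  assert (sL1 : smooth D (flap phi f1)) by (apply sc_flap, (gn_f _ _ _ _ _ N1)).
  assert (sL2 : smooth D (flap phi f2)) by (apply sc_flap, (gn_f _ _ _ _ _ N2)).
  assert (rL1 : pd ir (flap phi f1) p = 0%C).
  { apply rindep_pd_r. unfold flap. apply rindep_mul; [ intros ? ?; reflexivity | ].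
    do 2 apply rindep_pd. apply (gn_fr _ _ _ _ _ N1). }
  assert (rL2 : pd ir (flap phi f2) p = 0%C).
  { apply rindep_pd_r. unfold flap. apply rindep_mul; [ intros ? ?; reflexivity | ].
    do 2 apply rindep_pd. apply (gn_fr _ _ _ _ _ N2). }
  unfold defect, Vf.
  change (Xg Yh fh ir) with (fadd (fadd (fopp (fmul rr (pd iu fh))) (fmul (fcst (RtoC (/ 2))) (flap phi fh)))
      (fsum2 (fun A => fmul (pd A fh) (J (V A))))).
  unfold rem_r, Sg, Mr, Ta. unf. pdx D O.
  rewrite rL1, rL2, (flap_fh p Hp), Euh.
  rewrite !(pd_flap _ f1), !(pd_flap _ f2) by (auto; discriminate).
  change (X1 iu) with f1. change (X2 iu) with f2. pdr.
  assert (TX : forall Y f A, Xg Y f (ia A) p = (Y A p - sum2 (fun B => pd B f p * J (gi A B) p))%C).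
  { intros Y f A. unfold Xf. unf. pdx D O. unfold sum2. ring. }
  rewrite !TX.
  assert (XR1 : X1 ir p = (- rr p * pd iu f1 p + RtoC (/ 2) * flap phi f1 p + sum2 (fun A => pd A f1 p * J (V A) p))%C).
  { unfold Xf. unf. pdx D O. unfold sum2. ring. }
  assert (XR2 : X2 ir p = (- rr p * pd iu f2 p + RtoC (/ 2) * flap phi f2 p + sum2 (fun A => pd A f2 p * J (V A) p))%C).
  { unfold Xf. unf. pdx D O. unfold sum2. ring. }
  rewrite XR1, XR2.
  (* Expressing [w] through [f], [phi] and [Y] leaves derivatives that are algebraically
     independent, so that [field] can finish once mixed derivatives are ordered. *)
  rewrite (gn_w_eq _ _ _ N1 p Hp), (gn_w_eq _ _ _ N2 p Hp).
  unfold flap, Uexp, fdiv, sum2. unf. pdx D O.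
  rewrite ?(pd2_add D HD), ?(pd2_opp D HD) by sm.
  repeat first [ rewrite (pd2_add D HD) by sm | rewrite (pd2_opp D HD) by sm | rewrite (pd2_mul D HD) by sm ].
  rewrite !pd3 by auto. rewrite H3, H4, K3, K4, H1, H2, K1, K2.
  rewrite ?(pd_comm D hol iu f1), ?(pd_comm D hol iu f2), ?(pd_comm D ahol iu f1), ?(pd_comm D ahol iu f2),
    ?(pd_comm D ahol hol f1), ?(pd_comm D ahol hol f2) by auto.
  rewrite (J_gi_sym ahol hol p Hp).
  unfold gaminv. rewrite ?fmul_e, ?fcst_e.
  change (ofR (fun p0 => exp (-2 * ph p0)) p) with (RtoC (exp (-2 * ph p))).
  rewrite ?(gn_Yu _ _ _ _ _ N1), ?(gn_Yu _ _ _ _ _ N2), RtoC_inv by lra. field.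
Qed.

Lemma closure_r p : D p -> defect ir p = 0%C.
Proof.
  intros Hp. apply (ray_zero D HD); auto.
  - eapply (so_ext D HD); [ intros q Hq; apply (defect_r_rem q Hq) | ].
    pose proof (so_flap _ sof1). pose proof (so_flap _ sof2).
    pose proof soR1 as S1. pose proof soR2 as S2. revert S1 S2.
    unfold rem_r. generalize R1, R2. intros Ra Rb S1 S2. unf. so.
  - intros; apply defect_r; auto.
Qed.

Lemma closure m p : D p ->
  (flie X1 X2 m p - Vf X1 w1 e12 f2 m p + Vf X2 w2 e21 f1 m p)%C = Xg Yh fh m p.
Proof.
  intros Hp.
  assert (E : defect m p = 0%C).
  { destruct m as [| |A]; [ apply closure_u | apply closure_r | apply closure_a ]; auto. }
  unfold defect, fsub in E. rewrite fadd_e, fopp_e, fadd_e, fadd_e, fopp_e in E.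
  match type of E with (?l + - ?r)%C = _ => transitivity ((l + - r) + r)%C; [ ring | rewrite E; ring ] end.
Qed.
End Closure.

(** * The function [f] *)

(** Divergence, [psi] and [f] for an arbitrary real [P] in the role of the conformal factor. [P] may
    depend on [r]; the treatment of perturbed metrics relies on that freedom. *)
Definition fdivP (P : pt -> R) (Y : ang -> pt -> C) : pt -> C :=
  fsum2 (fun A => fadd (pd A (Y A)) (fmul (fcst (RtoC 2)) (fmul (Y A) (pd A (ofR P))))).
Definition fpsi (P : pt -> R) (Y : ang -> pt -> C) (w : pt -> C) : pt -> C :=
  fsub (fdivP P Y) (fmul (fcst (RtoC 2)) w).
Definition fF (P : pt -> R) (Y : ang -> pt -> C) (T w : pt -> C) : pt -> C :=
  fadd T (fmul (fcst (RtoC (/ 2))) (intu (fmul (ofR (fun p => exp (- P p))) (fpsi P Y w)))).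
Definition ff (P : pt -> R) (Y : ang -> pt -> C) (T w : pt -> C) : pt -> C :=
  fmul (ofR (fun p => exp (P p))) (fF P Y T w).

Lemma xi_f_ff s g : xi_f s g =
  ff (cfac (conformal_factor g)) (fun A => lift_z (tY s A)) (lift_z (tT s)) (lift_uz (tw s)).
Proof.
  apply functional_extensionality; intros p.
  unfold xi_f, ff, fF, intu. feval. unfold ofR, cfac, lift_z. f_equal. f_equal. f_equal.
  f_equal. apply functional_extensionality; intros u. unfold psi, fpsi, fdivP, divergence, sum2.
  unf. feval. unfold lift_uz. simpl pu; simpl pz. f_equal.
  change (lift_R (conformal_factor g)) with (ofR (cfac (conformal_factor g))).
  change (set_coord du p u) with (u, pr p, pz p).
  change (fun p0 : pt => tY s hol (pz p0)) with (lift_z (tY s hol)).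
  change (fun p0 : pt => tY s ahol (pz p0)) with (lift_z (tY s ahol)).
  unfold ofR, cfac. cbn [pu pz fst snd]. ring.
Qed.

Section FF.
Context (E : pt -> Prop) (OE : opn E) (UE : ustar E).
Context (P : pt -> R) (Y : ang -> pt -> C) (T w : pt -> C).
Context (smP : smooth E (ofR P)).
Context (smY : forall A, smooth E (Y A)).
Context (smT : smooth E T).
Context (smw : smooth E w).

Lemma sm_mexp : smooth E (ofR (fun p => exp (- P p))).
Proof.
  apply (sm_exp E OE (fun p => - P p)). apply (sm_ext E OE (fopp (ofR P))).
  - intros p _. rewrite fopp_e. unfold ofR. rewrite RtoC_opp; auto.
  - sm.
Qed.
Hint Resolve sm_mexp : sm.

Lemma pd_mexp m p : E p -> pd m (ofR (fun p => exp (- P p))) p = (- (RtoC (exp (- P p)) * pd m (ofR P) p))%C.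
Proof.
  intros Hp. assert (X : forall q, E q -> fopp (ofR P) q = ofR (fun p => - P p) q).
  { intros q _. rewrite fopp_e. unfold ofR. rewrite RtoC_opp; auto. }
  rewrite (pd_exp E m (fun p => - P p)); auto.
  - rewrite <- (pd_ext E OE m _ _ p X Hp), (pd_opp E OE) by auto. ring.
  - apply (sm_ext E OE (fopp (ofR P))); auto. sm.
Qed.

Lemma mexp_exp p : (RtoC (exp (- P p)) * RtoC (exp (P p)))%C = 1%C.
Proof. rewrite <- RtoC_mult, <- exp_plus. replace (- P p + P p) with 0 by ring. rewrite exp_0; auto. Qed.

Lemma sm_psi : smooth E (fpsi P Y w).
Proof. unfold fpsi, fdivP; unf; sm. Qed.
Hint Resolve sm_psi : sm.

Lemma sm_intu F : smooth E F -> smooth E (intu F).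
Proof. apply intu_smooth; auto. Qed.
Hint Resolve sm_intu : sm.

Lemma sm_fF : smooth E (fF P Y T w).
Proof. unfold fF; sm. Qed.
Hint Resolve sm_fF : sm.

Lemma sm_ff : smooth E (ff P Y T w).
Proof. unfold ff; sm. Qed.

Lemma pd_u_intu F p : smooth E F -> E p -> pd iu (intu F) p = F p.
Proof. intros H Hp. apply (intu_rpd E F du p OE UE H Hp). Qed.

Lemma fF_u p : E p -> pd iu T p = 0%C ->
  pd iu (fF P Y T w) p = (RtoC (/ 2) * (RtoC (exp (- P p)) * fpsi P Y w p))%C.
Proof.
  intros Hp HT. unfold fF. pdx E OE. rewrite pd_u_intu by (auto; sm). rewrite HT.
  rewrite fmul_e. unfold ofR. ring.
Qed.

Lemma ff_u p : E p -> pd iu T p = 0%C -> pd iu (ff P Y T w) p =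
  (ff P Y T w p * pd iu (ofR P) p + RtoC (/ 2) * fpsi P Y w p)%C.
Proof.
  intros Hp HT. unfold ff. pdx E OE. rewrite fF_u by auto.
  rewrite (pd_exp E iu P) by auto. unfold ofR.
  pose proof (mexp_exp p) as X.
  transitivity (RtoC (exp (P p)) * pd iu (fun p => RtoC (P p)) p * fF P Y T w p +
     RtoC (/ 2) * (RtoC (exp (- P p)) * RtoC (exp (P p))) * fpsi P Y w p)%C; [ ring | rewrite X; ring ].
Qed.

Lemma rindep_ff : rindep (ofR P) -> (forall A, rindep (Y A)) -> rindep T -> rindep w -> rindep (ff P Y T w).
Proof.
  intros rP rY rT rw. unfold ff, fF, fpsi, fdivP. unf.
  assert (r1 := rindep_comp exp P rP). assert (r2 := rindep_comp (fun x => exp (- x)) P rP).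
  auto 20 with sm.
Qed.
End FF.

Lemma intu_at0 F q : pu q = 0 -> intu F q = 0%C.
Proof.
  intros H. unfold intu. rewrite H. apply (RInt_point (V:=C_R_CompleteNormedModule)).
Qed.

Lemma pd_intu_at0 F A q : pu q = 0 -> pd (ia A) (intu F) q = 0%C.
Proof.
  intros H. assert (X : forall i, i <> du -> rpd i (intu F) q = 0%C).
  { intros i Ni. apply isd_rpd. apply (isd_ext (fun _ => 0%C)); [ | apply isd_const ].
    intros t. symmetry. apply intu_at0.
    change (pu (set_coord i q t)) with (coord du (set_coord i q t)). rewrite coord_swap; auto. }
  destruct A; simpl; rewrite !X by discriminate; ring.
Qed.

(** Uniqueness for the [u]-evolution: a function that is constant along the segment from [u = 0] and
    zero at its start. *)
Lemma ustar_zero E F p : ustar E -> base E F -> (forall q, E q -> pd iu F q = 0%C) ->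
  (forall q, E q -> pu q = 0 -> F q = 0%C) -> E p -> F p = 0%C.
Proof.
  intros UE HB H0 Hz Hp.
  assert (I0 : Rmin 0 (pu p) <= 0 <= Rmax 0 (pu p)) by (split; [ apply Rmin_l | apply Rmax_l ]).
  assert (Z : F (set_coord du p 0) = 0%C) by (apply Hz; auto).
  assert (X : forall s, Rmin 0 (pu p) <= s <= Rmax 0 (pu p) -> isd (fun s => F (set_coord du p s)) s 0%C).
  { intros s Hs. eapply isd_eq; [ apply (line_isd E); auto | ]. apply (H0 (set_coord du p s)); auto. }
  assert (Ep : F (set_coord du p (pu p)) = F p) by (f_equal; apply (set_coord_id du)).
  rewrite <- Ep, <- Z. destruct (Req_dec (pu p) 0) as [->|N]; auto.
  assert (Y : forall g : R -> R, (forall s, Rmin 0 (pu p) <= s <= Rmax 0 (pu p) -> is_derive g s 0) -> g (pu p) = g 0).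
  { intros g Hg. destruct (Rlt_dec 0 (pu p)) as [L|L].
    - symmetry. apply (eq_is_derive g 0 (pu p)); auto. intros t Ht; apply Hg.
      rewrite Rmin_left, Rmax_right; lra.
    - apply (eq_is_derive g (pu p) 0); [ | lra ]. intros t Ht; apply Hg.
      rewrite Rmin_right, Rmax_left; lra. }
  apply C_eq.
  - apply (Y (fun s => Re (F (set_coord du p s)))). intros s Hs; apply X; auto.
  - apply (Y (fun s => Im (F (set_coord du p s)))). intros s Hs; apply X; auto.
Qed.

(** The variation of [ff P Y2 T2 w2] when [P] varies by [w1]. *)
Definition fvar (P : pt -> R) (Y2 : ang -> pt -> C) (T2 w2 w1 : pt -> C) : pt -> C :=
  fadd (fmul w1 (ff P Y2 T2 w2))
    (fmul (fcst (RtoC (/ 2))) (fmul (ofR (fun p => exp (P p)))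
      (intu (fmul (ofR (fun p => exp (- P p)))
        (fsub (fsum2 (fun A => fmul (fcst (RtoC 2)) (fmul (Y2 A) (pd A w1)))) (fmul w1 (fpsi P Y2 w2))))))).

Section Algebra.
Context (E : pt -> Prop) (OE : opn E) (UE : ustar E).
Context (P : pt -> R) (smP : smooth E (ofR P)).
Context (Y1 Y2 Yh : ang -> pt -> C) (T1 T2 Th w1 w2 : pt -> C).
Context (smY1 : forall A, smooth E (Y1 A)).
Context (smY2 : forall A, smooth E (Y2 A)).
Context (smYh : forall A, smooth E (Yh A)).
Context (smT1 : smooth E T1).
Context (smT2 : smooth E T2).
Context (smTh : smooth E Th).
Context (smw1 : smooth E w1).
Context (smw2 : smooth E w2).
Context (Y1u : forall A q, E q -> pd iu (Y1 A) q = 0%C).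
Context (Y2u : forall A q, E q -> pd iu (Y2 A) q = 0%C).
Context (T1u : forall q, E q -> pd iu T1 q = 0%C).
Context (T2u : forall q, E q -> pd iu T2 q = 0%C).
Context (Thu : forall q, E q -> pd iu Th q = 0%C).
Context (EYh : forall A q, E q -> Yh A q =
  fsub (fsum2 (fun B => fmul (Y1 B) (pd B (Y2 A)))) (fsum2 (fun B => fmul (Y2 B) (pd B (Y1 A)))) q).
Context (ETh : forall q, E q -> Th q = (sum2 (fun A => Y1 A q * pd A T2 q - Y2 A q * pd A T1 q)
  + RtoC (/ 2) * (T1 q * sum2 (fun A => pd A (Y2 A) q) - T2 q * sum2 (fun A => pd A (Y1 A) q)))%C).

Let em := ofR (fun p => exp (- P p)).
Let F1 := fF P Y1 T1 w1.
Let F2 := fF P Y2 T2 w2.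
Let Fh := fF P Yh Th (fcst 0%C).
Let p1 := fpsi P Y1 w1.
Let p2 := fpsi P Y2 w2.
Let C12 := fmul em (fsub (fsum2 (fun A => fmul (fcst (RtoC 2)) (fmul (Y2 A) (pd A w1)))) (fmul w1 p2)).
Let C21 := fmul em (fsub (fsum2 (fun A => fmul (fcst (RtoC 2)) (fmul (Y1 A) (pd A w2)))) (fmul w2 p1)).
Let hf := fcst (RtoC (/ 2)).
Let smem : smooth E em := sm_mexp E OE P smP.
Let smF1 : smooth E F1 := sm_fF E OE UE P Y1 T1 w1 smP smY1 smT1 smw1.
Let smF2 : smooth E F2 := sm_fF E OE UE P Y2 T2 w2 smP smY2 smT2 smw2.
Let smFh : smooth E Fh := sm_fF E OE UE P Yh Th (fcst 0%C) smP smYh smTh (sm_cst E OE _).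
Let smp1 : smooth E p1 := sm_psi E OE P Y1 w1 smP smY1 smw1.
Let smp2 : smooth E p2 := sm_psi E OE P Y2 w2 smP smY2 smw2.
Let smC12 : smooth E C12. Proof. unfold C12; unf; sm. Qed.
Let smC21 : smooth E C21. Proof. unfold C21; unf; sm. Qed.
Let smi12 : smooth E (intu C12) := intu_smooth E C12 OE UE smC12.
Let smi21 : smooth E (intu C21) := intu_smooth E C21 OE UE smC21.

(** [exp (- P)] times the difference of the two [u]-components. In terms of [F = exp (- P) f] the
    [u]-derivative is explicit, half of [exp (- P) psi], and the terms [f1 f2 d_u P] cancel in
    [f1 d_u f2 - f2 d_u f1]. *)
Definition Pdef : pt -> C :=
  fsub Fh (fadd (fsub
    (fadd (fmul hf (fsub (fmul F1 p2) (fmul F2 p1)))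
      (fsum2 (fun A => fsub (fmul (Y1 A) (fadd (pd A F2) (fmul (pd A (ofR P)) F2)))
                            (fmul (Y2 A) (fadd (pd A F1) (fmul (pd A (ofR P)) F1))))))
    (fadd (fmul w1 F2) (fmul hf (intu C12))))
    (fadd (fmul w2 F1) (fmul hf (intu C21)))).

Lemma sm_Pdef : smooth E Pdef.
Proof. unfold Pdef, hf. unf. sm. Qed.

(** The vanishing of the bracket's conformal rescaling comes out here: any other choice would leave
    its multiple by [- exp (- P)] in this derivative. The integrals [C12] and [C21] from the
    variations absorb the terms in [w1], [w2] and their derivatives. *)
Lemma Pdef_u q : E q -> pd iu Pdef q = 0%C.
Proof.
  intros Hq.
  assert (A1 : forall q, E q -> pd iu F1 q = fmul hf (fmul em p1) q)
    by (intros x Hx; unfold F1, hf, em, p1; rewrite (fF_u E OE UE) by auto; reflexivity).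
  assert (A2 : forall q, E q -> pd iu F2 q = fmul hf (fmul em p2) q)
    by (intros x Hx; unfold F2, hf, em, p2; rewrite (fF_u E OE UE) by auto; reflexivity).
  assert (Ah : pd iu Fh q = fmul hf (fmul em (fpsi P Yh (fcst 0%C))) q).
  { unfold Fh; rewrite (fF_u E OE UE); auto using sm_cst. }
  assert (B1 : forall A : ang, pd iu (pd A F1) q = pd A (fmul hf (fmul em p1)) q)
    by (intros A; rewrite (pd_comm E) by auto; apply (pd_ext E OE); auto).
  assert (B2 : forall A : ang, pd iu (pd A F2) q = pd A (fmul hf (fmul em p2)) q)
    by (intros A; rewrite (pd_comm E) by auto; apply (pd_ext E OE); auto).
  assert (Em : forall m, pd m em q = (- (em q * pd m (ofR P) q))%C)
    by (intros m; unfold em; rewrite (pd_mexp E OE P smP) by auto; reflexivity).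
  assert (Dh : forall A : ang, pd A (Yh A) q = pd A (fsub (fsum2 (fun B => fmul (Y1 B) (pd B (Y2 A)))) (fsum2 (fun B => fmul (Y2 B) (pd B (Y1 A))))) q)
    by (intros A; apply (pd_ext E OE); auto).
  assert (Z1 : forall A B : ang, pd iu (pd A (Y1 B)) q = 0%C).
  { intros A B; rewrite (pd_comm E) by auto. rewrite (pd_ext E OE A _ (fcst 0%C)); auto using pd_cst. }
  assert (Z2 : forall A B : ang, pd iu (pd A (Y2 B)) q = 0%C).
  { intros A B; rewrite (pd_comm E) by auto. rewrite (pd_ext E OE A _ (fcst 0%C)); auto using pd_cst. }
  unfold Pdef. unf. unfold hf in *. pdx E OE.
  rewrite !(pd_u_intu E OE UE) by auto.
  rewrite Ah, !A1, !A2, !B1, !B2 by auto.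
  unfold C12, C21. unf. pdx E OE. rewrite !Em.
  unfold p1, p2, fpsi, fdivP. unf. pdx E OE.
  rewrite !Dh. unf. pdx E OE. rewrite !EYh by auto. unf. pdx E OE.
  rewrite !Z1, !Z2, !Y1u, !Y2u by auto.
  rewrite ?(pd_comm E hol iu), ?(pd_comm E ahol iu), ?(pd_comm E ahol hol (ofR P)),
    ?(pd_comm E ahol hol (Y1 _)), ?(pd_comm E ahol hol (Y2 _)) by auto.
  rewrite RtoC_inv by lra. field.
Qed.

(** At [u = 0] all integrals and their angular derivatives vanish, so [F] reduces to [T]. The
    derivatives of [P] and the terms in [w1], [w2] cancel, and what remains is the formula for the
    supertranslation part of the bracket. *)
Lemma Pdef_0 q : E q -> pu q = 0 -> Pdef q = 0%C.
Proof.
  intros Hq Z.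
  assert (sG1 : smooth E (intu (fmul em p1))) by (apply intu_smooth; auto; sm).
  assert (sG2 : smooth E (intu (fmul em p2))) by (apply intu_smooth; auto; sm).
  unfold Pdef. unf. unfold hf in *.
  assert (K1 : forall A : ang, pd A F1 q = pd A T1 q).
  { intros A. unfold F1, fF. change (ofR (fun p => exp (- P p))) with em. change (fpsi P Y1 w1) with p1.
    pdx E OE. rewrite (pd_intu_at0 _ _ _ Z), (intu_at0 _ _ Z). ring. }
  assert (K2 : forall A : ang, pd A F2 q = pd A T2 q).
  { intros A. unfold F2, fF. change (ofR (fun p => exp (- P p))) with em. change (fpsi P Y2 w2) with p2.
    pdx E OE. rewrite (pd_intu_at0 _ _ _ Z), (intu_at0 _ _ Z). ring. }
  assert (L1 : F1 q = T1 q) by (unfold F1, fF; rewrite fadd_e, fmul_e, (intu_at0 _ _ Z); ring).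
  assert (L2 : F2 q = T2 q) by (unfold F2, fF; rewrite fadd_e, fmul_e, (intu_at0 _ _ Z); ring).
  assert (Lh : Fh q = Th q) by (unfold Fh, fF; rewrite fadd_e, fmul_e, (intu_at0 _ _ Z); ring).
  pdx E OE. rewrite !K1, !K2, L1, L2, Lh, !(intu_at0 _ _ Z), ETh by auto.
  unfold p1, p2, fpsi, fdivP, sum2. unf. pdx E OE.
  rewrite RtoC_inv by lra. field.
Qed.

Lemma ff_bracket q : E q -> ff P Yh Th (fcst 0%C) q =
  Uexp Y1 Y2 (ff P Y1 T1 w1) (ff P Y2 T2 w2) (fvar P Y2 T2 w2 w1) (fvar P Y1 T1 w1 w2) q.
Proof.
  intros Hq.
  assert (Z : Pdef q = 0%C).
  { apply (ustar_zero E); auto using Pdef_u, Pdef_0. apply smooth_base, sm_Pdef. }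
  assert (Lh : Fh q = (Fh q - Pdef q)%C) by (rewrite Z; ring).
  unfold ff at 1. rewrite fmul_e. fold Fh. rewrite Lh.
  unfold Pdef, Uexp, fvar. unf.
  repeat first [ rewrite fadd_e | rewrite fmul_e | rewrite fopp_e | rewrite fcst_e ].
  rewrite (ff_u E OE UE P Y1 T1 w1), (ff_u E OE UE P Y2 T2 w2) by auto. unfold ff. fold F1 F2 em p1 p2.
  assert (smex : smooth E (ofR (fun p => exp (P p)))) by (apply sm_exp; auto).
  unfold hf. pdx E OE. rewrite !(pd_exp E _ P) by auto.
  change (ofR (fun p => exp (P p)) q) with (RtoC (exp (P q))).
  fold C12 C21. unfold C12, C21. unf. ring.
Qed.
End Algebra.

(** * Variation of the integrals to null infinity *)

Lemma J_ext D (HD : dom D) F G p : symb D (-2) F -> (forall q, D q -> F q = G q) -> D p -> J G p = J F p.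
Proof.
  intros H E Hp. apply J_of_ray. eapply rayI_ext; [ | apply (J_rayI D HD F p H Hp) ].
  intros t Ht; cbv beta. apply E, (up_ray D HD); auto.
Qed.

Lemma ray_dom D (HD : dom D) F p : symb D (-2) F -> D p ->
  exists K, 0 <= K /\ forall t, pr p <= t -> Cmod (F (set_coord dr p t)) <= K * wt t.
Proof.
  intros H Hp.
  destruct (ray_bound D F p HD (fun q Hq => proj1 (symb_base D _ _ H q Hq)) (symb_SB D _ _ H) Hp)
    as (d & K & d0 & K0 & HK).
  exists K; split; auto. intros t Ht. apply (HK (set_coord dr p t)).
  - intros j Hj. rewrite coord_swap, Rminus_diag, Rabs_R0; auto.
  - change (pr p - d < t); lra.
Qed.

Definition fwt : pt -> C := finv (fadd (fcst 1%C) (fmul rr rr)).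

Lemma fwt_eq q : fwt q = RtoC (wt (pr q)) /\ fadd (fcst 1%C) (fmul rr rr) q <> 0%C.
Proof.
  assert (E : fadd (fcst 1%C) (fmul rr rr) q = RtoC (1 + pr q ^ 2)).
  { feval. unfold rr. rewrite RtoC_plus. simpl. rewrite Rmult_1_r, RtoC_mult. reflexivity. }
  pose proof (pow2_ge_0 (pr q)).
  split.
  - unfold fwt, finv. rewrite E. unfold wt. rewrite RtoC_inv; auto. lra.
  - rewrite E. intros K. apply RtoC_inj in K. lra.
Qed.

Lemma so_fwt D (HD : dom D) : symb D (-2) fwt.
Proof.
  apply (so_inv D HD 2).
  - so.
  - intros p _; apply fwt_eq.
  - intros p _. exists 1; split; [ lra | ]. generalize (nsc_r p 1); apply nsc_imp. intros q [L _].
    feval. unfold rr. rewrite <- RtoC_mult, <- RtoC_plus, Cmod_R, Rabs_pos_eq by nra.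
    simpl. nra.
Qed.

(** Multiplication by the weight [fwt], itself a symbol of order -2, reduces the claim to the
    majorant already known for that order. *)
Lemma ray_bounded D (HD : dom D) F p : symb D 0 F -> D p ->
  exists K, 0 <= K /\ forall t, pr p <= t -> Cmod (F (set_coord dr p t)) <= K.
Proof.
  intros H Hp.
  destruct (ray_dom D HD (fmul F fwt) p) as (K & K0 & HK); auto.
  { pose proof (so_fwt D HD). so. }
  exists K; split; auto. intros t Ht. specialize (HK t Ht).
  rewrite fmul_e, (proj1 (fwt_eq _)), Cmod_mult, Cmod_R in HK.
  change (pr (set_coord dr p t)) with t in HK. pose proof (wt_pos t).
  rewrite Rabs_pos_eq in HK by lra. apply (Rmult_le_reg_r (wt t)); auto.
Qed.

(** The shape of the inverse of a matrix [h + e k] of size two: the determinant, divided by that of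
    [h], is quadratic in [e] and the cofactors are linear. The shift carries one more factor linear
    in [e], hence numerators of degree two. *)
Definition qf (P0 P1 P2 a b : pt -> C) (e : R) : pt -> C := fun q =>
  ((P0 q + RtoC e * P1 q + RtoC e * RtoC e * P2 q) * / (1 + RtoC e * a q + RtoC e * RtoC e * b q))%C.

(** The integrand is an explicit rational function of [e], so its second-order remainder is written
    in closed form and dominated by [wt], as [param_isd] requires. *)
Lemma J_var D (HD : dom D) P0 P1 P2 a b p :
  symb D (-2) P0 -> symb D (-2) P1 -> symb D (-2) P2 -> symb D 0 a -> symb D 0 b -> D p ->
  exists d, 0 < d /\
    (forall e t, Rabs e < d -> pr p <= t ->
      (1 + RtoC e * a (set_coord dr p t) + RtoC e * RtoC e * b (set_coord dr p t))%C <> 0%C) /\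
    (forall e, Rabs e < d ->
      rayI (pr p) (fun t => qf P0 P1 P2 a b e (set_coord dr p t)) (J (qf P0 P1 P2 a b e) p)) /\
    isd (fun e => J (qf P0 P1 P2 a b e) p) 0 (J (fsub P1 (fmul a P0)) p).
Proof.
  intros S0 S1 S2 Sa Sb Hp.
  destruct (ray_dom D HD P0 p S0 Hp) as (K0 & K00 & HK0).
  destruct (ray_dom D HD P1 p S1 Hp) as (K1 & K10 & HK1).
  destruct (ray_dom D HD P2 p S2 Hp) as (K2 & K20 & HK2).
  destruct (ray_bounded D HD a p Sa Hp) as (Ma & Ma0 & HMa).
  destruct (ray_bounded D HD b p Sb Hp) as (Mb & Mb0 & HMb).
  (* For [|e| < d] the linear term of the denominator is at most [1/4] and the quadratic one at most
     [1/16], so its modulus stays above [1/2] on the entire ray. *)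
  set (M := Ma + Mb + 1). set (d := / (4 * M)).
  assert (M1 : 1 <= M) by (unfold M; lra).
  assert (d0 : 0 < d) by (apply Rinv_0_lt_compat; lra).
  assert (dM : d * M = / 4) by (unfold d; field; lra).
  assert (d1 : d <= / 4) by nra.
  assert (LB : forall e t, Rabs e < d -> pr p <= t ->
    / 2 <= Cmod (1 + RtoC e * a (set_coord dr p t) + RtoC e * RtoC e * b (set_coord dr p t))%C).
  { intros e t He Ht. specialize (HMa t Ht). specialize (HMb t Ht).
    set (u := a (set_coord dr p t)) in *. set (v := b (set_coord dr p t)) in *.
    assert (T : Cmod 1 <= Cmod (1 + RtoC e * u + RtoC e * RtoC e * v) + Cmod (- (RtoC e * u + RtoC e * RtoC e * v))).
    { replace (RtoC 1) with ((1 + RtoC e * u + RtoC e * RtoC e * v) + - (RtoC e * u + RtoC e * RtoC e * v))%C at 1 by ring.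
      apply Cmod_triangle. }
    rewrite Cmod_1, Cmod_opp in T.
    pose proof (Cmod_triangle (RtoC e * u) (RtoC e * RtoC e * v)) as T2.
    rewrite !Cmod_mult, !Cmod_R in T2.
    pose proof (Rabs_pos e). pose proof (Cmod_ge_0 u). pose proof (Cmod_ge_0 v).
    assert (Rabs e * Cmod u <= d * M) by (apply Rmult_le_compat; unfold M; lra).
    assert (Rabs e * Rabs e * Cmod v <= d * M * / 4).
    { replace (d * M * / 4) with (d * / 4 * M) by ring.
      apply Rmult_le_compat; [ nra | auto | | unfold M; lra ]. apply Rmult_le_compat; lra. }
    lra. }
  assert (NZ : forall e t, Rabs e < d -> pr p <= t ->
      (1 + RtoC e * a (set_coord dr p t) + RtoC e * RtoC e * b (set_coord dr p t))%C <> 0%C).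
  { intros e t He Ht E. specialize (LB e t He Ht). rewrite E, Cmod_0 in LB. lra. }
  assert (IB : forall e t, Rabs e < d -> pr p <= t ->
    Cmod (/ (1 + RtoC e * a (set_coord dr p t) + RtoC e * RtoC e * b (set_coord dr p t)))%C <= 2).
  { intros e t He Ht. rewrite Cmod_inv by auto. rewrite <- (Rinv_inv 2).
    apply Rinv_le_contravar; auto. lra. }
  assert (RI : forall e, Rabs e < d -> rayI (pr p) (fun t => qf P0 P1 P2 a b e (set_coord dr p t)) (J (qf P0 P1 P2 a b e) p)).
  { intros e He. destruct (rayI_ex (pr p) (fun t => qf P0 P1 P2 a b e (set_coord dr p t)) ((K0 + K1 + K2) * 2)) as [l Hl].
    - intros t Ht. assert (Dt : D (set_coord dr p t)) by (apply (up_ray D HD); auto).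
      pose proof (fun F n (S : symb D n F) => line_isd D F dr p t (symb_base D n F S) Dt) as LI.
      pose proof (fun c : C => isd_const c t) as IC.
      eexists. unfold qf. apply isd_mul; [ | apply isd_inv; [ | apply NZ; auto ] ].
      + apply isd_add; [ apply isd_add | ]; [ apply (LI P0 _ S0) | apply isd_mul; [ apply IC | apply (LI P1 _ S1) ] | ].
        apply isd_mul; [ apply IC | apply (LI P2 _ S2) ].
      + apply isd_add; [ apply isd_add | ]; [ apply IC | apply isd_mul; [ apply IC | apply (LI a _ Sa) ] | ].
        apply isd_mul; [ apply IC | apply (LI b _ Sb) ].
    - intros t Ht. unfold qf. rewrite Cmod_mult.
      replace ((K0 + K1 + K2) * 2 * wt t) with ((K0 + K1 + K2) * wt t * 2) by ring.
      apply Rmult_le_compat; auto using Cmod_ge_0.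
      specialize (HK0 t Ht). specialize (HK1 t Ht). specialize (HK2 t Ht). pose proof (wt_pos t).
      eapply Rle_trans; [ apply Cmod_triangle | ]. rewrite !Cmod_mult, !Cmod_R.
      assert (E1 : Rabs e <= 1) by lra. pose proof (Rabs_pos e).
      assert (Cmod (P0 (set_coord dr p t) + RtoC e * P1 (set_coord dr p t))%C <= K0 * wt t + K1 * wt t).
      { eapply Rle_trans; [ apply Cmod_triangle | ]. rewrite Cmod_mult, Cmod_R.
        pose proof (Cmod_ge_0 (P1 (set_coord dr p t))). nra. }
      assert (Rabs e * Rabs e * Cmod (P2 (set_coord dr p t)) <= 1 * (K2 * wt t)).
      { apply Rmult_le_compat; auto using Cmod_ge_0; nra. }
      lra.
    - rewrite (J_of_ray _ _ _ Hl). exact Hl. }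
  exists d; split; auto; split; auto; split; auto.
  set (KK := 2 * (K2 + 2 * (M * (K1 + M * K0)) + M * K0)).
  apply (param_isd _ _ _ _ (rayI_ifun (pr p)) (fun e t => qf P0 P1 P2 a b e (set_coord dr p t))
    (fun t => fsub P1 (fmul a P0) (set_coord dr p t)) _ _ 0 d KK d0).
  - assert (0 <= M * K0) by nra. assert (0 <= M * (K1 + M * K0)) by nra. unfold KK. lra.
  - intros h Hh. rewrite Rplus_0_l. apply RI; auto.
  - apply (J_rayI D HD); auto. unf. so.
  - intros h t Hh Ht. rewrite Rplus_0_l.
    specialize (NZ h t Hh Ht). specialize (IB h t Hh Ht).
    specialize (HK0 t Ht). specialize (HK1 t Ht). specialize (HK2 t Ht). specialize (HMa t Ht). specialize (HMb t Ht).
    unfold qf, fsub. rewrite fadd_e, fopp_e, fmul_e.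
    set (x0 := P0 (set_coord dr p t)) in *. set (x1 := P1 (set_coord dr p t)) in *.
    set (x2 := P2 (set_coord dr p t)) in *. set (u := a (set_coord dr p t)) in *. set (v := b (set_coord dr p t)) in *.
    set (Iv := (/ (1 + RtoC h * u + RtoC h * RtoC h * v))%C) in *.
    (* With [c = P1 - a P0], the numerator minus the denominator times [P0 + e c] equals
       [e^2 (P2 - a c - b P0 - e b c)]. *)
    match goal with |- Cmod ?z <= _ => replace z with
      (RtoC h * RtoC h * (x2 + - (u * (x1 + - (u * x0))) + - (v * x0) + - (RtoC h * (v * (x1 + - (u * x0))))) * Iv)%C end.
    2: { unfold Iv. replace (1 + 0 * u + 0 * 0 * v)%C with (RtoC 1) by ring.
         field; repeat split; auto using C1_nz. }
    rewrite !Cmod_mult, Cmod_R.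
    assert (B1 : Cmod (x1 + - (u * x0))%C <= (K1 + M * K0) * wt t).
    { eapply Rle_trans; [ apply Cmod_triangle | ]. rewrite Cmod_opp, Cmod_mult. pose proof (wt_pos t).
      pose proof (Cmod_ge_0 u). pose proof (Cmod_ge_0 x0).
      assert (Cmod u * Cmod x0 <= M * (K0 * wt t)) by (apply Rmult_le_compat; unfold M; lra). lra. }
    pose proof (wt_pos t).
    assert (B2 : Cmod (u * (x1 + - (u * x0)))%C <= M * ((K1 + M * K0) * wt t)).
    { rewrite Cmod_mult. apply Rmult_le_compat; auto using Cmod_ge_0. unfold M; lra. }
    assert (B3 : Cmod (v * x0)%C <= M * (K0 * wt t)).
    { rewrite Cmod_mult. apply Rmult_le_compat; auto using Cmod_ge_0. unfold M; lra. }
    assert (B4 : Cmod (RtoC h * (v * (x1 + - (u * x0))))%C <= 1 * (M * ((K1 + M * K0) * wt t))).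
    { rewrite Cmod_mult, Cmod_R. apply Rmult_le_compat; auto using Cmod_ge_0, Rabs_pos; [ lra | ].
      rewrite Cmod_mult. apply Rmult_le_compat; auto using Cmod_ge_0. unfold M; lra. }
    assert (B : Cmod (x2 + - (u * (x1 + - (u * x0))) + - (v * x0) + - (RtoC h * (v * (x1 + - (u * x0)))))%C
       <= (K2 + 2 * (M * (K1 + M * K0)) + M * K0) * wt t).
    { eapply Rle_trans; [ apply Cmod_triangle | ]. rewrite Cmod_opp.
      eapply Rle_trans; [ apply Rplus_le_compat_r, Cmod_triangle | ]. rewrite Cmod_opp.
      eapply Rle_trans; [ apply Rplus_le_compat_r, Rplus_le_compat_r, Cmod_triangle | ]. rewrite Cmod_opp. lra. }
    replace (Rabs h * Rabs h) with (h ^ 2) by (rewrite <- Rabs_mult, Rabs_pos_eq; simpl; nra).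
    replace (KK * h ^ 2 * wt t) with (h ^ 2 * ((K2 + 2 * (M * (K1 + M * K0)) + M * K0) * wt t) * 2) by (unfold KK; ring).
    apply Rmult_le_compat; auto using Cmod_ge_0.
    { apply Rmult_le_pos; [ apply pow2_ge_0 | apply Cmod_ge_0 ]. }
    apply Rmult_le_compat_l; auto. apply pow2_ge_0.
Qed.

Lemma lim_rem D N q : symb D 1 N -> D q ->
  is_lim (fun r => 2 * Re (N (set_coord dr q r)) / r ^ 2) p_infty 0.
Proof.
  intros H Hq. destruct (symb_SB D _ _ H q Hq) as (K & K0 & HK).
  destruct (nsc_ray _ _ HK) as (M & M1 & X).
  intros P [e He].
  exists (M + 2 * K / e). intros r Hr. apply He.
  assert (e0 := cond_pos e).
  assert (Z : 0 <= 2 * K / e) by (apply Rmult_le_pos; [ lra | left; apply Rinv_0_lt_compat; auto ]).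
  assert (r1 : M < r) by lra.
  specialize (X r r1). change (Cmod (N (pu q, r, pz q)) <= K * (r * 1)) in X. rewrite Rmult_1_r in X.
  change (Rabs (2 * Re (N (pu q, r, pz q)) / r ^ 2 - 0) < e). rewrite Rminus_0_r.
  pose proof (re_le_Cmod (N (pu q, r, pz q))) as Y.
  unfold Rdiv. rewrite !Rabs_mult, Rabs_inv, (Rabs_pos_eq 2), (Rabs_pos_eq (r ^ 2)) by (try apply pow2_ge_0; lra).
  apply (Rle_lt_trans _ (2 * (K * r) * / r ^ 2)).
  { apply Rmult_le_compat_r; [ left; apply Rinv_0_lt_compat, pow_lt; lra | lra ]. }
  replace (2 * (K * r) * / r ^ 2) with (2 * K * / r) by (field; lra).
  apply (Rmult_lt_reg_r r); [ lra | ]. rewrite Rmult_assoc, Rinv_l, Rmult_1_r by lra.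
  assert (2 * K / e < r) by lra. apply (Rmult_lt_compat_r e) in H0; auto.
  unfold Rdiv in H0. rewrite Rmult_assoc, Rinv_l, Rmult_1_r in H0 by lra. lra.
Qed.

(** The conformal factor is a limit of [g / r^2], hence it sees only the leading coefficient. The
    factor [c] is 1 for the given metric and [1 + 2 e w] for a perturbed one. *)
Lemma cf_of_lead D (gg : metric) (phi : R -> C -> R) (c : R) N q : symb D 1 N -> cyl D q -> 0 < c ->
  (forall r, 0 < r -> gg hol ahol (set_coord dr q r) =
     (RtoC (r ^ 2 * (exp (2 * cfac phi q) / 2) * c) + N (set_coord dr q r))%C) ->
  conformal_factor gg (pu q) (pz q) = cfac phi q + / 2 * ln c.
Proof.
  intros HN [t Ht] c0 E. unfold conformal_factor.
  assert (L : is_lim (fun r => 2 * Re (gg hol ahol (pu q, r, pz q)) / r ^ 2) p_infty (exp (2 * cfac phi q) * c)).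
  { pose proof (lim_rem D N _ HN Ht) as L.
    apply (is_lim_ext_loc (fun r => exp (2 * cfac phi q) * c + 2 * Re (N (set_coord dr q r)) / r ^ 2)).
    - exists 0. intros r Hr. change (pu q, r, pz q) with (set_coord dr q r). rewrite (E r Hr).
      unfold Re; simpl. field. lra.
    - replace (Finite (exp (2 * cfac phi q) * c)) with (Rbar_plus (exp (2 * cfac phi q) * c) 0)
        by (simpl; f_equal; ring).
      apply (is_lim_plus _ _ _ (exp (2 * cfac phi q) * c) 0); [ apply is_lim_const | exact L | reflexivity ]. }
  rewrite (is_lim_unique _ _ _ L). simpl.
  rewrite ln_mult, ln_exp by (auto; apply exp_pos). field.
Qed.

(** * Variation of [f] *)

Lemma sm_rr_any E : opn E -> smooth E rr.
Proof.
  intros O k. pose proof (TB_bclass E O) as HB.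
  assert (B : base E rr).
  { intros p _; split; [ | intros i; apply rpd_rr ]. split; [ | apply continuous_const ].
    apply contR_of_eps. intros e He. exists e; split; auto. intros q (_ & A & _); exact A. }
  destruct k; (split; [ exact B | split; [ exact I | ] ]); auto.
  intros i. apply (Ck_TB _ _ 0). apply (Ck_ext E TB HB k 0 (fcst (match i with dr => 1%C | _ => 0%C end))).
  - intros p _. rewrite (proj2 (rpd_rr i p)). reflexivity.
  - apply Ck_cst; auto.
Qed.

Lemma nb_opn i p d a b : opn (nb i p d a b).
Proof.
  intros q [Q1 Q2].
  set (m := fun j => d - Rabs (coord j q - coord j p)).
  set (r := Rmin (coord i q - (a - d)) (b + d - coord i q)).
  assert (r0 : 0 < r) by (apply Rmin_glb_lt; lra).
  assert (X : exists e, 0 < e /\ forall j, j <> i -> e <= m j).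
  { assert (P : forall j, exists e, 0 < e /\ (j <> i -> e <= m j)).
    { intros j. destruct (classic (j = i)) as [->|N].
      - exists 1; split; [ lra | congruence ].
      - exists (m j); split; [ specialize (Q1 j N); unfold m; lra | lra ]. }
    destruct (P du) as (e1 & A1 & B1), (P dr) as (e2 & A2 & B2), (P dx) as (e3 & A3 & B3), (P dy) as (e4 & A4 & B4).
    exists (Rmin (Rmin e1 e2) (Rmin e3 e4)); split; [ repeat apply Rmin_glb_lt; auto | ].
    pose proof (Rmin_l (Rmin e1 e2) (Rmin e3 e4)); pose proof (Rmin_r (Rmin e1 e2) (Rmin e3 e4)).
    pose proof (Rmin_l e1 e2); pose proof (Rmin_r e1 e2); pose proof (Rmin_l e3 e4); pose proof (Rmin_r e3 e4).
    intros [| | |] N; [ specialize (B1 N) | specialize (B2 N) | specialize (B3 N) | specialize (B4 N) ]; lra. }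
  destruct X as (e & e0 & He).
  exists (Rmin e r); split; [ apply Rmin_glb_lt; auto | ]. intros x Hx. rewrite bx_coord in Hx.
  pose proof (Rmin_l e r); pose proof (Rmin_r e r).
  pose proof (Rmin_l (coord i q - (a - d)) (b + d - coord i q)); pose proof (Rmin_r (coord i q - (a - d)) (b + d - coord i q)).
  fold r in H1, H2.
  split.
  - intros j N. specialize (He j N). specialize (Hx j). unfold m in He.
    replace (coord j x - coord j p) with ((coord j x - coord j q) + (coord j q - coord j p)) by ring.
    eapply Rle_lt_trans; [ apply Rabs_triang | lra ].
  - specialize (Hx i). revert Hx. unfold Rabs; destruct Rcase_abs; lra.
Qed.

(** * Restriction to slices of constant [r] *)

Section Slice.
Context (E : pt -> Prop) (OE : opn E) (UE : ustar E).

Lemma slice_pd e F H m q : (forall x, E x -> pr x = e -> F x = H x) -> E q -> pr q = e -> m <> ir ->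
  pd m F q = pd m H q.
Proof.
  intros X Hq Eq Nm.
  assert (R : forall i, i <> dr -> rpd i F q = rpd i H q).
  { intros i Ni. assert (L := opn_coord E i q OE Hq).
    assert (Y : forall t, E (set_coord i q t) -> F (set_coord i q t) = H (set_coord i q t)).
    { intros t Ht. apply X; auto. change (coord dr (set_coord i q t) = e). rewrite coord_swap; auto. }
    unfold rpd; f_equal; apply Derive_ext_loc;
      (eapply filter_imp; [ | exact L ]; cbv beta; intros t Ht; rewrite Y; auto). }
  destruct m as [| |[|]]; simpl; rewrite ?R by discriminate; auto; congruence.
Qed.

Lemma slice_intu e F H q : (forall x, E x -> pr x = e -> F x = H x) -> E q -> pr q = e -> base E F ->
  intu H q = intu F q.
Proof.
  intros X Hq Eq HB. unfold intu at 1. apply segI_RInt.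
  eapply segI_ext; [ | apply (intu_segI E F q HB UE Hq) ].
  intros t Ht; cbv beta. apply X; auto.
Qed.
End Slice.

Section Perturb.
Context (D : pt -> Prop) (HD : dom D) (US : ustar (cyl D)).
Let O := dom_open D HD.
Let OC := cyl_opn D O.
Context (W : pt -> C) (V : ang -> pt -> C) (h : ang -> ang -> pt -> C) (phi : R -> C -> R).
Context (G : NUgeom D W V h phi).
Context (k : metric) (w1 : pt -> C).
Context (scw1 : smooth (cyl D) w1).
Context (rw1 : rindep w1).
Context (rew1 : forall q, cyl D q -> Im (w1 q) = 0).
Context (lead : symb D 1 (fsub (k hol ahol)
  (fmul (fmul (fcst (RtoC 2)) w1) (fmul (fmul rr rr) (gam phi hol ahol))))).
Context (Y2 : ang -> pt -> C) (T2 w2 : pt -> C).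
Context (scY2 : forall A, smooth (cyl D) (Y2 A)).
Context (scT2 : smooth (cyl D) T2).
Context (scw2 : smooth (cyl D) w2).
Context (rY2 : forall A, rindep (Y2 A)).
Context (rT2 : rindep T2).
Context (rw2 : rindep w2).
Local Notation ph := (cfac phi).
Let scph : smooth (cyl D) (ofR ph) := ng_phi _ _ _ _ _ G.

Definition gvar (e : R) : metric := fun m n q => (nu_metric W V h m n q + RtoC e * k m n q)%C.

Lemma w1_real q : cyl D q -> w1 q = RtoC (Re (w1 q)).
Proof. intros Hq. apply C_eq; simpl; auto. Qed.

(** The perturbation is [2 w1] times the leading term of the metric plus order [r], so the leading
    coefficient is multiplied by [1 + 2 e w1]. The dependence on [e] is thus known exactly and not
    merely to first order. *)
Lemma cf_ge e q : cyl D q -> 0 < 1 + 2 * e * Re (w1 q) ->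
  cfac (conformal_factor (gvar e)) q = ph q + / 2 * ln (1 + 2 * e * Re (w1 q)).
Proof.
  intros Hq Hp. unfold cfac at 1.
  apply (cf_of_lead D (gvar e) phi _ (fadd (hrem phi h hol ahol) (fmul (fcst (RtoC e)) (fsub (k hol ahol)
    (fmul (fmul (fcst (RtoC 2)) w1) (fmul (fmul rr rr) (gam phi hol ahol))))))); auto.
  - pose proof (ng_hrem _ _ _ _ _ G). generalize dependent (fsub (k hol ahol)
      (fmul (fmul (fcst (RtoC 2)) w1) (fmul (fmul rr rr) (gam phi hol ahol)))). intros. so.
  - intros r Hr. unfold gvar, hrem. unf.
    repeat first [ rewrite fadd_e | rewrite fmul_e | rewrite fopp_e | rewrite fcst_e ].
    rewrite rw1, gam_eq. change (nu_metric W V h hol ahol) with (h hol ahol).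
    rewrite fmul_e, fcst_e. change (ofR (fun p => exp (2 * ph p)) (set_coord dr q r)) with (RtoC (exp (2 * ph q))).
    change (rr (set_coord dr q r)) with (RtoC r).
    pose proof (w1_real q Hq) as Wq. set (x := Re (w1 q)) in *. rewrite Wq.
    replace (RtoC (r ^ 2 * (exp (2 * ph q) / 2) * (1 + 2 * e * x))) with
      (RtoC r * RtoC r * (RtoC (/ 2) * RtoC (exp (2 * ph q))) * (1 + RtoC 2 * RtoC e * RtoC x))%C.
    + ring.
    + rewrite <- !RtoC_mult, <- RtoC_plus, <- !RtoC_mult. f_equal. field.
Qed.

Context (p0 : pt) (Hp0 : D p0).

(** A region in which [r] is no longer the radial coordinate but the deformation parameter: it lies
    in the cylinder, not in [D]. Positivity of [1 + 2 r w1] keeps the logarithm smooth,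
    star-shapedness in [u] serves the integral in [f], and the line through [p0] is where
    derivatives in [e] are taken. *)
Record box (E : pt -> Prop) (d : R) : Prop := {
  bx_pos : 0 < d;
  bx_open : opn E;
  bx_star : ustar E;
  bx_cyl : forall q, E q -> cyl D q;
  bx_w : forall q, E q -> 0 < 1 + 2 * pr q * Re (w1 q);
  bx_line : forall e, Rabs e < d -> E (set_coord dr p0 e) }.

Lemma box_ex : exists E d, box E d.
Proof.
  set (x0 := set_coord dr p0 0).
  destruct (tube_bound (cyl D) w1 du x0 (Rmin 0 (pu p0)) (Rmax 0 (pu p0)) OC) as (d & K & d0 & K0 & HK).
  { intros q Hq; apply (smooth_base _ _ scw1 q Hq). }
  { apply Rminmax_ex. }
  { intros t Ht. apply US; [ apply cyl_set, cyl_sub; auto | exact Ht ]. }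
  (* Then [|2 r w1| <= 1/2] on the tube, as [K] bounds [w1] there. *)
  set (d' := Rmin d (/ (4 * (K + 1)))).
  assert (P : 0 < / (4 * (K + 1))) by (apply Rinv_0_lt_compat; lra).
  assert (d'0 : 0 < d') by (apply Rmin_glb_lt; auto).
  assert (D1 : d' <= d) by apply Rmin_l. assert (D2 : d' <= / (4 * (K + 1))) by apply Rmin_r.
  exists (nb du x0 d' (Rmin 0 (pu p0)) (Rmax 0 (pu p0))), d'.
  assert (SUB : forall q, nb du x0 d' (Rmin 0 (pu p0)) (Rmax 0 (pu p0)) q -> cyl D q /\ Cmod (w1 q) <= K).
  { intros q [A B]. apply HK. split; [ intros j Nj; specialize (A j Nj); lra | lra ]. }
  split; auto.
  - apply nb_opn.
  - intros q t [A B] Ht. split.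
    + intros j Nj. rewrite coord_swap by auto. apply A; auto.
    + rewrite coord_set. change (coord du q) with (pu q) in B.
      revert Ht. pose proof (Rmin_l 0 (pu p0)). pose proof (Rmax_l 0 (pu p0)).
      unfold Rmin at 1, Rmax at 1. destruct (Rle_dec 0 (pu q)); lra.
  - intros q Hq; apply SUB; auto.
  - intros q Hq. destruct (SUB q Hq) as [_ B]. destruct Hq as [A _].
    specialize (A dr ltac:(discriminate)). change (Rabs (pr q - 0) < d') in A. rewrite Rminus_0_r in A.
    pose proof (re_le_Cmod (w1 q)) as Rw.
    assert (X : Rabs (2 * pr q * Re (w1 q)) <= / 2).
    { rewrite !Rabs_mult, (Rabs_pos_eq 2) by lra.
      assert (Rabs (pr q) * Rabs (Re (w1 q)) <= / (4 * (K + 1)) * (K + 1)).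
      { apply Rmult_le_compat; auto using Rabs_pos; lra. }
      replace (/ (4 * (K + 1)) * (K + 1)) with (/ 4) in H by (field; lra). lra. }
    revert X. unfold Rabs; destruct Rcase_abs; lra.
  - intros e He. split.
    + intros j Nj. destruct (classic (j = dr)) as [->|N].
      * unfold x0. rewrite !coord_set, Rminus_0_r; auto.
      * unfold x0. rewrite !coord_swap, Rminus_diag, Rabs_R0 by auto; auto.
    + rewrite coord_swap by discriminate. change (coord du p0) with (pu p0).
      unfold Rmin, Rmax; destruct Rle_dec; lra.
Qed.

Context (E : pt -> Prop) (d : R) (BX : box E d).
Let OE : opn E := bx_open _ _ BX.
Let UE : ustar E := bx_star _ _ BX.
Let smE F (H : smooth (cyl D) F) : smooth E F := smooth_sub (cyl D) E F (bx_cyl _ _ BX) H.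

Definition lf (q : pt) : R := 1 + 2 * pr q * Re (w1 q).
Definition Ph (q : pt) : R := ph q + / 2 * ln (lf q).

Lemma sm_lf : smooth E (ofR lf) /\ forall q, E q -> ofR lf q = fadd (fcst (RtoC 1)) (fmul (fmul (fcst (RtoC 2)) rr) w1) q.
Proof.
  assert (X : forall q, E q -> ofR lf q = fadd (fcst (RtoC 1)) (fmul (fmul (fcst (RtoC 2)) rr) w1) q).
  { intros q Hq. repeat first [ rewrite fadd_e | rewrite fmul_e | rewrite fcst_e ].
    rewrite (w1_real q) by (apply (bx_cyl _ _ BX); auto). unfold ofR, lf, rr.
    rewrite <- !RtoC_mult, <- RtoC_plus. reflexivity. }
  split; auto. apply (sm_ext E OE (fadd (fcst (RtoC 1)) (fmul (fmul (fcst (RtoC 2)) rr) w1))).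
  - intros; symmetry; auto.
  - pose proof (sm_rr_any E OE). pose proof (smE _ scw1). sm.
Qed.

Lemma sm_Ph : smooth E (ofR Ph) /\ forall m q, E q -> pd m (ofR Ph) q =
  (pd m (ofR ph) q + RtoC (/ 2) * (RtoC (/ lf q) * pd m (ofR lf) q))%C.
Proof.
  destruct sm_lf as [S1 _].
  assert (S2 : smooth E (ofR (fun q => ln (lf q)))) by (apply sm_ln; auto; apply (bx_w _ _ BX)).
  pose proof (smE _ scph) as S3.
  assert (X : forall q, E q -> fadd (ofR ph) (fmul (fcst (RtoC (/ 2))) (ofR (fun q => ln (lf q)))) q = ofR Ph q).
  { intros q _. rewrite fadd_e, fmul_e, fcst_e. unfold ofR, Ph. rewrite RtoC_plus, RtoC_mult; auto. }
  split.
  - apply (sm_ext E OE _ _ X). sm.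
  - intros m q Hq. rewrite <- (pd_ext E OE m _ _ q X Hq). pdx E OE.
    rewrite (pd_ln E m lf) by (auto; apply (bx_w _ _ BX); auto). ring.
Qed.

Let smPh := proj1 sm_Ph.

Lemma Ph0 q : pr q = 0 -> Ph q = ph q.
Proof. intros Z. unfold Ph, lf. rewrite Z, Rmult_0_r, Rmult_0_l, Rplus_0_r, ln_1. ring. Qed.

Lemma pd_Ph0 m q : E q -> pr q = 0 -> m <> ir -> pd m (ofR Ph) q = pd m (ofR ph) q.
Proof.
  intros Hq Z Nm. apply (slice_pd E OE 0); auto. intros x _ Zx. unfold ofR. rewrite Ph0; auto.
Qed.

Lemma pd_r_Ph0 q : E q -> pr q = 0 -> pd ir (ofR Ph) q = w1 q.
Proof.
  intros Hq Z. rewrite (proj2 sm_Ph) by auto. rewrite (rindep_pd_r (ofR ph)) by (intros ? ?; reflexivity).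
  destruct sm_lf as [_ X]. rewrite (pd_ext E OE ir _ _ q X Hq).
  pose proof (sm_rr_any E OE). pose proof (smE _ scw1). pdx E OE. rewrite (rindep_pd_r w1) by auto.
  unfold lf, rr. rewrite Z, Rmult_0_r, Rmult_0_l, Rplus_0_r, Rinv_1, RtoC_inv by lra. field.
Qed.

Lemma pd_r_pd_Ph0 m q : E q -> pr q = 0 -> m <> ir -> pd ir (pd m (ofR Ph)) q = pd m w1 q.
Proof.
  intros Hq Z Nm. rewrite (pd_comm E) by auto. apply (slice_pd E OE 0); auto.
  intros; apply pd_r_Ph0; auto.
Qed.

Local Notation fE := (ff Ph Y2 T2 w2).
Let smY A : smooth E (Y2 A) := smE _ (scY2 A).
Let smT : smooth E T2 := smE _ scT2.
Let smw : smooth E w2 := smE _ scw2.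
Let sm_fE : smooth E fE := sm_ff E OE UE Ph Y2 T2 w2 smPh smY smT smw.

(** On [r = 0] the function [Ph] equals the unperturbed conformal factor and has radial derivative
    [w1]. Differentiating [ff] under the [u]-integral therefore yields the linearization [fvar]. *)
Lemma pd_r_fE q : E q -> pr q = 0 -> pd ir fE q = fvar ph Y2 T2 w2 w1 q.
Proof.
  intros Hq Z.
  set (B := fmul (ofR (fun p => exp (- Ph p))) (fpsi Ph Y2 w2)).
  set (B0 := fmul (ofR (fun p => exp (- ph p))) (fpsi ph Y2 w2)).
  set (Cv := fmul (ofR (fun p => exp (- ph p)))
        (fsub (fsum2 (fun A => fmul (fcst (RtoC 2)) (fmul (Y2 A) (pd A w1)))) (fmul w1 (fpsi ph Y2 w2)))).
  pose proof (sm_mexp E OE Ph smPh) as sme.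
  assert (smpsi : smooth E (fpsi Ph Y2 w2)) by (apply sm_psi; auto).
  assert (smB : smooth E B) by (unfold B; sm).
  assert (Epsi : forall x, E x -> pr x = 0 -> fpsi Ph Y2 w2 x = fpsi ph Y2 w2 x).
  { intros x Hx Zx. unfold fpsi, fdivP. unf.
    repeat first [ rewrite fadd_e | rewrite fmul_e | rewrite fopp_e | rewrite fcst_e ].
    rewrite !pd_Ph0 by (auto; discriminate). reflexivity. }
  assert (I1 : intu B0 q = intu B q).
  { apply (slice_intu E UE 0); auto using smooth_base. intros x Hx Zx. unfold B, B0. rewrite !fmul_e, Epsi by auto.
    unfold ofR. rewrite Ph0; auto. }
  assert (I2 : pd ir (intu B) q = intu Cv q).
  { change (pd ir (intu B) q) with (rpd dr (intu B) q). rewrite (proj2 (intu_rpd E B dr q OE UE smB Hq)).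
    symmetry. apply (slice_intu E UE 0); auto.
    - intros x Hx Zx. change (rpd dr B x) with (pd ir B x). unfold B. pdx E OE.
      rewrite (pd_mexp E OE Ph smPh) by auto. rewrite pd_r_Ph0, Epsi by auto.
      unfold fpsi at 2. unfold fdivP. unf. pdx E OE.
      rewrite !pd_r_pd_Ph0 by (auto; discriminate).
      rewrite (rindep_pd_r w2), !(rindep_pd_r (Y2 _)), !(pd_ir_re _ (Y2 _)) by auto.
      unfold Cv. unf. repeat first [ rewrite fadd_e | rewrite fmul_e | rewrite fopp_e | rewrite fcst_e ].
      unfold ofR. rewrite Ph0 by auto. ring.
    - apply smooth_base, smooth_rpd, smB. }
  unfold ff, fF. fold B.
  assert (smI : smooth E (intu B)) by (apply intu_smooth; auto).
  assert (smx : smooth E (ofR (fun p => exp (Ph p)))) by (apply sm_exp; auto).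
  pdx E OE. rewrite (pd_exp E ir Ph) by auto. rewrite I2, pd_r_Ph0 by auto.
  rewrite (rindep_pd_r T2) by auto.
  unfold fvar, ff, fF. fold B0 Cv.
  repeat first [ rewrite fadd_e | rewrite fmul_e | rewrite fopp_e | rewrite fcst_e ].
  rewrite I1. unfold ofR. rewrite Ph0 by auto. ring.
Qed.

(** The radial coordinate serves as deformation parameter: on the slice [r = e] of the box, [Ph] is the
    conformal factor of the perturbed metric [gvar e], so [f] varies smoothly with [e] because [fE] is smooth. *)
Lemma ff_ge e q : E q -> pr q = e -> ff (cfac (conformal_factor (gvar e))) Y2 T2 w2 q = fE q.
Proof.
  intros Hq Eq.
  assert (C0 : forall x, E x -> pr x = e -> Ph x = cfac (conformal_factor (gvar e)) x).
  { intros x Hx Ex. rewrite cf_ge; [ | apply (bx_cyl _ _ BX); auto | rewrite <- Ex; apply (bx_w _ _ BX x Hx) ].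
    unfold Ph, lf. rewrite Ex. reflexivity. }
  unfold ff, fF. repeat first [ rewrite fadd_e | rewrite fmul_e | rewrite fopp_e | rewrite fcst_e ].
  assert (smpsi : smooth E (fpsi Ph Y2 w2)) by (apply sm_psi; auto).
  pose proof (sm_mexp E OE Ph smPh) as sme.
  rewrite (slice_intu E UE e (fmul (ofR (fun p => exp (- Ph p))) (fpsi Ph Y2 w2))); auto.
  - unfold ofR. rewrite C0; auto.
  - intros x Hx Ex. rewrite !fmul_e. unfold ofR at 1 2. rewrite C0 by auto. f_equal.
    unfold fpsi, fdivP. unf. repeat first [ rewrite fadd_e | rewrite fmul_e | rewrite fopp_e | rewrite fcst_e ].
    rewrite !(slice_pd E OE e (ofR Ph) (ofR (cfac (conformal_factor (gvar e)))))
      by (auto; try discriminate; intros; unfold ofR; rewrite C0; auto). reflexivity.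
  - apply smooth_base. sm.
Qed.

Local Notation fg e := (ff (cfac (conformal_factor (gvar e))) Y2 T2 w2).
Local Notation ev := (fvar ph Y2 T2 w2 w1).

Lemma rindep_fg e : rindep (fg e).
Proof. apply rindep_ff; auto. intros ? ?; reflexivity. Qed.

Lemma rindep_fvar : rindep ev.
Proof.
  unfold fvar, fpsi, fdivP. unf.
  assert (r0 : rindep (ofR ph)) by (intros ? ?; reflexivity).
  assert (r1 := rindep_comp exp ph r0). assert (r2 := rindep_comp (fun x => exp (- x)) ph r0).
  pose proof (rindep_ff ph Y2 T2 w2 r0 rY2 rT2 rw2). auto 20 with sm.
Qed.

Lemma isd_line F H : (forall e, Rabs e < d -> F e = H (set_coord dr p0 e)) -> smooth E H ->
  isd F 0 (pd ir H (set_coord dr p0 0)).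
Proof.
  intros X S. pose proof (bx_pos _ _ BX) as d0.
  apply (isd_ext_loc (fun e => H (set_coord dr p0 e))).
  - exists (mkposreal d d0). intros e He. symmetry; apply X. change (Rabs (e - 0) < d) in He.
    rewrite Rminus_0_r in He; auto.
  - apply (line_isd E H dr p0 0); [ apply smooth_base, S | apply (bx_line _ _ BX); rewrite Rabs_R0; auto ].
Qed.

Let E0 : E (set_coord dr p0 0).
Proof. apply (bx_line _ _ BX). rewrite Rabs_R0; apply (bx_pos _ _ BX). Qed.

Lemma var_f : isd (fun e => fg e p0) 0 (ev p0).
Proof.
  rewrite <- (rindep_fvar p0 0), <- (pd_r_fE _ E0 eq_refl).
  apply isd_line; auto. intros e He.
  rewrite <- (rindep_fg e p0 e). apply ff_ge; auto. apply (bx_line _ _ BX); auto.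
Qed.

(** The derivative in the deformation parameter is [pd ir] of the smooth function [fE], so it
    commutes with [pd m] by symmetry of second derivatives; restriction to slices translates this
    back to the perturbed metrics. *)
Lemma var_pd m : m <> ir -> isd (fun e => pd m (fg e) p0) 0 (pd m ev p0).
Proof.
  intros Nm.
  assert (V0 : pd ir (pd m fE) (set_coord dr p0 0) = pd m ev p0).
  { rewrite (pd_comm E) by auto. rewrite <- (rindep_pd m _ rindep_fvar p0 0).
    apply (slice_pd E OE 0); auto. intros; apply pd_r_fE; auto. }
  rewrite <- V0. apply isd_line; [ | sm ]. intros e He.
  rewrite <- (rindep_pd m _ (rindep_fg e) p0 e).
  apply (slice_pd E OE e); auto; [ intros; apply ff_ge; auto | apply (bx_line _ _ BX); auto ].
Qed.

Lemma var_pd2 m n : m <> ir -> n <> ir -> isd (fun e => pd m (pd n (fg e)) p0) 0 (pd m (pd n ev) p0).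
Proof.
  intros Nm Nn.
  assert (V0 : pd ir (pd m (pd n fE)) (set_coord dr p0 0) = pd m (pd n ev) p0).
  { rewrite (pd_comm E) by (auto; sm). rewrite <- (rindep_pd m _ (rindep_pd n _ rindep_fvar) p0 0).
    apply (slice_pd E OE 0); auto. intros x Hx Zx. rewrite (pd_comm E) by auto.
    apply (slice_pd E OE 0); auto. intros; apply pd_r_fE; auto. }
  rewrite <- V0. apply isd_line; [ | sm ]. intros e He.
  rewrite <- (rindep_pd m _ (rindep_pd n _ (rindep_fg e)) p0 e).
  refine (slice_pd E OE e _ _ m _ _ (bx_line _ _ BX e He) eq_refl Nm). intros x Hx Ex.
  refine (slice_pd E OE e _ _ n _ _ Hx Ex Nn). intros; apply ff_ge; auto.
Qed.

Lemma var_exp : isd (fun e => RtoC (exp (-2 * cfac (conformal_factor (gvar e)) p0))) 0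
  (RtoC (-2 * exp (-2 * ph p0)) * w1 p0)%C.
Proof.
  set (H := ofR (fun q => exp (-2 * Ph q))).
  assert (X : forall q, E q -> fmul (fcst (RtoC (-2))) (ofR Ph) q = ofR (fun q => -2 * Ph q) q).
  { intros q _. rewrite fmul_e, fcst_e. unfold ofR. rewrite RtoC_mult; auto. }
  assert (S : smooth E (ofR (fun q => -2 * Ph q))) by (apply (sm_ext E OE _ _ X); sm).
  assert (SH : smooth E H) by (apply (sm_exp E OE (fun q => -2 * Ph q)), S).
  assert (V0 : pd ir H (set_coord dr p0 0) = (RtoC (-2 * exp (-2 * ph p0)) * w1 p0)%C).
  { unfold H. rewrite (pd_exp E ir (fun q => -2 * Ph q)) by auto.
    rewrite <- (pd_ext E OE ir _ _ _ X E0). pdx E OE. rewrite pd_r_Ph0, Ph0, rw1 by auto.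
    change (ph (set_coord dr p0 0)) with (ph p0). rewrite RtoC_mult. ring. }
  rewrite <- V0. apply isd_line; auto. intros e He. unfold H, ofR. f_equal. f_equal. f_equal.
  pose proof (bx_line _ _ BX e He) as Ee.
  change (cfac (conformal_factor (gvar e)) p0) with (cfac (conformal_factor (gvar e)) (set_coord dr p0 e)).
  rewrite cf_ge; [ | apply (bx_cyl _ _ BX); auto | apply (bx_w _ _ BX _ Ee) ].
  reflexivity.
Qed.
End Perturb.

(** * Variation of the radial integrals *)

(** Derivatives were handled componentwise so far, in accordance with [rpd]. The statement of the
    variation uses the normed module [C], reached by writing [f] as [Re f] times 1 plus [Im f] times
    [Ci]. *)
Lemma is_derive_of_isd (f : R -> C) x l : isd f x l -> @is_derive R_AbsRing C_R_NormedModule f x l.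
Proof.
  intros [A B].
  apply (is_derive_ext (fun t => plus (scal (Re (f t)) (RtoC 1 : C_R_NormedModule)) (scal (Im (f t)) (Ci : C_R_NormedModule)))).
  - intros t. unfold plus, scal; simpl. apply injective_projections; simpl;
      unfold plus, scal, Re, Im; simpl; unfold mult; simpl; ring.
  - evar_last.
    + apply @is_derive_plus; apply (is_derive_scal_l (K:=R_AbsRing)); [ exact A | exact B ].
    + apply injective_projections; simpl; unfold plus, scal, Re, Im; simpl; unfold mult; simpl; ring.
Qed.

Section Variation.
Context (D : pt -> Prop) (HD : dom D) (US : ustar (cyl D)).
Context (W : pt -> C) (V : ang -> pt -> C) (h : ang -> ang -> pt -> C) (phi : R -> C -> R).
Context (G : NUgeom D W V h phi).
Local Notation gi := (gi W V h).
Local Notation ph := (cfac phi).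
Local Notation idet := (idet h).
Context (Y1 : ang -> pt -> C) (f1 w1 : pt -> C) (N1 : generator D phi Y1 f1 w1).
Local Notation X1 := (Xf W V h phi Y1 f1).
Local Notation ka := (kab W V h phi Y1 f1).
Local Notation ku := (kua W V h phi Y1 f1).
Local Notation gs := (gsh V h).
Context (k : metric).
Context (Eka : forall A B q, D q -> k (ia A) (ia B) q = ka A B q).
Context (Eku : forall A q, D q -> k iu (ia A) q = ku A q).

Let hsym : forall A B p, D p -> h A B p = h B A p := ng_sym _ _ _ _ _ G.
Let soh : forall A B, symb D 2 (h A B) := ltac:(intros; eapply so_h; eassumption).
Let sogi : forall A B, symb D (-2) (gi A B) := ltac:(intros; eapply so_gi; eassumption).
Let soid : symb D (-4) idet := ltac:(eapply so_idet; eassumption).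
Let soka : forall A B, symb D 2 (ka A B) := so_kab D HD W V h phi G Y1 f1 w1 N1.
Let soku : forall A, symb D 0 (ku A) := so_kua D HD W V h phi G Y1 f1 w1 N1.
Let sogs : forall A, symb D 0 (gs A) := ltac:(intros; eapply so_gsh; eassumption).

Definition adj (m : ang -> ang -> pt -> C) (A B : ang) : pt -> C := match A, B with
  | hol, hol => m ahol ahol | ahol, ahol => m hol hol | _, _ => fopp (m A B) end.
(** [al] is the trace of [h^{-1} k] and [be] the quotient of the determinants of [k] and [h]: the
    coefficients of [e] and [e^2] in the determinant of [h + e k] divided by that of [h]. *)
Definition al : pt -> C := fmul idet (fsub (fadd (fmul (h hol hol) (ka ahol ahol)) (fmul (h ahol ahol) (ka hol hol)))
  (fadd (fmul (h hol ahol) (ka ahol hol)) (fmul (h ahol hol) (ka hol ahol)))).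
Definition be : pt -> C := fmul idet (fsub (fmul (ka hol hol) (ka ahol ahol)) (fmul (ka hol ahol) (ka ahol hol))).
Definition gq1 (A B : ang) : pt -> C := fmul (adj ka A B) idet.
Definition sq1 (A : ang) : pt -> C := fopp (fsum2 (fun B => fadd (fmul (gq1 A B) (gs B)) (fmul (gi A B) (ku B)))).
Definition sq2 (A : ang) : pt -> C := fopp (fsum2 (fun B => fmul (gq1 A B) (ku B))).

Lemma so_al : symb D 0 al.
Proof. unfold al; unf. so. Qed.
Lemma so_be : symb D 0 be.
Proof. unfold be; unf. so. Qed.
Lemma so_gq1 A B : symb D (-2) (gq1 A B).
Proof. unfold gq1; destruct A, B; unfold adj; so. Qed.
Hint Resolve so_gq1 : so.
Lemma so_sq1 A : symb D (-2) (sq1 A).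
Proof. unfold sq1; unf. so. Qed.
Lemma so_sq2 A : symb D (-2) (sq2 A).
Proof. unfold sq2; unf. so. Qed.

Local Notation ge := (gvar W V h k).
Definition Xe (e : R) (q : pt) : C := (1 + RtoC e * al q + RtoC e * RtoC e * be q)%C.

Lemma ge_inv e A B q : D q -> Xe e q <> 0%C ->
  ginv (ge e) A B q = qf (gi A B) (gq1 A B) (fcst 0%C) al be e q.
Proof.
  intros Hq Nz. pose proof (det_ne D W V h phi G q Hq) as Nd.
  assert (Ed : det2 (fun A' B' => ge e A' B' q) =
    ((h hol hol q * h ahol ahol q - h hol ahol q * h hol ahol q) * Xe e q)%C).
  { unfold det2, gvar, Xe, al, be. unf.
    repeat first [ rewrite fadd_e | rewrite fmul_e | rewrite fopp_e ].
    rewrite !Eka, (idet_val D W V h phi G), (hsym ahol hol) by auto.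
    simpl nu_metric. rewrite (hsym ahol hol) by auto. field; auto. }
  unfold ginv, inv2, qf. rewrite Ed. fold (Xe e q).
  rewrite gi_eq. unfold gq1, adj, gic.
  destruct A, B; repeat first [ rewrite fadd_e | rewrite fmul_e | rewrite fopp_e | rewrite fcst_e ];
    rewrite (idet_val D W V h phi G) by auto; unfold gvar; rewrite Eka by auto; simpl nu_metric;
    field; split; auto.
Qed.

Lemma ge_shift e A q : D q -> Xe e q <> 0%C ->
  shift_of (ge e) A q = qf (fopp (fsum2 (fun B => fmul (gi A B) (gs B)))) (sq1 A) (sq2 A) al be e q.
Proof.
  intros Hq Nz. unfold shift_of, sum2. rewrite !ge_inv by auto. unfold gvar at 1 2.
  rewrite !Eku, !nu_gsh by auto.
  unfold qf, sq1, sq2. fold (Xe e q). unf.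
  repeat first [ rewrite fadd_e | rewrite fmul_e | rewrite fopp_e | rewrite fcst_e ].
  field; auto.
Qed.

Lemma dginv_q A B q : D q -> fsub (gq1 A B) (fmul al (gi A B)) q = dginv V gi X1 A B q.
Proof.
  intros Hq. rewrite (dginv_k D HD W V h phi G) by auto. pose proof (det_ne D W V h phi G q Hq) as Nd.
  unfold sum2. rewrite !gi_eq. unfold gq1, adj, al, gic. unf.
  destruct A, B; repeat first [ rewrite fadd_e | rewrite fmul_e | rewrite fopp_e | rewrite fcst_e ];
    rewrite (idet_val D W V h phi G), ?(hsym ahol hol) by auto; field; exact Nd.
Qed.

Lemma dshift_q A q : D q ->
  fsub (sq1 A) (fmul al (fopp (fsum2 (fun B => fmul (gi A B) (gs B))))) q = dshift V gi W X1 A q.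
Proof.
  intros Hq. rewrite (dshift_k D HD W V h phi G Y1 f1 w1 N1) by auto. unfold sum2.
  rewrite <- !dginv_q by auto. unfold sq1. unf.
  repeat first [ rewrite fadd_e | rewrite fmul_e | rewrite fopp_e | rewrite fcst_e ]. ring.
Qed.

Lemma shift_V A q : D q -> fopp (fsum2 (fun B => fmul (gi A B) (gs B))) q = V A q.
Proof.
  intros Hq. pose proof (gi_h D W V h phi G A hol q Hq) as H1. pose proof (gi_h D W V h phi G A ahol q Hq) as H2.
  unfold sum2 in *. unfold gsh. unf.
  repeat first [ rewrite fadd_e | rewrite fmul_e | rewrite fopp_e | rewrite fcst_e ].
  transitivity ((gi A hol q * h hol hol q + gi A ahol q * h ahol hol q) * V hol q
    + (gi A hol q * h hol ahol q + gi A ahol q * h ahol ahol q) * V ahol q)%C; [ ring | ].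
  rewrite H1, H2. destruct A; ring.
Qed.

Lemma shift_of_V A q : D q -> shift_of (nu_metric W V h) A q = V A q.
Proof.
  intros Hq. rewrite <- shift_V by auto. unfold shift_of, sum2. rewrite !nu_gsh. unf.
  repeat first [ rewrite fadd_e | rewrite fmul_e | rewrite fopp_e | rewrite fcst_e ]. reflexivity.
Qed.

Context (p : pt) (Hp : D p).

Lemma var_J (F : R -> pt -> C) P0 P1 P2 : symb D (-2) P0 -> symb D (-2) P1 -> symb D (-2) P2 ->
  (forall e q, D q -> Xe e q <> 0%C -> F e q = qf P0 P1 P2 al be e q) ->
  isd (fun e => J (F e) p) 0 (J (fsub P1 (fmul al P0)) p).
Proof.
  intros S0 S1 S2 H.
  destruct (J_var D HD P0 P1 P2 al be p S0 S1 S2 so_al so_be Hp) as (d & d0 & Nz & RI & X).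
  eapply isd_ext_loc; [ | exact X ].
  exists (mkposreal d d0). intros e He. change (Rabs (e - 0) < d) in He. rewrite Rminus_0_r in He.
  symmetry. apply J_of_ray. eapply rayI_ext; [ | apply (RI e He) ].
  intros t Ht; cbv beta. symmetry. apply H; [ apply (up_ray D HD); auto | apply Nz; auto ].
Qed.

Lemma var_J_ginv A B : isd (fun e => J (ginv (ge e) A B) p) 0 (J (dginv V gi X1 A B) p).
Proof.
  (* For the inverse metric the numerator is linear in [e], so the coefficient [P2] is zero. *)
  assert (S : symb D (-2) (fcst 0%C)) by (intros n; apply Ck_zero, SB_bclass, HD).
  eapply isd_eq; [ apply (var_J (fun e => ginv (ge e) A B) (gi A B) (gq1 A B) (fcst 0%C)); auto using so_gq1, ge_inv | ].
  pose proof so_al. pose proof (so_gq1 A B).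
  symmetry. apply (J_ext D HD); auto using dginv_q. unf. so.
Qed.

Lemma var_J_shift A : isd (fun e => J (shift_of (ge e) A) p) 0 (J (dshift V gi W X1 A) p).
Proof.
  assert (S : symb D (-2) (fopp (fsum2 (fun B => fmul (gi A B) (gs B))))) by (unf; so).
  eapply isd_eq; [ apply (var_J (fun e => shift_of (ge e) A) _ (sq1 A) (sq2 A) S); auto using so_sq1, so_sq2, ge_shift | ].
  pose proof so_al. pose proof (so_sq1 A).
  symmetry. apply (J_ext D HD); auto using dshift_q. unf. so.
Qed.
End Variation.

(** * The modified bracket *)

Definition Yl (s : triple) (A : ang) : pt -> C := lift_z (tY s A).
Definition Tl (s : triple) : pt -> C := lift_z (tT s).
Definition wl (s : triple) : pt -> C := lift_uz (tw s).

Lemma pd_u_z F q : pd iu (lift_z F) q = 0%C.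
Proof. apply (isd_rpd du (lift_z F) q 0%C (isd_const (F (pz q)) (pu q))). Qed.

Lemma dz_pd A F q : dz A F (pz q) = pd A (lift_z F) q.
Proof. destruct q as [[u r] z]. reflexivity. Qed.

Lemma ge0 W V h k : gvar W V h k 0 = nu_metric W V h.
Proof.
  apply functional_extensionality; intros m. apply functional_extensionality; intros n.
  apply functional_extensionality; intros q. unfold gvar. ring.
Qed.

Lemma smooth_fvar E P Y2 T2 w2 w1 : opn E -> ustar E -> smooth E (ofR P) -> (forall A, smooth E (Y2 A)) ->
  smooth E T2 -> smooth E w2 -> smooth E w1 -> smooth E (fvar P Y2 T2 w2 w1).
Proof.
  intros OE UE SP SY ST S2 S1. unfold fvar.
  pose proof (sm_ff E OE UE P Y2 T2 w2 SP SY ST S2). pose proof (sm_psi E OE P Y2 w2 SP SY S2).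
  pose proof (sm_mexp E OE P SP). pose proof (sm_exp E OE P SP).
  apply (sm_add E OE); [ sm | ]. repeat (apply (sm_mul E OE); [ sm | ]).
  apply intu_smooth; auto. unf. sm.
Qed.

Section Main.
Context (D : pt -> Prop) (HD : dom D) (US : ustar (cyl D)).
Let O := dom_open D HD.
Let OC := cyl_opn D O.
Context (W : pt -> C) (V : ang -> pt -> C) (h : ang -> ang -> pt -> C).
Local Notation g := (nu_metric W V h).
Local Notation phi := (conformal_factor g).
Local Notation ph := (cfac phi).
Context (G : NUgeom D W V h phi).

Record datum (s : triple) : Prop := {
  dt_Y : forall A, smooth (cyl D) (Yl s A);
  dt_T : smooth (cyl D) (Tl s);
  dt_w : smooth (cyl D) (wl s);
  dt_re : forall q, cyl D q -> Im (wl s q) = 0;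
  dt_hol : forall A q, cyl D q -> pd (abar A) (Yl s A) q = 0%C }.

Lemma xi_f_eq s : xi_f s g = ff ph (Yl s) (Tl s) (wl s).
Proof. apply xi_f_ff. Qed.

Lemma rindep_xi_f s : rindep (xi_f s g).
Proof.
  rewrite xi_f_eq. apply rindep_ff; try (intros; apply rindep_z); try (intros ? ?; reflexivity).
Qed.

Lemma sc_xi_f s : (forall A, smooth (cyl D) (Yl s A)) -> smooth (cyl D) (Tl s) -> smooth (cyl D) (wl s) ->
  smooth (cyl D) (xi_f s g).
Proof. intros. rewrite xi_f_eq. apply sm_ff; auto. apply (ng_phi _ _ _ _ _ G). Qed.

Lemma gen_of_datum s : datum s -> generator D phi (Yl s) (xi_f s g) (wl s).
Proof.
  intros H. pose proof (dt_Y _ H). pose proof (dt_T _ H). pose proof (dt_w _ H).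
  split; auto.
  - apply sc_xi_f; auto.
  - intros A; apply rindep_z.
  - apply rindep_xi_f.
  - apply rindep_uz.
  - intros A q; apply pd_u_z.
  - apply (dt_hol _ H).
  - intros q Hq. rewrite xi_f_eq. rewrite (ff_u (cyl D) OC US); auto.
    + unfold fpsi, fdiv, fdivP. unf.
      repeat first [ rewrite fadd_e | rewrite fmul_e | rewrite fopp_e | rewrite fcst_e ]. ring.
    + apply (ng_phi _ _ _ _ _ G).
    + apply pd_u_z.
Qed.

Lemma J_shift A q : D q -> J (shift_of g A) q = J (V A) q.
Proof.
  intros Hq. apply (J_ext D HD); auto.
  - apply (ng_V _ _ _ _ _ G).
  - intros x Hx. symmetry. eapply shift_of_V; eauto.
Qed.

(** The equality holds on [D] only, because recovering [V] from [shift_of] uses the invertibility of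
    [h]. As [D] is open, it passes to derivatives. *)
Lemma xi_eq s m q : D q -> xi s g m q = Xf W V h phi (Yl s) (xi_f s g) m q.
Proof.
  intros Hq. destruct m as [| |A]; [ reflexivity | | ].
  - unfold xi, Xf, flap, laplacian, sum2. unf.
    change (int_to_scri (shift_of g hol) q) with (J (shift_of g hol) q).
    change (int_to_scri (shift_of g ahol) q) with (J (shift_of g ahol) q).
    rewrite !J_shift by auto.
    repeat first [ rewrite fadd_e | rewrite fmul_e | rewrite fopp_e | rewrite fcst_e ].
    unfold rr, ofR, cfac. rewrite (RtoC_mult 4). ring.
  - unfold xi, Xf, sum2. unf.
    repeat first [ rewrite fadd_e | rewrite fmul_e | rewrite fopp_e | rewrite fcst_e ].
    change (int_to_scri (ginv g A hol) q) with (J (gi W V h A hol) q).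
    change (int_to_scri (ginv g A ahol) q) with (J (gi W V h A ahol) q). unfold Yl, lift_z. ring.
Qed.

Lemma lie_xi s m n q : D q ->
  lie_derivative (xi s g) g m n q = lie_derivative (Xf W V h phi (Yl s) (xi_f s g)) g m n q.
Proof.
  intros Hq. unfold lie_derivative, sum4, sum2.
  assert (E : forall l i, pd l (xi s g i) q = pd l (Xf W V h phi (Yl s) (xi_f s g) i) q)
    by (intros l i; apply (pd_ext D O); auto; intros; apply xi_eq; auto).
  rewrite !E, !xi_eq by auto. reflexivity.
Qed.

(** Each component of [xi] is a sum of products of quantities whose derivative in [e] is known: [f]
    and its derivatives, the factor [exp (-2 phi)], and the radial integrals. The product rule at
    [e = 0] assembles [Vf]. *)
Lemma variation s1 s2 : datum s1 -> datum s2 ->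
  is_variation D (xi s2) g (lie_derivative (xi s1 g) g)
    (Vf W V h phi (Xf W V h phi (Yl s1) (xi_f s1 g)) (wl s1)
      (fvar ph (Yl s2) (Tl s2) (wl s2) (wl s1)) (xi_f s2 g)).
Proof.
  intros H1 H2 m p Hp. apply is_derive_of_isd.
  set (k := lie_derivative (xi s1 g) g).
  set (ev := fvar ph (Yl s2) (Tl s2) (wl s2) (wl s1)).
  pose proof (gen_of_datum s1 H1) as N1.
  assert (Eka : forall A B q, D q -> k (ia A) (ia B) q = kab W V h phi (Yl s1) (xi_f s1 g) A B q).
  { intros A B q Hq. unfold k. rewrite lie_xi, lie_kab by auto. reflexivity. }
  assert (Eku : forall A q, D q -> k iu (ia A) q = kua W V h phi (Yl s1) (xi_f s1 g) A q).
  { intros A q Hq. unfold k. rewrite lie_xi, lie_kua by auto. reflexivity. }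
  assert (lead : symb D 1 (fsub (k hol ahol)
    (fmul (fmul (fcst (RtoC 2)) (wl s1)) (fmul (fmul rr rr) (gam phi hol ahol))))).
  { eapply (so_ext D HD); [ | exact (so_kab_lead D HD W V h phi G (Yl s1) (xi_f s1 g) (wl s1) N1) ].
    intros q Hq. unf. rewrite !fadd_e, Eka by auto. reflexivity. }
  change (isd (fun e => xi s2 (gvar W V h k e) m p) 0
    (Vf W V h phi (Xf W V h phi (Yl s1) (xi_f s1 g)) (wl s1) ev (xi_f s2 g) m p)).
  destruct (box_ex D HD US (wl s1) (dt_w _ H1) p Hp) as (E & d & BX).
  pose proof (var_f D HD W V h phi G k (wl s1) (dt_w _ H1) (rindep_uz _) (dt_re _ H1) lead (Yl s2) (Tl s2) (wl s2)
    (dt_Y _ H2) (dt_T _ H2) (dt_w _ H2) (fun A => rindep_z _) (rindep_z _) (rindep_uz _) p E d BX) as Vf0.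
  pose proof (var_pd D HD W V h phi G k (wl s1) (dt_w _ H1) (rindep_uz _) (dt_re _ H1) lead (Yl s2) (Tl s2) (wl s2)
    (dt_Y _ H2) (dt_T _ H2) (dt_w _ H2) (fun A => rindep_z _) (rindep_z _) (rindep_uz _) p E d BX) as Vf1.
  pose proof (var_pd2 D HD W V h phi G k (wl s1) (dt_w _ H1) (rindep_uz _) (dt_re _ H1) lead (Yl s2) (Tl s2) (wl s2)
    (dt_Y _ H2) (dt_T _ H2) (dt_w _ H2) (fun A => rindep_z _) (rindep_z _) (rindep_uz _) p E d BX) as Vf2.
  pose proof (var_exp D HD W V h phi G k (wl s1) (dt_w _ H1) (rindep_uz _) (dt_re _ H1) lead p E d BX) as Ve.
  pose proof (var_J_ginv D HD W V h phi G (Yl s1) (xi_f s1 g) (wl s1) N1 k Eka p Hp) as VJ.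
  pose proof (var_J_shift D HD W V h phi G (Yl s1) (xi_f s1 g) (wl s1) N1 k Eka Eku p Hp) as VS.
  fold ev in Vf0, Vf1, Vf2.
  assert (Exi : forall e, ff (cfac (conformal_factor (gvar W V h k e))) (Yl s2) (Tl s2) (wl s2) = xi_f s2 (gvar W V h k e))
    by (intros e; symmetry; apply xi_f_ff).
  assert (X0 : isd (fun e => xi_f s2 (gvar W V h k e) p) 0 (ev p)).
  { eapply isd_ext; [ | exact Vf0 ]. intros e; cbv beta. rewrite Exi; auto. }
  assert (X1 : forall m, m <> ir -> isd (fun e => pd m (xi_f s2 (gvar W V h k e)) p) 0 (pd m ev p)).
  { intros m' Nm. eapply isd_ext; [ | exact (Vf1 m' Nm) ]. intros e; cbv beta. rewrite Exi; auto. }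
  assert (X2 : isd (fun e => pd hol (pd ahol (xi_f s2 (gvar W V h k e))) p) 0 (pd hol (pd ahol ev) p)).
  { eapply isd_ext; [ | exact (Vf2 hol ahol ltac:(discriminate) ltac:(discriminate)) ].
    intros e; cbv beta. rewrite Exi; auto. }
  clear Vf0 Vf1 Vf2 Exi BX.
  destruct m as [| |A].
  - exact X0.
  - assert (Y1 := isd_mul _ _ _ _ _ (isd_const (- RtoC (pr p)) 0) (X1 iu ltac:(discriminate))).
    assert (Y2 := isd_mul _ _ _ _ _ (isd_const (RtoC (/ 2)) 0)
      (isd_mul _ _ _ _ _ (isd_mul _ _ _ _ _ (isd_const (RtoC 4) 0) Ve) X2)).
    assert (Y3 := fun A : ang => isd_mul _ _ _ _ _ (X1 A ltac:(discriminate)) (VS A)).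
    assert (Y := isd_add _ _ _ _ _ (isd_add _ _ _ _ _ Y1 Y2) (isd_add _ _ _ _ _ (Y3 hol) (Y3 ahol))).
    eapply isd_eq; [ eapply isd_ext; [ | exact Y ] | ].
    + intros e. cbv beta. unfold xi, laplacian, sum2.
      change (int_to_scri (shift_of (gvar W V h k e) hol) p) with (J (shift_of (gvar W V h k e) hol) p).
      change (int_to_scri (shift_of (gvar W V h k e) ahol) p) with (J (shift_of (gvar W V h k e) ahol) p).
      unfold cfac. rewrite (RtoC_mult 4). ring.
    + cbv beta. rewrite ge0. unfold Vf, flap. unf.
      rewrite !J_shift by auto.
      repeat first [ rewrite fadd_e | rewrite fmul_e | rewrite fopp_e | rewrite fcst_e ].
      unfold rr, ofR. rewrite RtoC_mult. replace (RtoC (-2)) with (- RtoC 2)%C by (rewrite <- RtoC_opp; auto). ring.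
  - assert (Y3 := fun B : ang => isd_mul _ _ _ _ _ (X1 B ltac:(discriminate)) (VJ A B)).
    assert (Y := isd_add _ _ _ _ _ (isd_const (Yl s2 A p) 0)
      (isd_mul _ _ _ _ _ (isd_const (- (1))%C 0) (isd_add _ _ _ _ _ (Y3 hol) (Y3 ahol)))).
    eapply isd_eq; [ eapply isd_ext; [ | exact Y ] | ].
    + intros e. cbv beta. unfold xi, sum2.
      change (int_to_scri (ginv (gvar W V h k e) A hol) p) with (J (ginv (gvar W V h k e) A hol) p).
      change (int_to_scri (ginv (gvar W V h k e) A ahol) p) with (J (ginv (gvar W V h k e) A ahol) p).
      unfold Yl, lift_z. ring.
    + cbv beta. rewrite ge0. unfold Vf. unf.
      repeat first [ rewrite fadd_e | rewrite fmul_e | rewrite fopp_e | rewrite fcst_e ].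
      unfold gi. ring.
Qed.

Theorem closed_bracket s1 s2 : datum s1 -> datum s2 ->
  is_modified_bracket D (xi s1) (xi s2) g (xi (bms_bracket s1 s2) g).
Proof.
  intros H1 H2.
  set (e12 := fvar ph (Yl s2) (Tl s2) (wl s2) (wl s1)).
  set (e21 := fvar ph (Yl s1) (Tl s1) (wl s1) (wl s2)).
  exists (Vf W V h phi (Xf W V h phi (Yl s1) (xi_f s1 g)) (wl s1) e12 (xi_f s2 g)),
    (Vf W V h phi (Xf W V h phi (Yl s2) (xi_f s2 g)) (wl s2) e21 (xi_f s1 g)).
  split; [ apply variation; auto | split; [ apply variation; auto | ] ].
  intros m p Hp. set (s := bms_bracket s1 s2).
  pose proof (gen_of_datum s1 H1) as N1. pose proof (gen_of_datum s2 H2) as N2.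
  pose proof (dt_Y _ H1) as SY1. pose proof (dt_Y _ H2) as SY2. pose proof (dt_T _ H1) as ST1.
  pose proof (dt_T _ H2) as ST2. pose proof (dt_w _ H1) as Sw1. pose proof (dt_w _ H2) as Sw2.
  pose proof (ng_phi _ _ _ _ _ G) as Sph.
  assert (EY : forall A q, Yl s A q = fsub (fsum2 (fun B => fmul (Yl s1 B) (pd B (Yl s2 A))))
     (fsum2 (fun B => fmul (Yl s2 B) (pd B (Yl s1 A)))) q).
  { intros A q.
    change (Yl s A q) with (sum2 (fun B => tY s1 B (pz q) * dz B (tY s2 A) (pz q) - tY s2 B (pz q) * dz B (tY s1 A) (pz q))%C).
    unfold sum2. rewrite !dz_pd. unf. repeat first [ rewrite fadd_e | rewrite fmul_e | rewrite fopp_e | rewrite fcst_e ].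
    unfold Yl, lift_z. ring. }
  assert (ET : forall q, Tl s q = (sum2 (fun A => Yl s1 A q * pd A (Tl s2) q - Yl s2 A q * pd A (Tl s1) q)
    + RtoC (/ 2) * (Tl s1 q * sum2 (fun A => pd A (Yl s2 A) q) - Tl s2 q * sum2 (fun A => pd A (Yl s1 A) q)))%C).
  { intros q.
    change (Tl s q) with (sum2 (fun A => tY s1 A (pz q) * dz A (tT s2) (pz q) - tY s2 A (pz q) * dz A (tT s1) (pz q))
      + RtoC (/ 2) * (tT s1 (pz q) * sum2 (fun A => dz A (tY s2 A) (pz q)) - tT s2 (pz q) * sum2 (fun A => dz A (tY s1 A) (pz q))))%C.
    unfold sum2. rewrite !dz_pd. unfold Yl, Tl, lift_z. ring. }
  assert (SY : forall A, smooth (cyl D) (Yl s A)).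
  { intros A. eapply (sm_ext (cyl D) OC); [ intros q _; symmetry; apply EY | ]. unf. sm. }
  assert (ST : smooth (cyl D) (Tl s)).
  { apply (sm_ext (cyl D) OC (fadd (fsum2 (fun A => fsub (fmul (Yl s1 A) (pd A (Tl s2))) (fmul (Yl s2 A) (pd A (Tl s1)))))
      (fmul (fcst (RtoC (/ 2))) (fsub (fmul (Tl s1) (fsum2 (fun A => pd A (Yl s2 A)))) (fmul (Tl s2) (fsum2 (fun A => pd A (Yl s1 A)))))))).
    - intros q _. rewrite ET. unfold sum2. unf.
      repeat first [ rewrite fadd_e | rewrite fmul_e | rewrite fopp_e | rewrite fcst_e ]. ring.
    - unf. sm. }
  assert (Sw : smooth (cyl D) (wl s)) by (exact (sm_cst (cyl D) OC 0%C)).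
  assert (rf : forall t1 t2, rindep (fvar ph (Yl t2) (Tl t2) (wl t2) (wl t1))).
  { intros t1 t2. apply rindep_fvar; intros; solve [ apply rindep_z | apply rindep_uz ]. }
  assert (Se12 : smooth (cyl D) e12) by (apply smooth_fvar; auto).
  assert (Se21 : smooth (cyl D) e21) by (apply smooth_fvar; auto).
  assert (EY' : forall A q, D q -> Yl s A q = sum2 (fun B => Yl s1 B q * pd B (Yl s2 A) q - Yl s2 B q * pd B (Yl s1 A) q)%C).
  { intros A q Hq. rewrite EY. unfold sum2. unf.
    repeat first [ rewrite fadd_e | rewrite fmul_e | rewrite fopp_e | rewrite fcst_e ]. ring. }
  (* The rescaling component of [s] is zero by computation, which is the case treated by
     [ff_bracket]. *)
  assert (Ef : forall q, D q -> xi_f s g q = Uexp (Yl s1) (Yl s2) (xi_f s1 g) (xi_f s2 g) e12 e21 q).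
  { intros q Hq. rewrite (xi_f_eq s1), (xi_f_eq s2), (xi_f_eq s).
    change (wl s) with (fcst 0%C).
    apply (ff_bracket (cyl D) OC US ph Sph); auto using cyl_sub; intros; apply pd_u_z. }
  rewrite xi_eq by auto.
  rewrite <- (closure D HD W V h phi G (Yl s1) (Yl s2) (Yl s) (xi_f s1 g) (xi_f s2 g) (wl s1) (wl s2) e12 e21 (xi_f s g) N1 N2
    Se12 Se21 (rf s1 s2) (rf s2 s1) (fun A => rindep_z _) SY EY' (sc_xi_f s SY ST Sw) (rindep_xi_f s) Ef m p Hp).
  f_equal. f_equal. rewrite flie_eq. unfold lie_bracket, sum4, sum2.
  assert (E : forall t l i, pd l (xi t g i) p = pd l (Xf W V h phi (Yl t) (xi_f t g) i) p)
    by (intros t l i; apply (pd_ext D O); auto; intros; apply xi_eq; auto).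
  rewrite !E, !xi_eq by auto. reflexivity.
Qed.
End Main.

(** * From the stated hypotheses to the working form *)

Lemma smooth_pds D l F : opn D -> smooth D F -> smooth D (pds l F).
Proof. intros O H. induction l; simpl; [ auto | sm ]. Qed.

Lemma symb_of_bigO D n F : dom D -> smooth D F -> bigO D n F -> symb D n F.
Proof.
  intros HD HS HF k. pose proof (dom_open _ HD). apply Ck_of_pds; auto using SB_bclass.
  { intros l. apply smooth_base, smooth_pds; auto. }
  intros l p Hp. destruct (HF l p Hp) as [K HK]. apply near_scri_nsc in HK.
  exists (Rabs K); split; [ apply Rabs_pos | ].
  generalize (nsc_and _ _ _ HK (nsc_r p 1)). apply nsc_imp.
  intros [[u r] z] [A [L _]]. cbn in *. eapply Rle_trans; [ exact A | ].
  apply Rmult_le_compat_r; [ left; apply powerRZ_lt; lra | apply Rle_abs ].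
Qed.

Lemma dom_of_coordinate_domain D : coordinate_domain D -> dom D /\ ustar (cyl D).
Proof.
  intros (A & B & E). split; [ split | ].
  - apply opn_open, A.
  - intros [[u r] z] [[u' r'] z'] Hp E1 E2 L. cbn in *. subst. eapply B; eauto.
  - intros q t [s Hs] Ht. destruct q as [[u r] z]. destruct (E u s z t Hs Ht) as [r' Hr'].
    exists r'. exact Hr'.
Qed.

Lemma smooth_gam D phi A B : opn D -> smooth D (ofR (cfac phi)) -> smooth D (gam phi A B).
Proof.
  intros O S.
  assert (S2 : smooth D (ofR (fun p => 2 * cfac phi p))).
  { apply (sm_ext D O (fmul (fcst (RtoC 2)) (ofR (cfac phi)))); [ | sm ].
    intros q _. rewrite fmul_e, fcst_e. unfold ofR. rewrite RtoC_mult; auto. }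
  pose proof (sm_exp D O (fun p => 2 * cfac phi p) S2) as S3.
  destruct A, B.
  1, 4: apply (sm_ext D O (fcst 0%C)); [ intros; rewrite gam_eq; auto | sm ].
  all: apply (sm_ext D O (fmul (fcst (RtoC (/ 2))) (ofR (fun p => exp (2 * cfac phi p)))));
    [ intros; rewrite gam_eq; auto | sm ].
Qed.

(** The definition of the metrics asserts that some [phi0] exists, while [xi] uses the conformal
    factor extracted from the metric by a limit. The two agree on the cylinder, so the expansions
    carry over to the extracted one. *)
Lemma geometry_of_newman_unti D W V h : dom D -> newman_unti D W V h ->
  NUgeom D W V h (conformal_factor (nu_metric W V h)).
Proof.
  intros HD ((HW & _) & HV & _ & Hh & Hs & _ & Hd & phi0 & S & Hphi & HS & Hlo & _ & HVO & HWO).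
  pose proof (dom_open _ HD) as O. pose proof (cyl_opn D O) as OC.
  set (phi := conformal_factor (nu_metric W V h)).
  assert (smW : smooth D W) by (apply smooth_of_smooth_on; auto).
  assert (smh : forall A B, smooth D (h A B)) by (intros; apply smooth_of_smooth_on; auto).
  assert (smP : smooth D (ofR (cfac phi0))) by (apply smooth_of_smooth_on; auto).
  assert (rP : rindep (ofR (cfac phi0))) by (intros ? ?; reflexivity).
  assert (scP : smooth (cyl D) (ofR (cfac phi0))) by (apply smooth_cyl; auto).
  assert (soS : forall A B, symb D 0 (lift_uz (S A B))).
  { intros A B. apply rindep_symb; auto using rindep_uz. apply smooth_cyl; auto using rindep_uz.
    apply smooth_of_smooth_on; auto. }
  assert (smrr : smooth D rr) by (apply sm_rr; auto).
  assert (soH0 : forall A B, symb D 1 (hrem phi0 h A B)).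
  { intros A B. pose proof (smooth_gam D phi0 A B O smP). pose proof (symb_smooth _ _ _ (soS A B)).
    set (F := fun p => (h A B p - RtoC (pr p ^ 2) * gam phi0 A B p - RtoC (pr p) * S A B (pu p) (pz p))%C).
    assert (EF : forall p, F p = fsub (hrem phi0 h A B) (fmul rr (lift_uz (S A B))) p).
    { intros p. unfold F, hrem. unf. repeat first [ rewrite fadd_e | rewrite fmul_e | rewrite fopp_e ].
      unfold rr, lift_uz. simpl pow. rewrite Rmult_1_r, RtoC_mult. ring. }
    assert (soF : symb D 1 F).
    { apply symb_of_bigO; auto.
      - apply (sm_ext D O (fsub (hrem phi0 h A B) (fmul rr (lift_uz (S A B))))); auto.
        unfold hrem; unf. sm.
      - apply bigO_of_littleo, Hlo. }
    apply (so_ext D HD _ (fadd F (fmul rr (lift_uz (S A B))))).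
    - intros p _. rewrite fadd_e, EF. unf. repeat first [ rewrite fadd_e | rewrite fmul_e | rewrite fopp_e ]. ring.
    - so. }
  (* The unperturbed case [c = 1] of [cf_of_lead], where [ln c = 0]. *)
  assert (Ephi : forall q, cyl D q -> cfac phi q = cfac phi0 q).
  { intros q Hq. unfold cfac at 1, phi.
    rewrite (cf_of_lead D (nu_metric W V h) phi0 1 (hrem phi0 h hol ahol) q); auto; [ rewrite ln_1; ring | lra | ].
    intros r _. change (nu_metric W V h hol ahol) with (h hol ahol). rewrite (h_split h phi0 hol ahol).
    rewrite fadd_e, !fmul_e, gam_eq, fmul_e, fcst_e.
    change (ofR (fun p => exp (2 * cfac phi0 p)) (set_coord dr q r)) with (RtoC (exp (2 * cfac phi0 q))).
    change (rr (set_coord dr q r)) with (RtoC r).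
    rewrite Rmult_1_r, <- !RtoC_mult. f_equal. f_equal. field. }
  assert (EofR : forall q, cyl D q -> ofR (cfac phi0) q = ofR (cfac phi) q)
    by (intros q Hq; unfold ofR; rewrite Ephi; auto).
  split; auto.
  - apply (sm_ext (cyl D) OC (ofR (cfac phi0))); auto.
  - intros A B. apply (so_ext D HD _ (hrem phi0 h A B)); auto. intros q Hq. unfold hrem. unf.
    rewrite !fadd_e, !fopp_e, !fmul_e, !gam_eq. destruct A, B; auto;
    rewrite !fmul_e; unfold ofR; rewrite Ephi by (apply cyl_sub; auto); auto.
  - intros A. apply symb_of_bigO; auto. apply smooth_of_smooth_on; auto.
  - set (lap := fmul (fmul (fcst (RtoC 4)) (ofR (fun p => exp (-2 * cfac phi0 p)))) (pd hol (pd ahol (ofR (cfac phi0))))).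
    assert (S2 : smooth (cyl D) (ofR (fun p => -2 * cfac phi0 p))).
    { apply (sm_ext (cyl D) OC (fmul (fcst (RtoC (-2))) (ofR (cfac phi0)))); [ | sm ].
      intros q _. rewrite fmul_e, fcst_e. unfold ofR. rewrite RtoC_mult; auto. }
    pose proof (sm_exp (cyl D) OC (fun p => -2 * cfac phi0 p) S2) as S3.
    assert (rl : rindep lap).
    { unfold lap. apply rindep_mul; [ intros ? ?; reflexivity | auto with sm ]. }
    assert (sl : smooth (cyl D) lap) by (unfold lap; sm).
    pose proof (rindep_symb D lap HD rl sl) as sol. pose proof (symb_smooth _ _ _ sol) as sml.
    set (F := fun p => (W p - (RtoC (- 2 * pr p) * pd iu (lift_R phi0) p + laplacian phi0 (lift_R phi0) p))%C).
    assert (EF : forall p, F p = fsub (Wrem phi0 W) lap p).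
    { intros p. unfold F, Wrem, lap, laplacian. unf.
      change (lift_R phi0) with (ofR (cfac phi0)).
      repeat first [ rewrite fadd_e | rewrite fmul_e | rewrite fopp_e | rewrite fcst_e ].
      unfold rr. rewrite !RtoC_mult.
      change (ofR (fun p0 => exp (-2 * cfac phi0 p0)) p) with (RtoC (exp (- 2 * phi0 (pu p) (pz p)))).
      replace (RtoC (-2)) with (- RtoC 2)%C by (rewrite <- RtoC_opp; auto). ring. }
    assert (soF : symb D (-1) F).
    { apply symb_of_bigO; auto. apply (sm_ext D O (fsub (Wrem phi0 W) lap)); auto. unfold Wrem; unf. sm. }
    apply (so_ext D HD _ (fadd F lap)); [ | so ].
    intros p Hp. rewrite fadd_e, EF. unfold Wrem. unf.
    repeat first [ rewrite fadd_e | rewrite fmul_e | rewrite fopp_e | rewrite fcst_e ].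
    rewrite (pd_ext (cyl D) OC iu (ofR (cfac phi)) (ofR (cfac phi0))) by (auto using cyl_sub; intros; symmetry; auto). ring.
Qed.

Lemma datum_of_admissible D W V h s : dom D -> admissible D (nu_metric W V h) s -> datum D s.
Proof.
  intros HD (SY & _ & [la CK] & ST & _ & Sw & Rw). pose proof (dom_open _ HD) as O.
  assert (SYD : forall A, smooth D (Yl s A)) by (intros; apply smooth_of_smooth_on; auto; apply SY).
  split.
  - intros A. apply smooth_cyl; auto. apply rindep_z.
  - apply smooth_cyl; auto; [ apply rindep_z | apply smooth_of_smooth_on; auto ].
  - apply smooth_cyl; auto; [ apply rindep_uz | apply smooth_of_smooth_on; auto ].
  - intros q [t Ht]. specialize (Rw _ Ht). change (lift_uz (tw s) (set_coord dr q t)) with (wl s q) in Rw.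
    apply (f_equal Im) in Rw. unfold Im in *. simpl in Rw. lra.
  - intros A q [t Ht]. rewrite <- (rindep_pd (abar A) (Yl s A) (rindep_z _) q t).
    (* A diagonal component of the conformal Killing equation: [gam] has no diagonal, so the right
       side and the transport term vanish, and there remains twice an invertible entry of [gam]
       times the [abar A] derivative of [Y^A]. This is holomorphy of [Y]. *)
    specialize (CK (abar A) (abar A) _ Ht). revert CK. unfold sum2.
    set (x := set_coord dr q t). set (phi := conformal_factor (nu_metric W V h)).
    assert (Z : forall B, gam phi B B = fcst 0%C) by (intros []; reflexivity).
    rewrite !Z, !pd_cst.
    assert (N : gam phi (abar A) A x <> 0%C).
    { assert (E : gam phi (abar A) A x = RtoC (exp (2 * phi (pu x) (pz x)) / 2)) by (destruct A; reflexivity).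
      rewrite E. intros K. apply RtoC_inj in K. pose proof (exp_pos (2 * phi (pu x) (pz x))). lra. }
    change (fun p : pt => tY s hol (pz p)) with (Yl s hol).
    unfold fcst. intros CK.
    assert (E : (gam phi (abar A) A x * pd (abar A) (Yl s A) x * 2)%C = 0%C).
    { unfold Yl. destruct A; simpl abar in *.
      - change (gam phi hol ahol x) with (gam phi ahol hol x) in CK. rewrite Z in CK. unfold fcst in CK.
        transitivity (la x * 0)%C; [ rewrite <- CK; ring | ring ].
      - change (gam phi ahol hol x) with (gam phi hol ahol x) in CK. rewrite Z in CK. unfold fcst in CK.
        transitivity (la x * 0)%C; [ rewrite <- CK; ring | ring ]. }
    assert (N2 : RtoC 2 <> 0%C) by (intros K; apply RtoC_inj in K; lra).
    transitivity (/ gam phi (abar A) A x * / 2 * (gam phi (abar A) A x * pd (abar A) (Yl s A) x * 2))%C.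
    + field; auto.
    + rewrite E; ring.
Qed.

Theorem theorem2p1 (D : pt -> Prop) (W : pt -> C) (V : ang -> pt -> C)
    (h : ang -> ang -> pt -> C) (s1 s2 : triple)
    (HD : coordinate_domain D)
    (Hg : newman_unti D W V h)
    (H1 : admissible D (nu_metric W V h) s1)
    (H2 : admissible D (nu_metric W V h) s2) :
  is_modified_bracket D (xi s1) (xi s2) (nu_metric W V h)
    (xi (bms_bracket s1 s2) (nu_metric W V h)).
Proof.
  destruct (dom_of_coordinate_domain D HD) as [HD' US].
  apply (closed_bracket D HD' US W V h).
  - apply geometry_of_newman_unti; auto.
  - apply (datum_of_admissible D W V h s1); auto.
  - apply (datum_of_admissible D W V h s2); auto.
Qed.
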